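(* Let $C$ be any log-space uniform layered arithmetic circuit of fan-in 2 over a finite field $\mathbb F$, of size $S(n)$ and depth $d(n)$, where $n$ is the number of inputs. When the Goldwasser–Kalai–Rothblum circuit-checking protocol (described in the context) is applied to $C$ and instantiated with multilinear extensions of the wiring predicates and gate-value functions, the honest prover $\mathcal P$ requires $O(S(n)\log S(n))$ time over the entire execution; the verifier $\mathcal V$ requires space $O(d(n)\log S(n))$ and time $O(\mathrm{poly}(S(n)))$ in a non-interactive, data-independent preprocessing phase (performed before the input is seen, knowing an upper bound on the input length), and only space $O(d(n)\log S(n))$ and time $O(n\log n+d(n)\log S(n))$ in the online interactive phase, where the $O(n\log n)$ term is the time to evaluate the low-degree extension of the input at a point.
   Context: An arithmetic circuit over $\mathbb F$ has input gates and gates computing $+$ or $\times$ of two inputs. It is layered with depth $d$: layer $0$ is the output, layer $d$ consists of the inputs, and every gate at layer $i-1$ takes its two inputs from layer $i$. Gates within a layer are labelled by strings in $\{0,1\}^v$. The wiring predicates for $1\le i\le d$ are $\mathrm{add}_i,\mathrm{mult}_i:\{0,1\}^{3v}\to\{0,1\}$, where $\mathrm{add}_i(a,b,c)=1$ iff gate $a$ at layer $i-1$ is an addition gate with inputs gates $b,c$ at layer $i$ (similarly $\mathrm{mult}_i$). $V_i:\{0,1\}^v\to\mathbb F$ gives gate values at layer $i$. The multilinear extension $\tilde g$ of $g:\{0,1\}^k\to\mathbb F$ is the unique polynomial of degree at most one in each variable agreeing with $g$ on $\{0,1\}^k$. Log-space uniform: the circuit's description is generable in space $O(\log S(n))$.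 The protocol: $\mathcal P$ claims the output value; for $i=1,\dots,d$ the parties run the sum-check protocol on $f_i(p,\omega_1,\omega_2)=\beta(p)\big(\widetilde{\mathrm{add}}_i(p,\omega_1,\omega_2)(\tilde V_i(\omega_1)+\tilde V_i(\omega_2))+\widetilde{\mathrm{mult}}_i(p,\omega_1,\omega_2)\tilde V_i(\omega_1)\tilde V_i(\omega_2)\big)$ ($\beta$ a fixed polynomial depending only on $p$ and earlier randomness), reducing a claim about $\tilde V_{i-1}$ at a random point to a claim about $\tilde V_i$ at a random point; $\mathcal V$ must evaluate $\widetilde{\mathrm{add}}_i,\widetilde{\mathrm{mult}}_i$ at points determined by its random coins. Finally $\mathcal V$ checks the claim about $\tilde V_d$, the multilinear (low-degree) extension of the input, evaluated by $\mathcal V$ itself. Space is in field elements (words). *)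

(* Defs.v *)
From HB Require Import structures.
From mathcomp Require Import all_boot all_order all_algebra.
From mathcomp Require Import mpoly.
Set Implicit Arguments.
Unset Strict Implicit.
Unset Printing Implicit Defensive.
Import GRing.Theory.
Local Open Scope ring_scope.

(* [(true, b, c)] multiplies, and [(false, b, c)] adds, the gates [b] and [c]
   of the next layer. *)
Definition gate := (bool * nat * nat)%type.

(* The layers of operation gates, output layer first; the input layer is not
   listed.  A circuit contains no field constants, so the same circuit can be
   evaluated over every field. *)
Definition circuit := seq (seq gate).

Definition depth (C : circuit) : nat := size C.

Section Circuit.
Variables (n : nat) (C : circuit).

Definition width (i : nat) : nat :=
  if (i < depth C)%N then size (nth [::] C i) else n.

Definition csize : nat := (\sum_(i < (depth C).+1) width i)%N.

Definition wf_circuit : Prop :=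
  [/\ (0 < depth C)%N,
      width 0 = 1%N,
      forall i, (0 < width i)%N
    & forall i mul b c, (mul, b, c) \in nth [::] C i ->
        (b < width i.+1)%N /\ (c < width i.+1)%N].

(* Length of the labels of layer [i]. *)
Definition lab (i : nat) : nat := up_log 2 (width i).

Definition description : seq nat :=
  depth C :: [seq width i | i <- iota 0 (depth C).+1] ++
  flatten [seq [:: nat_of_bool g.1.1; g.1.2; g.2] | g <- flatten C].

End Circuit.

(* [None] is the separator; binary digits come least significant first. *)
Definition encode (s : seq nat) : seq (option bool) :=
  flatten [seq rcons [seq Some (odd (k %/ 2 ^ j)%N) | j <- iota 0 (up_log 2 k.+1)]
                     None | k <- s].

Inductive move := Left | Stay | Right.

Definition moved (m : move) (k : nat) : nat :=
  match m with Left => k.-1 | Stay => k | Right => k.+1 end.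

(* Deterministic Turing machine with a read-only two-way input tape holding
   [1^n], a work tape infinite to the right, and a write-only one-way output
   tape.  The two booleans read by [tm_delta] tell whether the input head is on
   the first cell, respectively on the end marker; [None] means halting. *)
Record tm := TM {
  tm_state : finType;
  tm_sym : finType;
  tm_blank : tm_sym;
  tm_start : tm_state;
  tm_delta : tm_state -> bool -> bool -> tm_sym ->
    option (tm_state * tm_sym * move * move * option (option bool)) }.

Record tm_config (M : tm) := TMConfig {
  tm_q : tm_state M;
  tm_inpos : nat;
  tm_pos : nat;
  tm_tape : nat -> tm_sym M;
  tm_out : seq (option bool) }.

Definition upd (T : Type) (f : nat -> T) (k : nat) (v : T) : nat -> T :=
  fun j => if j == k then v else f j.

Section TuringMachine.
Variables (M : tm) (n : nat).

Definition tm_init : tm_config M :=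
  TMConfig (tm_start M) 0 0 (fun=> tm_blank M) [::].

Definition tm_next (c : tm_config M) : option (tm_config M) :=
  match tm_delta (tm_q c) (tm_inpos c == 0)%N (tm_inpos c == n)%N
                 (tm_tape c (tm_pos c)) with
  | None => None
  | Some (q, a, mi, mw, o) =>
      Some (TMConfig q (minn n (moved mi (tm_inpos c))) (moved mw (tm_pos c))
                     (upd (tm_tape c) (tm_pos c) a) (tm_out c ++ seq_of_opt o))
  end.

Inductive tm_generates (s : nat) : tm_config M -> seq (option bool) -> Prop :=
| tm_halt c : (tm_pos c < s)%N -> tm_next c = None ->
    tm_generates s c (tm_out c)
| tm_step c c' out : (tm_pos c < s)%N -> tm_next c = Some c' ->
    tm_generates s c' out -> tm_generates s c out.

End TuringMachine.

Definition logspace_uniform (C : nat -> circuit) : Prop :=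
  exists (M : tm) (K : nat), forall n, (0 < n)%N ->
    tm_generates n (K * up_log 2 (csize n (C n)))%N (tm_init M)
                 (encode (description n (C n))).

Definition cube (k : nat) := {ffun 'I_k -> bool}.

Definition label (k : nat) (b : cube k) : nat := (\sum_(j < k) b j * 2 ^ j)%N.

Section MultilinearExtension.
Variables (F : fieldType) (k : nat).
Implicit Types (g : cube k -> F) (p : {mpoly F[k]}).

Definition multilinear p : Prop :=
  forall m : 'X_{1..k}, m \in msupp p -> forall j, (m j <= 1)%N.

Definition extends p g : Prop := forall b : cube k, p.@[fun j => (b j)%:R] = g b.

Definition mle g : {mpoly F[k]} :=
  \sum_(b : cube k) g b *: \prod_(j < k) (if b j then 'X_j else 1 - 'X_j).

Lemma multilinear_mle g : multilinear (mle g).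
Proof.
have XP (e : cube k) : \prod_(j < k) ('X_j ^+ e j : {mpoly F[k]})
    = 'X_[[multinom (e j : nat) | j < k]].
  by rewrite mpolyXE_id; apply: eq_bigr => j _; rewrite mnmE.
have split (b : bool) (j : 'I_k) : (if b then 'X_j else 1 - 'X_j)
    = \sum_(e : bool) (if b then e%:R else (-1) ^+ e) *: 'X_j ^+ e :> {mpoly F[k]}.
  rewrite big_bool; case: b => /=.
    by rewrite scale1r expr1 scale0r addr0.
  by rewrite !expr1 !expr0 scaleN1r scale1r addrC.
move=> m; rewrite mcoeff_msupp => nz j; rewrite leqNgt; apply: contra nz => mj.
rewrite /mle raddf_sum big1 //= => b _; rewrite mcoeffZ.
rewrite (eq_bigr _ (fun j _ => split (b j) j)) bigA_distr_bigA raddf_sum.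
rewrite big1 ?mulr0 //= => e _; rewrite scaler_prod XP mcoeffZ mcoeffX.
case: eqP => [em|_]; last by rewrite mulr0.
by move: mj; rewrite -em mnmE; case: (e j).
Qed.

Lemma extends_mle g : extends (mle g) g.
Proof.
move=> b; rewrite /mle raddf_sum (bigD1 b) //= mevalZ rmorph_prod big1 ?mulr1.
  rewrite big1 ?addr0 // => c /eqP cb; rewrite mevalZ rmorph_prod.
  have /existsP[j cj] : [exists j, c j != b j].
    apply: contra_notT cb => /existsPn H.
    by apply/ffunP => j; apply/eqP/negPn/H.
  rewrite (bigD1 j) //= (_ : meval _ _ = 0) ?mul0r ?mulr0 //.
  move: cj; case: (c j); case E: (b j) => //= _.
    by rewrite mevalXU E.
  by rewrite rmorphB rmorph1 /= mevalXU E subrr.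
move=> j _; case E: (b j) => /=; first by rewrite mevalXU E.
by rewrite rmorphB rmorph1 /= mevalXU E subr0.
Qed.

Lemma mle_unique g p : multilinear p -> extends p g -> p = mle g.
Proof.
move=> mp pg; have -> : mle g = mle (fun b : cube k => p.@[fun j => (b j)%:R]).
  by apply: eq_bigr => b _; rewrite pg.
rewrite {1}[p]mpolyE /mle.
under [RHS]eq_bigr => b _ do rewrite mevalE scaler_suml.
rewrite exchange_big /= !big_seq; apply: eq_bigr => m /mp m1.
under [RHS]eq_bigr => b _ do rewrite -scalerA.
rewrite -scaler_sumr; congr (_ *: _).
under [RHS]eq_bigr => b _ do rewrite -scaler_prod.
rewrite -(bigA_distr_bigA (fun j (e : bool) =>
  ((e%:R : F) ^+ m j) *: (if e then 'X_j else 1 - 'X_j : {mpoly F[k]}))).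
rewrite mpolyXE_id; apply: eq_bigr => j _; rewrite big_bool /=.
rewrite expr1n scale1r; move: (m1 j); case: (m j) => [|[|//]] _.
  by rewrite !expr0 scale1r addrC subrK.
by rewrite !expr1 scale0r addr0.
Qed.

End MultilinearExtension.

Section Protocol.
Variables (F : fieldType) (n : nat) (C : circuit).

Notation v := (lab n C).

(* The sum-check relating layer [i] to layer [i.+1] runs over the label of a
   gate of layer [i] and the labels of its two inputs. *)
Definition nvars (i : nat) : nat := (v i + (v i.+1 + v i.+1))%N.

Section Layer.
Variable i : nat.

Definition ip (j : 'I_(v i)) : 'I_(nvars i) := lshift _ j.
Definition i1 (j : 'I_(v i.+1)) : 'I_(nvars i) := rshift _ (lshift _ j).
Definition i2 (j : 'I_(v i.+1)) : 'I_(nvars i) := rshift _ (rshift _ j).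

(* [wiring false] and [wiring true] are the predicates add and mult between
   layers [i] and [i.+1]. *)
Definition wiring (mul : bool) : cube (nvars i) -> F := fun s =>
  (onth (nth [::] C i) (label [ffun j => s (ip j)])
   == Some (mul, label [ffun j => s (i1 j)], label [ffun j => s (i2 j)]))%:R.

End Layer.

Arguments wiring i mul _ : clear implicits.

Definition gate_value (vs : seq F) (g : gate) : F :=
  if g.1.1 then vs`_g.1.2 * vs`_g.2 else vs`_g.1.2 + vs`_g.2.

(* An input shorter than [n] is padded with zeros by [nth]. *)
Definition layer_values (x : seq F) (i : nat) : seq F :=
  foldr (fun l vs => map (gate_value vs) l) x (drop i C).

Definition layer_fun (x : seq F) (i : nat) : cube (v i) -> F := fun b =>
  (layer_values x i)`_(label b).

Arguments layer_fun x i _ : clear implicits.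

Definition beta (i : nat) (z : nat -> F) : {mpoly F[nvars i]} :=
  \prod_(j < v i) ((z j)%:MP * 'X_(ip j) + (1 - z j)%:MP * (1 - 'X_(ip j))).

Definition sumcheck_poly (x : seq F) (i : nat) (z : nat -> F) :
    {mpoly F[nvars i]} :=
  let V1 := mle (layer_fun x i.+1) \mPo [tuple 'X_(i1 j) | j < v i.+1] in
  let V2 := mle (layer_fun x i.+1) \mPo [tuple 'X_(i2 j) | j < v i.+1] in
  beta i z * (mle (wiring i false) * (V1 + V2)
              + mle (wiring i true) * (V1 * V2)).

(* Honest message of round [j] of the sum-check protocol for [f]: the variables
   before [j] are set to the challenges [r], and those after [j] are summed
   over the cube. *)
Definition round_poly (m : nat) (f : {mpoly F[m]}) (r : nat -> F) (j : nat) :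
    {poly F} :=
  \sum_(b : cube m | [forall k : 'I_m, (k <= j)%N ==> ~~ b k])
    mmap (@polyC F) (fun k : 'I_m =>
      if (k < j)%N then (r k)%:P
      else if (k == j :> nat) then 'X else ((b k)%:R)%:P) f.

Definition line (a b : nat -> F) (j : nat) : {poly F} :=
  (1 - 'X) * (a j)%:P + 'X * (b j)%:P.

Section Coins.
Variable coins : nat -> F. (* the verifier's challenges, in the order sent *)

Definition coin_start (i : nat) : nat := (\sum_(k < i) (nvars k).+1)%N.
Definition chal (i j : nat) : F := coins (coin_start i + j)%N.
Definition chal1 (i j : nat) : F := chal i (v i + j)%N.
Definition chal2 (i j : nat) : F := chal i (v i + v i.+1 + j)%N.
Definition line_chal (i : nat) : F := chal i (nvars i).

(* The point at which the multilinear extension of layer [i] is claimed; the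
   output layer has labels of length [0]. *)
Definition point (i j : nat) : F :=
  if i is i'.+1 then (line (chal1 i') (chal2 i') j).[line_chal i'] else 0.

(* The honest prover sends the output value and then, for each layer, the three
   coefficients of every sum-check polynomial (all of degree at most 2), the
   values of the next layer's extension at the two points reached, and the
   coefficients of its restriction to the line through these points. *)
Definition honest_layer (x : seq F) (i : nat) : seq F :=
  let f := sumcheck_poly x i (point i) in
  let W := mle (layer_fun x i.+1) in
  flatten [seq [seq (round_poly f (chal i) j)`_k | k <- iota 0 3]
          | j <- iota 0 (nvars i)]
  ++ [:: W.@[fun j => chal1 i j]; W.@[fun j => chal2 i j]]
  ++ [seq (mmap (@polyC F) (fun j => line (chal1 i) (chal2 i) j) W)`_k
     | k <- iota 0 (v i.+1).+1].

Definition honest_messages (x : seq F) : seq F :=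
  (layer_values x 0)`_0 :: flatten [seq honest_layer x i | i <- iota 0 (depth C)].

Section Messages.
Variable msgs : nat -> F. (* the prover's messages, in the order sent *)

Definition msg_start (i : nat) : nat :=
  (1 + \sum_(k < i) (3 * nvars k + 2 + (v k.+1).+1))%N.

Definition round_msg (i j : nat) : {poly F} :=
  \poly_(k < 3) msgs (msg_start i + 3 * j + k)%N.
Definition claim1 (i : nat) : F := msgs (msg_start i + 3 * nvars i)%N.
Definition claim2 (i : nat) : F := msgs (msg_start i + 3 * nvars i + 1)%N.
Definition line_msg (i : nat) : {poly F} :=
  \poly_(k < (v i.+1).+1) msgs (msg_start i + 3 * nvars i + 2 + k)%N.

(* The claim about layer [i] at [point i]. *)
Definition claim (i : nat) : F :=
  if i is i'.+1 then (line_msg i').[line_chal i'] else msgs 0.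

(* The value claimed for the sum left after [j] rounds. *)
Definition round_claim (i j : nat) : F :=
  if j is j'.+1 then (round_msg i j').[chal i j'] else claim i.

Definition layer_accepts (i : nat) : bool :=
  let r := fun j : 'I_(nvars i) => chal i j in
  [&& all (fun j => (round_msg i j).[0] + (round_msg i j).[1]
                    == round_claim i j) (iota 0 (nvars i)),
      round_claim i (nvars i)
      == (beta i (point i)).@[r]
         * ((mle (wiring i false)).@[r] * (claim1 i + claim2 i)
            + (mle (wiring i true)).@[r] * (claim1 i * claim2 i)),
      (line_msg i).[0] == claim1 i
    & (line_msg i).[1] == claim2 i].

Definition accepts (x : seq F) : bool :=
  all layer_accepts (iota 0 (depth C))
  && (claim (depth C)
      == (mle (layer_fun x (depth C))).@[fun j => point (depth C) j]).

(* The conversation; [true] marks what the prover sends. *)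
Definition layer_conversation (i : nat) : seq (bool * F) :=
  flatten [seq [seq (true, msgs (msg_start i + 3 * j + k)%N) | k <- iota 0 3]
               ++ [:: (false, chal i j)] | j <- iota 0 (nvars i)]
  ++ [seq (true, msgs (msg_start i + 3 * nvars i + k)%N)
     | k <- iota 0 (2 + (v i.+1).+1)%N]
  ++ [:: (false, line_chal i)].

Definition conversation : seq (bool * F) :=
  (true, msgs 0) :: flatten [seq layer_conversation i | i <- iota 0 (depth C)].

End Messages.
End Coins.
End Protocol.

Arguments wiring F n C i mul _ : clear implicits.
Arguments layer_fun {F} n C x i _.

(* A word RAM with field arithmetic.  Programs use finitely many integer and field registers, named by literals,
   and two memories, one of integer words and one of field elements.  Every
   instruction and every test takes one unit of time.  The operands of an
   instruction are names of registers, except for the constant of [ISet]. *)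
Inductive arith := Add | Sub | Mul | Div.
Inductive farith := FAdd | FSub | FMul.

Inductive instr :=
| ISet (r c : nat)                    (* r := c *)
| IOp (o : arith) (r a b : nat)
| ILoad (r a : nat)                   (* r := imem[register a] *)
| IStore (a r : nat)                  (* imem[register a] := r *)
| IInput (r a : nat)                  (* r := cell [register a] of the integer input *)
| FSet (r : nat) (c : bool)           (* r := 0 or 1 *)
| FOp (o : farith) (r a b : nat)
| FLoad (r a : nat)                   (* r := fmem[register a] *)
| FStore (a r : nat)                  (* fmem[register a] := r *)
| FInput (r a : nat)                  (* r := cell [register a] of the field input *)
| FRand (r : nat)                     (* r := next random field element *)
| FSend (r : nat)
| FRecv (r : nat).

Inductive prog :=
| Nop
| Do (i : instr)
| Seq (p q : prog)
| IfZero (r : nat) (p q : prog)       (* test of an integer register *)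
| IfFZero (r : nat) (p q : prog)      (* test of a field register *)
| WhileNZ (r : nat) (p : prog).

Definition arith_op (o : arith) : nat -> nat -> nat :=
  match o with Add => addn | Sub => subn | Mul => muln | Div => divn end.

Section Machine.
Variable F : fieldType.

Definition farith_op (o : farith) (x y : F) : F :=
  match o with FAdd => x + y | FSub => x - y | FMul => x * y end.

Record env := Env {
  iinput : seq nat;
  finput : seq F;
  random : nat -> F;
  inbox : nat -> F }.

(* [trace] records what was sent ([true]) and received ([false]), in order. *)
Record state := State {
  ireg : nat -> nat;
  freg : nat -> F;
  imem : nat -> nat;
  fmem : nat -> F;
  nrandom : nat;
  nreceived : nat;
  trace : seq (bool * F) }.

Definition start : state :=
  State (fun=> 0%N) (fun=> 0) (fun=> 0%N) (fun=> 0) 0 0 [::].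

(* [W] is the largest integer that fits in a word and [M] the number of cells of
   each memory; exceeding either makes the machine stuck. *)
Variables (E : env) (W M : nat).

Definition set_ireg (s : state) (r k : nat) : option state :=
  if (k <= W)%N then
    Some (State (upd (ireg s) r k) (freg s) (imem s) (fmem s)
                (nrandom s) (nreceived s) (trace s))
  else None.

Definition set_freg (s : state) (r : nat) (y : F) : state :=
  State (ireg s) (upd (freg s) r y) (imem s) (fmem s)
        (nrandom s) (nreceived s) (trace s).

Definition run_instr (i : instr) (s : state) : option state :=
  match i with
  | ISet r c => set_ireg s r c
  | IOp o r a b => set_ireg s r (arith_op o (ireg s a) (ireg s b))
  | ILoad r a =>
      if (ireg s a < M)%N then set_ireg s r (imem s (ireg s a)) else None
  | IStore a r =>
      if (ireg s a < M)%N then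
        Some (State (ireg s) (freg s) (upd (imem s) (ireg s a) (ireg s r))
                    (fmem s) (nrandom s) (nreceived s) (trace s))
      else None
  | IInput r a => set_ireg s r (nth 0%N (iinput E) (ireg s a))
  | FSet r c => Some (set_freg s r c%:R)
  | FOp o r a b => Some (set_freg s r (farith_op o (freg s a) (freg s b)))
  | FLoad r a =>
      if (ireg s a < M)%N then Some (set_freg s r (fmem s (ireg s a))) else None
  | FStore a r =>
      if (ireg s a < M)%N then
        Some (State (ireg s) (freg s) (imem s)
                    (upd (fmem s) (ireg s a) (freg s r))
                    (nrandom s) (nreceived s) (trace s))
      else None
  | FInput r a => Some (set_freg s r (finput E)`_(ireg s a))
  | FRand r =>
      Some (State (ireg s) (upd (freg s) r (random E (nrandom s))) (imem s)
                  (fmem s) (nrandom s).+1 (nreceived s) (trace s))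
  | FSend r =>
      Some (State (ireg s) (freg s) (imem s) (fmem s) (nrandom s) (nreceived s)
                  (rcons (trace s) (true, freg s r)))
  | FRecv r =>
      let y := inbox E (nreceived s) in
      Some (State (ireg s) (upd (freg s) r y) (imem s) (fmem s) (nrandom s)
                  (nreceived s).+1 (rcons (trace s) (false, y)))
  end.

(* [runs p s t s'] : started in [s], [p] halts in [s'] after [t] time units. *)
Inductive runs : prog -> state -> nat -> state -> Prop :=
| runs_nop s : runs Nop s 0 s
| runs_do i s s' : run_instr i s = Some s' -> runs (Do i) s 1 s'
| runs_seq p q s s' s'' t t' :
    runs p s t s' -> runs q s' t' s'' -> runs (Seq p q) s (t + t')%N s''
| runs_if r p q s s' t :
    runs (if ireg s r == 0%N then p else q) s t s' ->
    runs (IfZero r p q) s t.+1 s'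
| runs_iff r p q s s' t :
    runs (if freg s r == 0 then p else q) s t s' ->
    runs (IfFZero r p q) s t.+1 s'
| runs_while_end r p s : ireg s r = 0%N -> runs (WhileNZ r p) s 1 s
| runs_while r p s s' s'' t t' : ireg s r <> 0%N ->
    runs p s t s' -> runs (WhileNZ r p) s' t' s'' ->
    runs (WhileNZ r p) s (t + t').+1%N s''.

End Machine.

(* The conversation as recorded by the verifier. *)
Definition swap_view (F : fieldType) (c : seq (bool * F)) : seq (bool * F) :=
  [seq (~~ e.1, e.2) | e <- c].

(* Main.v *)
Require Import Defs.
From mathcomp Require Import all_boot all_order all_algebra.
From mathcomp Require Import mpoly.
From mathcomp Require Import zify ring.
Set Implicit Arguments.
Unset Strict Implicit.
Unset Printing Implicit Defensive.
Import GRing.Theory.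

(** * Multilinear extensions *)

(** Time of the prover. The multilinear extension of a wiring predicate is a sum with one term per
    gate of the layer: the Lagrange basis polynomial of the vertex formed by the label of the gate
    and the labels of its two inputs ([mmap_wiring]). While later variables are summed over the
    cube, such a basis polynomial acts as a 0/1 selector that leaves a single vertex ([sum_select]),
    so every sum-check message is again a sum with one term per gate ([round_polyE]). The rounds of
    a layer form three stretches, over the label of the gate, of its first input and of its second
    input. In each stretch only one factor still depends on the variables being bound: first [beta],
    then the value of the first input, then that of the second ([round_A], [round_B], [round_C]).
    That factor is the extension of a table, and the table is folded to half its length whenever a
    challenge arrives ([tab], [mlx_tab]). A gate then contributes a linear polynomial times the
    interpolation between two table entries ([phase_polyE]). A round costs time linear in the number
    of gates plus the table length, and there are [O(log S)] rounds per layer; since rounding a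
    layer up to a power of two at most doubles it ([pow_lab]), summing over the layers gives
    [O(S log S)] ([layer_progP], [prover_cmdP]). The restriction of the next layer's extension to a
    line comes from folding a table of truncated polynomials, whose number of rows halves each time
    ([line_progP]).

    Space and time of the verifier. The values of [beta] and of the wiring extensions used in its
    checks depend on its coins alone, so the coins can be drawn in advance and the values reduced to
    two field elements per layer ([gate_coef]). With the coins, the label lengths and the last point
    these fill [O(d log S)] cells ([ready]). The circuit itself would not fit. Each word of its
    description is therefore recomputed when needed, by running the uniformity machine from the
    start and decoding one entry of its output on the fly ([get_progP]). A halting run never repeats
    a configuration, and in space [O(log S)] there are only polynomially many of them ([run_time],
    [get_time_le]). Online there remain a bounded number of operations per message ([interact_cmdP])
    and, for the input, [n] Lagrange basis values in [up_log 2 n] variables ([evaluate_cmdP]).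

    The machine. All programs are written in a structured language whose weakest preconditions count
    time exactly, and [wp_runs] transfers such a specification to the compiled word RAM program. Its
    safety conditions ensure that words stay below [S ^ K] and addresses below the memory bound. *)

Definition bit (a j : nat) : bool := odd (a %/ 2 ^ j).

Lemma bit0 a : bit a 0 = odd a.
Proof. by rewrite /bit expn0 divn1. Qed.

Lemma bitS a j : bit a j.+1 = bit (a %/ 2) j.
Proof. by rewrite /bit expnS divnMA. Qed.

Lemma bit_sum k (b : nat -> bool) j :
  bit (\sum_(i < k) b i * 2 ^ i) j = (j < k) && b j.
Proof.
elim: k b j => [|k IH] b j; first by rewrite big_ord0 /bit div0n.
rewrite big_ord_recl expn0 muln1.
have -> : \sum_(i < k) b (lift ord0 i) * 2 ^ lift ord0 i
    = 2 * \sum_(i < k) b i.+1 * 2 ^ i.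
  by rewrite big_distrr; apply: eq_bigr => i _; rewrite /= expnS mulnCA.
case: j => [|j]; first by rewrite bit0 oddD oddM /= addbF; case: (b 0).
rewrite bitS divnDr ?dvdn_mulr // mulKn // (_ : b 0 %/ 2 = 0); last by case: (b 0).
exact: (IH (fun i => b i.+1)).
Qed.

Lemma bit_inj k a b : a < 2 ^ k -> b < 2 ^ k ->
  (forall j, j < k -> bit a j = bit b j) -> a = b.
Proof.
elim: k a b => [|k IH] a b; first by rewrite expn0; lia.
rewrite expnS => ak bk H.
have : a %/ 2 = b %/ 2.
  by apply: IH => [||j jk]; [lia | lia | rewrite -!bitS H].
by have := H 0 isT; rewrite !bit0; lia.
Qed.

Lemma label_lt k (b : cube k) : label b < 2 ^ k.
Proof.
rewrite /label; elim: k b => [|k IH] b; first by rewrite big_ord0.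
rewrite big_ord_recr /= expnS mul2n -addnn.
have h : (\sum_(i < k) b (widen_ord (leqnSn k) i) * 2 ^ i < 2 ^ k).
  have := IH [ffun i => b (widen_ord (leqnSn k) i)].
  by under eq_bigr do rewrite ffunE.
by case: (b ord_max); rewrite ?mul1n ?ltn_add2r // mul0n addn0 ltn_addr.
Qed.

Lemma bit_label k (b : cube k) (j : 'I_k) : bit (label b) j = b j.
Proof.
pose b' i := if insub i is Some j then b j else false.
have Eb i : b' (val i) = b i by rewrite /b' valK.
rewrite /label (eq_bigr (fun i : 'I_k => b' i * 2 ^ i)) => [|i _]; last by rewrite Eb.
by rewrite bit_sum ltn_ord Eb.
Qed.

Definition tocube k a : cube k := [ffun j : 'I_k => bit a j].

Lemma tocubeK k a : a < 2 ^ k -> label (tocube k a) = a.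
Proof.
move=> ak; apply: (bit_inj (label_lt _) ak) => j jk.
by rewrite (bit_label (tocube k a) (Ordinal jk)) ffunE.
Qed.

Lemma labelK k (b : cube k) : tocube k (label b) = b.
Proof. by apply/ffunP => j; rewrite ffunE bit_label. Qed.

Local Open Scope ring_scope.

Section Multilinear.
Variable R : comNzRingType.

Definition lin (b : bool) (y : R) : R := if b then y else 1 - y.

(** The Lagrange basis polynomial of the vertex with binary expansion [a]. Vertices are numbers and
    points are functions on [nat], so that no dependent types get in the way of splitting variables.
    The ring is arbitrary: the same formulas are used for field values and, with arguments in
    [{poly F}], for the prover's messages. *)
Definition chi (v a : nat) (y : nat -> R) : R := \prod_(j < v) lin (bit a j) (y j).

Definition mlx (v : nat) (T y : nat -> R) : R := \sum_(a < (2 ^ v)%N) T a * chi v a y.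

Lemma chiS v a y : chi v.+1 a y = lin (odd a) (y 0%N) * chi v (a %/ 2)%N (fun j => y j.+1).
Proof.
rewrite /chi big_ord_recl bit0; congr (_ * _).
by apply: eq_bigr => j _; rewrite bitS.
Qed.

Lemma chiSr v a y : chi v.+1 a y = chi v a y * lin (bit a v) (y v).
Proof. by rewrite /chi big_ord_recr. Qed.

Lemma eq_chi v a y y' : (forall j, (j < v)%N -> y j = y' j) -> chi v a y = chi v a y'.
Proof. by move=> h; apply: eq_bigr => j _; rewrite h. Qed.

Lemma eq_mlx v T T' y y' : (forall a, (a < 2 ^ v)%N -> T a = T' a) ->
  (forall j, (j < v)%N -> y j = y' j) -> mlx v T y = mlx v T' y'.
Proof. by move=> hT hy; apply: eq_bigr => a _; rewrite hT // (eq_chi _ hy). Qed.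

Lemma sum_pairs n (G : nat -> R) :
  \sum_(a < (2 * n)%N) G a = \sum_(e < n) (G (2 * e)%N + G (2 * e).+1).
Proof.
elim: n => [|n IH]; first by rewrite muln0 !big_ord0.
rewrite mulnS addnC addnS addn1 !big_ord_recr /= IH addrA.
by rewrite -!addrA; congr (_ + _).
Qed.

(** Variable 0 is the lowest bit of an index, so binding it merges the entries [2 * e] and
    [2 * e + 1]. This is the folding step of the prover. *)
Lemma mlxS v T y : mlx v.+1 T y =
  mlx v (fun e => T (2 * e)%N + y 0%N * (T (2 * e).+1 - T (2 * e)%N)) (fun j => y j.+1).
Proof.
rewrite /mlx expnS (sum_pairs _ (fun a => T a * chi v.+1 a y)); apply: eq_bigr => e _.
have -> : chi v.+1 (2 * e)%N y = (1 - y 0%N) * chi v e (fun j => y j.+1).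
  by rewrite chiS mulKn // oddM.
have -> : chi v.+1 (2 * e).+1 y = y 0%N * chi v e (fun j => y j.+1).
  by rewrite chiS /= oddM /= (_ : ((2 * e).+1 %/ 2)%N = e) //; lia.
by ring.
Qed.

Lemma chi_bits v a b : (a < 2 ^ v)%N -> (b < 2 ^ v)%N ->
  chi v a (fun k => (bit b k)%:R) = (a == b)%:R.
Proof.
elim: v a b => [|v IH] a b.
  by rewrite expn0 /chi big_ord0; case: a => // _; case: b.
rewrite expnS => av bv; rewrite chiS bit0.
rewrite (@eq_chi v _ _ (fun k => (bit (b %/ 2) k)%:R)) => [|j _]; last by rewrite bitS.
rewrite IH; try lia.
have -> : (a == b) = (odd a == odd b) && (a %/ 2 == b %/ 2)%N by lia.
rewrite /lin; case: (odd a); case: (odd b); rewrite /= ?mul1r ?mul0r //.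
  by rewrite subrr mul0r.
by rewrite subr0 mul1r.
Qed.

Lemma mlx_bits v T a : (a < 2 ^ v)%N -> mlx v T (fun k => (bit a k)%:R) = T a.
Proof.
move=> av; rewrite /mlx (bigD1 (Ordinal av)) //= chi_bits // eqxx mulr1.
rewrite big1 ?addr0 // => b ba; rewrite chi_bits // (_ : (b == a :> nat) = false) ?mulr0 //.
by apply: contraNF ba => /eqP e; apply/eqP/val_inj.
Qed.

(** Serves to treat [beta] as the extension of a table, namely of the Lagrange coefficients of the
    point [z]; it can then be folded exactly like a table of gate values. *)
Lemma mlx_chi v z y :
  mlx v (fun a => chi v a z) y = \prod_(j < v) (z j * y j + (1 - z j) * (1 - y j)).
Proof.
elim: v z y => [|v IH] z y.
  by rewrite /mlx /chi expn0 big_ord1 !big_ord0 mulr1.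
rewrite mlxS big_ord_recl (_ : \prod_(i < v) _
    = mlx v (fun a => chi v a (fun j => z j.+1)) (fun j => y j.+1)); last by rewrite IH.
rewrite /mlx big_distrr /=; apply: eq_bigr => e _.
rewrite !chiS mulKn // oddM /= (_ : ((2 * e).+1 %/ 2)%N = e); last lia.
by rewrite oddM /= /lin /bump /=; ring.
Qed.

End Multilinear.

Lemma rmorph_lin (R S : comNzRingType) (f : {rmorphism R -> S}) b y :
  f (lin b y) = lin b (f y).
Proof. by case: b => //=; rewrite rmorphB rmorph1. Qed.

Lemma rmorph_chi (R S : comNzRingType) (f : {rmorphism R -> S}) v a y :
  f (chi v a y) = chi v a (fun j => f (y j)).
Proof. by rewrite rmorph_prod; apply: eq_bigr => j _; rewrite rmorph_lin. Qed.

Lemma rmorph_mlx (R S : comNzRingType) (f : {rmorphism R -> S}) v T y :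
  f (mlx v T y) = mlx v (fun a => f (T a)) (fun j => f (y j)).
Proof. by rewrite rmorph_sum; apply: eq_bigr => a _; rewrite rmorphM rmorph_chi. Qed.

Lemma sum_cube (R : nmodType) k (G : cube k -> R) :
  \sum_b G b = \sum_(a < (2 ^ k)%N) G (tocube k a).
Proof.
rewrite (reindex (fun a : 'I_(2 ^ k) => tocube k a)) //=.
exists (fun b => Ordinal (label_lt b)) => [a _|b _].
  by apply: val_inj; rewrite /= tocubeK.
by rewrite /= labelK.
Qed.

Section Circuit.
Variables (F : fieldType) (R : comNzRingType) (f : {rmorphism F -> R}).

(** Along an arbitrary morphism, this covers both evaluation at field points and substitution of
    polynomials, hence the verifier's checks and the prover's messages alike. *)
Lemma mmap_mle_cube k (g : cube k -> F) (h : 'I_k -> R) :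
  mmap f h (mle g) = \sum_b f (g b) * \prod_j lin (b j) (h j).
Proof.
rewrite /mle raddf_sum; apply: eq_bigr => b _; rewrite /= mmapZ rmorph_prod; congr (_ * _).
apply: eq_bigr => j _; rewrite /lin; case: (b j) => /=; first by rewrite mmapX mmap1U.
by rewrite rmorphB rmorph1 /= mmapX mmap1U.
Qed.

Lemma mmap_mle k (g : cube k -> F) (y : nat -> R) :
  mmap f (fun j : 'I_k => y j) (mle g) = mlx k (fun a => f (g (tocube k a))) y.
Proof.
rewrite mmap_mle_cube sum_cube; apply: eq_bigr => a _; congr (_ * _).
by apply: eq_bigr => j _; rewrite ffunE.
Qed.

End Circuit.

Lemma mmap_comp (F : fieldType) (R : comNzRingType) (f : {rmorphism F -> R}) m k
    (t : m.-tuple {mpoly F[k]}) (h : 'I_k -> R) (g : cube m -> F) :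
  mmap f h (mle g \mPo t) = mmap f (fun j => mmap f h (tnth t j)) (mle g).
Proof.
rewrite mmap_mle_cube /comp_mpoly (mmap_mle_cube (@mpolyC k F)) raddf_sum.
apply: eq_bigr => b _; rewrite /= rmorphM /= mmapC rmorph_prod; congr (_ * _).
by apply: eq_bigr => j _; rewrite -rmorph_lin.
Qed.

(** * The sum-check polynomial as a sum over the gates of a layer *)

Section Layer.
Variables (F : fieldType) (n : nat) (C : circuit) (i : nat).
Hypotheses (wfC : wf_circuit n C) (iC : (i < depth C)%N).

Notation v := (lab n C i).
Notation u := (lab n C i.+1).
Notation w := (width n C i).

Definition gate_of a : gate := nth (false, 0%N, 0%N) (nth [::] C i) a.
Definition gmul a := (gate_of a).1.1.
Definition gfst a := (gate_of a).1.2.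
Definition gsnd a := (gate_of a).2.

(** The bits of the one vertex at which gate [a] makes a wiring predicate nonzero: its own label,
    then the labels of its two inputs. *)
Definition wire a k : bool :=
  if (k < v)%N then bit a k
  else if (k < v + u)%N then bit (gfst a) (k - v) else bit (gsnd a) (k - (v + u)).

Lemma width_lab k : (width n C k <= 2 ^ lab n C k)%N.
Proof. exact: up_logP. Qed.

Lemma size_layer : size (nth [::] C i) = w.
Proof. by rewrite /width iC. Qed.

Lemma gate_wf a : (a < w)%N -> (gfst a < width n C i.+1)%N /\ (gsnd a < width n C i.+1)%N.
Proof.
case: wfC => _ _ _ H aw; apply: (H i (gmul a)).
have : gate_of a \in nth [::] C i by apply: mem_nth; rewrite size_layer.
by rewrite /gmul /gfst /gsnd; case: (gate_of a) => [[]].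
Qed.

Lemma gate_lt a : (a < w)%N -> [/\ (a < 2 ^ v)%N, (gfst a < 2 ^ u)%N & (gsnd a < 2 ^ u)%N].
Proof.
by move=> aw; have [h1 h2] := gate_wf aw; split; apply: leq_trans (width_lab _).
Qed.

Definition wcube a : cube (nvars n C i) := [ffun j : 'I_(nvars n C i) => wire a j].

Lemma eq_wcube (s : cube (nvars n C i)) a : (a < w)%N -> (s == wcube a) =
  [&& label [ffun j => s (ip j)] == a, label [ffun j => s (i1 j)] == gfst a
    & label [ffun j => s (i2 j)] == gsnd a].
Proof.
move=> aw; have [h0 h1 h2] := gate_lt aw; apply/eqP/and3P => [->|[/eqP e0 /eqP e1 /eqP e2]].
  split; apply/eqP.
  - rewrite -[RHS](tocubeK h0); congr label; apply/ffunP => j; rewrite !ffunE /wire /=.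
    by rewrite ltn_ord.
  - rewrite -[RHS](tocubeK h1); congr label; apply/ffunP => j; rewrite !ffunE /wire /=.
    by rewrite ltn_add2l ltn_ord ifF ?addKn //; lia.
  - rewrite -[RHS](tocubeK h2); congr label; apply/ffunP => j; rewrite !ffunE /wire /=.
    by rewrite addnA addKn !ifF //; lia.
apply/ffunP => j; rewrite ffunE /wire; case: (split_ordP j) => [k ->|k ->] /=.
  by rewrite -e0 bit_label ffunE.
case: (split_ordP k) => [l ->|l ->] /=.
  by rewrite ltn_add2l ltn_ord addKn -e1 bit_label ffunE.
by rewrite ltn_add2l ifF ?addnA ?addKn -?e2 ?bit_label ?ffunE //; lia.
Qed.

(** A label determines its gate and hence both inputs, so at most one term is nonzero; a label at or
    beyond the width names no gate and both sides vanish. *)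
Lemma wiring_sum mul (s : cube (nvars n C i)) :
  wiring F n C i mul s = \sum_(a < w | gmul a == mul) (s == wcube a)%:R.
Proof.
rewrite /wiring; set l := label _.
have [lw|wl] := ltnP l w; last first.
  rewrite onth_default ?size_layer // big1 // => a _; rewrite eq_wcube // -/l.
  by rewrite (_ : (l == a) = false) //; have := ltn_ord a; lia.
rewrite onthE (nth_map (false, 0, 0)%N) ?size_layer // -/(gate_of l).
rewrite big_mkcond (bigD1 (Ordinal lw)) //= big1 ?addr0 => [|a al]; last first.
  case: ifP => // _; rewrite eq_wcube // -/l (_ : (l == a) = false) //.
  by apply: contraNF al => /eqP e; apply/eqP/val_inj.
rewrite eq_wcube // -/l eqxx /= /gmul /gfst /gsnd; case: (gate_of l) => [[m b] c] /=.
rewrite -[Some _ == _]/((m, b, c) == _) !xpair_eqE.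
by case: eqP => //= _; rewrite (eq_sym b) (eq_sym c).
Qed.

Variables (R : comNzRingType) (f : {rmorphism F -> R}).

Definition wterm a (y : nat -> R) : R := \prod_(k < nvars n C i) lin (wire a k) (y k).

(** The extension of an indicator of finitely many vertices is the sum of their basis polynomials.
    Evaluating it thus costs one term per gate instead of one per vertex of the cube, for the prover
    and in the preprocessing. *)
Lemma mmap_wiring mul (y : nat -> R) :
  mmap f (fun j : 'I_(nvars n C i) => y j) (mle (wiring F n C i mul))
  = \sum_(a < w | gmul a == mul) wterm a y.
Proof.
rewrite mmap_mle_cube.
under eq_bigr do rewrite wiring_sum rmorph_sum mulr_suml.
rewrite exchange_big /=; apply: eq_bigr => a _.
rewrite (bigD1 (wcube a)) //= eqxx rmorph1 mul1r [X in _ + X]big1 ?addr0.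
  by rewrite /wterm; apply: eq_bigr => k _; rewrite ffunE.
by move=> s /negbTE sa; rewrite sa rmorph0 mul0r.
Qed.

Lemma wterm_split a y : wterm a y =
  chi v a y * (chi u (gfst a) (fun j => y (v + j)%N) * chi u (gsnd a) (fun j => y (v + u + j)%N)).
Proof.
rewrite /wterm /nvars !big_split_ord /=; congr (_ * (_ * _)); apply: eq_bigr => k _.
- by rewrite /wire ltn_ord.
- by rewrite /wire ltn_add2l ltn_ord ifF ?addKn //; lia.
- by rewrite /wire addnA addKn !ifF //; lia.
Qed.

Definition gop (T : comNzRingType) a (p q : T) : T := if gmul a then p * q else p + q.

Definition lval (x : seq F) k a : F := (layer_values C x k)`_a.

Lemma mle_layer k x (y : nat -> R) :
  mmap f (fun j : 'I_(lab n C k) => y j) (mle (layer_fun n C x k))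
  = mlx (lab n C k) (fun a => f (lval x k a)) y.
Proof.
by rewrite mmap_mle; apply: eq_mlx => // a ak; rewrite /layer_fun tocubeK.
Qed.

Lemma mmap_beta z (y : nat -> R) : mmap f (fun j : 'I_(nvars n C i) => y j) (beta n C i z)
  = mlx v (fun a => f (chi v a z)) y.
Proof.
rewrite /beta rmorph_prod.
transitivity (mlx v (fun a => chi v a (fun j => f (z j))) y); last first.
  by apply: eq_mlx => // a _; rewrite rmorph_chi.
rewrite mlx_chi; apply: eq_bigr => j _.
set h := (fun _ => _); have Ex : mmap f h 'X_(ip j) = y j by rewrite mmapX mmap1U.
have E1 : mmap f h (1 - 'X_(ip j)) = 1 - y j by rewrite rmorphB rmorph1 /= Ex.
have Ez : f (1 - z j) = 1 - f (z j) by rewrite rmorphB rmorph1.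
by rewrite /= rmorphD !rmorphM /= Ex E1 !mmapC -Ez.
Qed.

Lemma mmap_sumcheck x z (y : nat -> R) :
  mmap f (fun j : 'I_(nvars n C i) => y j) (sumcheck_poly n C x i z)
  = \sum_(a < w) wterm a y * (mlx v (fun a => f (chi v a z)) y
      * gop a (mlx u (fun a => f (lval x i.+1 a)) (fun j => y (v + j)%N))
              (mlx u (fun a => f (lval x i.+1 a)) (fun j => y (v + u + j)%N))).
Proof.
rewrite /sumcheck_poly rmorphM /= rmorphD !rmorphM rmorphD /= !mmap_comp mmap_beta !mmap_wiring.
have E1 : mmap f (fun j : 'I_u => mmap f (fun j0 : 'I_(nvars n C i) => y j0)
     (tnth [tuple 'X_(i1 j1) | j1 < u] j)) (mle (layer_fun n C x i.+1))
   = mlx u (fun a => f (lval x i.+1 a)) (fun j => y (v + j)%N).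
  rewrite -mle_layer !mmap_mle_cube; apply: eq_bigr => b _; congr (_ * _).
  by apply: eq_bigr => j _; rewrite tnth_mktuple mmapX mmap1U.
have E2 : mmap f (fun j : 'I_u => mmap f (fun j0 : 'I_(nvars n C i) => y j0)
     (tnth [tuple 'X_(i2 j1) | j1 < u] j)) (mle (layer_fun n C x i.+1))
   = mlx u (fun a => f (lval x i.+1 a)) (fun j => y (v + u + j)%N).
  rewrite -mle_layer !mmap_mle_cube; apply: eq_bigr => b _; congr (_ * _).
  by apply: eq_bigr => j _; rewrite tnth_mktuple mmapX mmap1U /= addnA.
rewrite E1 E2 [RHS](bigID (fun a : 'I_w => gmul a)) /= [in RHS]addrC mulrDr.
congr (_ + _); rewrite mulrCA mulr_suml.
  by apply: eq_big => a; rewrite ?eqbF_neg // /gop => /negbTE ->.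
by apply: eq_big => a; rewrite ?eqb_id // /gop => ->.
Qed.

End Layer.

(** * The prover's round polynomials *)

Section Rounds.
Variables (F : fieldType) (n : nat) (C : circuit) (i : nat).
Hypotheses (wfC : wf_circuit n C) (iC : (i < depth C)%N).

Notation v := (lab n C i).
Notation u := (lab n C i.+1).
Notation w := (width n C i).

(* Once [j] variables are bound to challenges, the argument at the gate whose
   remaining variables are the bits [b]. *)
Definition mix (r : nat -> F) (b : nat -> bool) (j k : nat) : {poly F} :=
  if (k < j)%N then (r k)%:P else if k == j then 'X else ((b k)%:R)%:P.

(** At a variable still to be summed the factor [lin (b0 k) (b k)] is 0 or 1, so only the vertex
    agreeing with [b0] after position [j] survives. The bits up to [j] are forced to be zero by the
    range of summation, which makes that vertex unique. *)
Lemma sum_select m j (b0 : nat -> bool) (r : nat -> F) (H : cube m -> {poly F}) : (j < m)%N ->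
  \sum_(b : cube m | [forall k : 'I_m, (k <= j)%N ==> ~~ b k])
    \prod_(k < m) lin (b0 k) (if (k < j)%N then (r k)%:P
       else if k == j :> nat then 'X else ((b k)%:R)%:P) * H b
  = (\prod_(k < j) lin (b0 k) (r k))%:P * lin (b0 j) 'X
    * H [ffun k : 'I_m => (j < k)%N && b0 k].
Proof.
move=> jm; set c := [ffun k : 'I_m => _].
rewrite (bigD1 c) /=; last by apply/forallP => k; rewrite ffunE ltnNge; case: leqP.
rewrite [X in _ + X]big1 ?addr0; last first.
  move=> b /andP[/forallP bz bc].
  have /existsP[k bk] : [exists k, b k != c k].
    apply: contraR bc => /existsPn h; apply/eqP/ffunP => k.
    by have := h k; rewrite negbK => /eqP.
  rewrite (bigD1 k) //=; have := bz k; move: bk; rewrite ffunE.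
  case: (ltngtP k j) => //= [kj|jk|kj]; rewrite ?negb_imply; first by case: (b k).
    rewrite /lin; case: (b k); case: (b0 k) => //= _ _; first by rewrite subrr !mul0r.
    by rewrite polyC0 !mul0r.
  by case: (b k).
congr (_ * _).
under eq_bigr => k _ do rewrite ffunE.
rewrite -(big_mkord xpredT (fun k => lin (b0 k) (if (k < j)%N then (r k)%:P
  else if k == j then 'X else (((j < k)%N && b0 k)%:R)%:P))).
rewrite (@big_cat_nat _ _ _ j.+1) //= big_nat_recr //= ltnn eqxx [X in _ * X]big_nat.
rewrite [X in _ * X]big1 ?mulr1 => [|k /andP[jk km]]; last first.
  rewrite ltnNge ltnW // jk /= gtn_eqF // /lin.
  by case: (b0 k); rewrite ?polyC1 // polyC0 subr0.
congr (_ * _); rewrite big_mkord rmorph_prod; apply: eq_bigr => k _.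
by rewrite ltn_ord /= rmorph_lin.
Qed.

Definition ymix r a j := mix r (wire n C i a) j.

Lemma round_polyE x z r j : (j < nvars n C i)%N ->
  round_poly (sumcheck_poly n C x i z) r j =
  \sum_(a < w) (\prod_(k < j) lin (wire n C i a k) (r k))%:P * lin (wire n C i a j) 'X *
     (mlx v (fun b => (chi v b z)%:P) (ymix r a j)
      * gop C i a (mlx u (fun b => (lval C x i.+1 b)%:P) (fun k => ymix r a j (v + k)%N))
              (mlx u (fun b => (lval C x i.+1 b)%:P) (fun k => ymix r a j (v + u + k)%N))).
Proof.
move=> jm; rewrite /round_poly.
(* The argument is extended from ordinals to all natural numbers, as [mlx] expects; the default
   [false] is only met beyond the last variable. *)
pose yb (b : cube (nvars n C i)) k : {poly F} :=
  if (k < j)%N then (r k)%:P else if k == j then 'X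
  else ((if insub k is Some o then b o else false)%:R)%:P.
under eq_bigr => b _.
  rewrite (_ : mmap _ _ _ = mmap (@polyC F) (fun k : 'I_(nvars n C i) => yb b k)
     (sumcheck_poly n C x i z)); last first.
    by rewrite /mmap; apply: eq_bigr => m _; congr (_ * _); apply: eq_bigr => k _; rewrite /yb valK.
  rewrite (mmap_sumcheck wfC iC (@polyC F)); over.
rewrite exchange_big /=; apply: eq_bigr => a _.
under eq_bigr => b _.
  rewrite (_ : wterm _ _ _ _ _ = \prod_(k < nvars n C i) lin (wire n C i a k) (if (k < j)%N then (r k)%:P
       else if k == j :> nat then 'X else ((b k)%:R)%:P)); last first.
    by apply: eq_bigr => k _; rewrite /yb valK.
  over.
rewrite (sum_select _ _ (fun b => mlx v _ (yb b) * gop C i a (mlx u _ (fun k => yb b (v + k)%N))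
   (mlx u _ (fun k => yb b (v + u + k)%N)))) //.
have E k : (k < nvars n C i)%N ->
    yb [ffun k : 'I_(nvars n C i) => (j < k)%N && wire n C i a k] k = ymix r a j k.
  move=> km; rewrite /yb /ymix /mix insubT /= ffunE /=.
  by case: ltngtP.
congr (_ * (_ * gop _ _ _ _ _)); apply: eq_mlx => // k ku; apply: E; rewrite /nvars; lia.
Qed.

(* The three stretches of rounds share this shape: a table [T] bound variable by
   variable along the index [idx a] of each gate [a], and an affine function of
   the table entry. *)
Definition phase_poly (m N : nat) (idx : nat -> nat) (c p q T r : nat -> F) (j : nat) : {poly F} :=
  \sum_(a < N) (c a * \prod_(k < j) lin (bit (idx a) k) (r k))%:P * lin (bit (idx a) j) 'X *
     ((p a)%:P + (q a)%:P * mlx m (fun b => (T b)%:P) (mix r (bit (idx a)) j)).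

Lemma mlx_bits_poly m (T : nat -> F) (y : nat -> {poly F}) a : (a < 2 ^ m)%N ->
  (forall k, (k < m)%N -> y k = ((bit a k)%:R)%:P) ->
  mlx m (fun b => (T b)%:P) y = (T a)%:P.
Proof.
move=> am hy; rewrite -(mlx_bits (fun b => (T b)%:P) am); apply: eq_mlx => // k km.
by rewrite hy // polyC_natr.
Qed.

Lemma mlx_poly m (T y : nat -> F) (y' : nat -> {poly F}) :
  (forall k, (k < m)%N -> y' k = (y k)%:P) ->
  mlx m (fun b => (T b)%:P) y' = (mlx m T y)%:P.
Proof. by move=> hy; rewrite rmorph_mlx; apply: eq_mlx. Qed.

(** In this stretch the input labels are Boolean at the surviving vertex, so the two extensions take
    the actual values of the inputs and the gate operation returns the value of the gate itself.
    Only [beta] remains to be folded. *)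
Lemma round_A x z r j : (j < v)%N ->
  round_poly (sumcheck_poly n C x i z) r j =
  phase_poly v w id (fun=> 1) (fun=> 0) (lval C x i) (fun b => chi v b z) r j.
Proof.
move=> jv; rewrite round_polyE; last by rewrite /nvars; lia.
apply: eq_bigr => a _; have [h0 h1 h2] := gate_lt wfC iC (ltn_ord a).
rewrite mul1r polyC0 add0r; congr (_ * _ * _).
- congr (_ %:P); apply: eq_bigr => k _; rewrite /wire ifT //; have := ltn_ord k; lia.
- by rewrite /wire jv.
rewrite mulrC (@mlx_bits_poly _ _ _ (gfst C i a)) //; last first.
  move=> k ku; rewrite /ymix /mix !ifF; try lia.
  by rewrite /wire ifF ?ltn_add2l ?ku ?addKn //; lia.
rewrite (@mlx_bits_poly _ _ _ (gsnd C i a)) //; last first.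
  move=> k ku; rewrite /ymix /mix !ifF; try lia.
  by rewrite /wire !ifF ?addKn //; lia.
congr (_ * _); last first.
  by apply: eq_mlx => // k kv; rewrite /ymix /mix /wire kv.
rewrite /lval /layer_values (drop_nth [::] (iC : (i < size C)%N)) /= (nth_map (false, 0, 0)%N) ?(size_layer n iC) //.
by rewrite /gate_value /gop /gmul -/(gate_of C i a) /gfst /gsnd; case: ifP => _; rewrite ?polyCM ?polyCD.
Qed.

(** The label of the gate is now bound, so [beta] is a constant, and the second input is still
    Boolean. As a function of the first value an addition is affine with slope 1 and a
    multiplication is linear with slope the second value; [p] and [q] record this. *)
Lemma round_B x z r j : (j < u)%N ->
  round_poly (sumcheck_poly n C x i z) r (v + j) =
  phase_poly u w (gfst C i)
    (fun a => mlx v (fun b => chi v b z) r * chi v a r)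
    (fun a => if gmul C i a then 0 else lval C x i.+1 (gsnd C i a))
    (fun a => if gmul C i a then lval C x i.+1 (gsnd C i a) else 1)
    (lval C x i.+1) (fun k => r (v + k)%N) j.
Proof.
move=> ju; rewrite round_polyE; last by rewrite /nvars; lia.
apply: eq_bigr => a _; have [h0 h1 h2] := gate_lt wfC iC (ltn_ord a).
rewrite (@mlx_poly v (fun b => chi v b z) r) => [|k kv]; last by rewrite /ymix /mix ifT //; lia.
rewrite [X in gop _ _ _ _ X](@mlx_bits_poly _ _ _ (gsnd C i a)) //; last first.
  move=> k ku; rewrite /ymix /mix !ifF; try lia.
  by rewrite /wire !ifF ?addKn //; lia.
have -> : mlx u (fun b => (lval C x i.+1 b)%:P) (fun k => ymix r a (v + j) (v + k))
   = mlx u (fun b => (lval C x i.+1 b)%:P) (mix (fun k => r (v + k)%N) (bit (gfst C i a)) j).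
  apply: eq_mlx => // k ku; rewrite /ymix /mix ltn_add2l eqn_add2l /wire ltn_add2l ku.
  by rewrite [(v + k < v)%N]ltnNge leq_addr addKn.
have -> : wire n C i a (v + j) = bit (gfst C i a) j.
  by rewrite /wire ltn_add2l ju ifF ?addKn //; lia.
have -> : \prod_(k < v + j) lin (wire n C i a k) (r k)
   = chi v a r * \prod_(k < j) lin (bit (gfst C i a) k) (r (v + k)%N).
  rewrite big_split_ord /=; congr (_ * _); apply: eq_bigr => k _; rewrite /wire.
    by rewrite ltn_ord.
  by rewrite [(v + k < v)%N]ltnNge leq_addr ltn_add2l (ltn_trans (ltn_ord k) ju) addKn.
by rewrite /gop; case: ifP => _; rewrite ?polyC0 ?polyC1 !rmorphM /=; ring.
Qed.

(** As in the previous stretch with the inputs exchanged, except that the first value is now one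
    constant [c1] for all gates: the extension at the first point reached. *)
Lemma round_C x z r j (c1 := mlx u (lval C x i.+1) (fun k => r (v + k)%N)) : (j < u)%N ->
  round_poly (sumcheck_poly n C x i z) r (v + u + j) =
  phase_poly u w (gsnd C i)
    (fun a => mlx v (fun b => chi v b z) r * chi v a r * chi u (gfst C i a) (fun k => r (v + k)%N))
    (fun a => if gmul C i a then 0 else c1)
    (fun a => if gmul C i a then c1 else 1)
    (lval C x i.+1) (fun k => r (v + u + k)%N) j.
Proof.
move=> ju; rewrite round_polyE; last by rewrite /nvars; lia.
apply: eq_bigr => a _; have [h0 h1 h2] := gate_lt wfC iC (ltn_ord a).
rewrite (@mlx_poly v (fun b => chi v b z) r) => [|k kv]; last by rewrite /ymix /mix ifT //; lia.
rewrite (@mlx_poly u (lval C x i.+1) (fun k => r (v + k)%N)) => [|k kv]; last by rewrite /ymix /mix ifT //; lia.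
have -> : mlx u (fun b => (lval C x i.+1 b)%:P) (fun k => ymix r a (v + u + j) (v + u + k))
   = mlx u (fun b => (lval C x i.+1 b)%:P) (mix (fun k => r (v + u + k)%N) (bit (gsnd C i a)) j).
  apply: eq_mlx => // k ku; rewrite /ymix /mix ltn_add2l eqn_add2l /wire.
  have -> : (v + u + k < v)%N = false by lia.
  have -> : (v + u + k < v + u)%N = false by lia.
  by rewrite addKn.
have -> : wire n C i a (v + u + j) = bit (gsnd C i a) j.
  by rewrite /wire !ifF ?addKn //; lia.
have -> : \prod_(k < v + u + j) lin (wire n C i a k) (r k)
   = chi v a r * chi u (gfst C i a) (fun k => r (v + k)%N)
     * \prod_(k < j) lin (bit (gsnd C i a) k) (r (v + u + k)%N).
  rewrite !big_split_ord /=; congr (_ * _ * _); apply: eq_bigr => k _; rewrite /wire.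
  - by rewrite ltn_ord.
  - by rewrite [(v + k < v)%N]ltnNge leq_addr ltn_add2l ltn_ord addKn.
  - by rewrite !ifF ?addKn //; lia.
by rewrite -/c1 /gop; case: ifP => _; rewrite ?polyC0 ?polyC1 !rmorphM /=; ring.
Qed.

End Rounds.

Local Close Scope ring_scope.

(** * The encoded circuit and the honest conversation *)

Definition logs T (f : nat -> seq T) k := flatten [seq f j | j <- iota 0 k].
Arguments logs : simpl never.

Lemma logs0 T (f : nat -> seq T) : logs f 0 = [::].
Proof. by []. Qed.

Lemma logsS T (f : nat -> seq T) k : logs f k.+1 = logs f k ++ f k.
Proof. by rewrite /logs -addn1 iotaD map_cat flatten_cat /= cats0. Qed.

Lemma eq_logs T (f g : nat -> seq T) k : (forall j, j < k -> f j = g j) ->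
  logs f k = logs g k.
Proof.
move=> fg; congr flatten; apply/eq_in_map => j.
by rewrite mem_iota => /andP[_ h]; apply: fg.
Qed.

Lemma size_logs T (f : nat -> seq T) k : size (logs f k) = \sum_(j < k) size (f j).
Proof.
by elim: k => [|k IH]; rewrite ?big_ord0 // logsS size_cat IH big_ord_recr.
Qed.

Lemma sum_ord_mono (f : nat -> nat) i j : i <= j -> \sum_(k < i) f k <= \sum_(k < j) f k.
Proof.
move=> ij; rewrite -(subnKC ij); elim: (j - i) => [|k IH]; first by rewrite addn0.
by rewrite addnS big_ord_recr /= (leq_trans IH) // leq_addr.
Qed.

Lemma nth_logs T (x0 : T) (f : nat -> seq T) k i a : i < k -> a < size (f i) ->
  nth x0 (logs f k) (\sum_(j < i) size (f j) + a) = nth x0 (f i) a.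
Proof.
elim: k => // k IH ik af; rewrite logsS nth_cat size_logs.
have [ik'|->] : i < k \/ i = k by lia.
  rewrite ifT ?IH //; apply: leq_trans (sum_ord_mono (fun j => size (f j)) ik').
  by rewrite big_ord_recr ltn_add2l.
by rewrite ltnNge leq_addr /= addKn.
Qed.

Lemma logs_nth T (x0 : T) U (g : T -> seq U) (s : seq T) :
  flatten [seq g y | y <- s] = logs (fun a => g (nth x0 s a)) (size s).
Proof. by rewrite /logs (map_comp g (nth x0 s)) map_nth_iota0 // take_size. Qed.

Section Description.
Variables (n : nat) (C : circuit).
Hypothesis wfC : wf_circuit n C.

Notation S := (csize n C).
Notation L := (up_log 2 S).
Notation d := (depth C).

Definition off i := \sum_(k < i) width n C k.

Lemma offS i : off i.+1 = off i + width n C i.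
Proof. by rewrite /off big_ord_recr. Qed.

Lemma off_le i j : i <= j -> off i <= off j.
Proof. exact: sum_ord_mono. Qed.

Lemma csizeE : S = off d + n.
Proof. by rewrite /csize -/(off d.+1) offS /width ltnn. Qed.

Lemma off_width i : i <= d -> off i + width n C i <= S.
Proof. by move=> id; rewrite -offS; apply: (@off_le i.+1 d.+1). Qed.

Lemma width_le i : width n C i <= S.
Proof.
have [id|id] := leqP i d; first by have := off_width id; lia.
by rewrite /width ltnNge (ltnW id) csizeE /=; lia.
Qed.

Lemma n_gt0 : 0 < n.
Proof. by case: wfC => _ _ /(_ d); rewrite /width ltnn. Qed.

Lemma S_ge2 : 2 <= S.
Proof.
case: wfC => d0 w0 _ _; rewrite csizeE; have := n_gt0.
by have := off_le d0; rewrite offS w0 /off big_ord0; lia.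
Qed.

Lemma depth_lt : d < S.
Proof.
rewrite csizeE; have := n_gt0; suff : d <= off d by lia.
case: wfC => _ _ w _; elim: d => // k IH; rewrite offS; have := w k; lia.
Qed.

Lemma L_gt0 : 0 < L.
Proof. by rewrite up_log_gt0 S_ge2. Qed.

Lemma L_lt : L < S.
Proof.
have : L.-1 < 2 ^ L.-1 by apply: ltn_expl.
have := up_log_gtn (isT : 1 < 2) S_ge2; have := L_gt0; lia.
Qed.

Lemma lab_le i : lab n C i <= L.
Proof. exact/leq_up_log/width_le. Qed.

(** Padding a layer to a power of two at most doubles it, so tables indexed by labels stay linear in
    the width. A layer of width 1 has the empty label and is treated apart. *)
Lemma pow_lab i : 2 ^ lab n C i <= 2 * width n C i.
Proof.
rewrite /lab; have : 0 < width n C i by case: wfC => _ _ ->.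
have [w1|w1] := leqP (width n C i) 1.
  by move=> h; have -> : width n C i = 1 by lia.
have := up_log_gtn (isT : 1 < 2) w1.
have : 0 < up_log 2 (width n C i) by rewrite up_log_gt0.
by case: (up_log _ _) => // k; rewrite expnS /=; lia.
Qed.

Lemma lab0 : lab n C 0 = 0.
Proof. by case: wfC => _ w0 _ _; rewrite /lab w0 up_log1. Qed.

Lemma size_flatten_circuit : size (flatten C) = off d.
Proof.
rewrite -[C]map_id (logs_nth [::]) size_logs /off map_id.
by apply: eq_bigr => i _; rewrite /width ltn_ord.
Qed.

Lemma size_description : size (description n C) = d.+2 + 3 * off d.
Proof.
rewrite /description /= size_cat size_map size_iota (logs_nth (false, 0, 0)) size_logs /=.
by rewrite sum_nat_const card_ord size_flatten_circuit addSn mulnC.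
Qed.

Lemma nth_depth : nth 0 (description n C) 0 = d.
Proof. by []. Qed.

Lemma nth_width i : i <= d -> nth 0 (description n C) i.+1 = width n C i.
Proof.
move=> id; rewrite /description -cat_cons nth_cat [size (_ :: _)]/= size_map size_iota.
by rewrite ltnS ltnS id -[nth _ _ _]/(nth _ _ i) (nth_map 0) ?size_iota // nth_iota.
Qed.

Lemma nth_gate i a j : i < d -> a < width n C i -> j < 3 ->
  nth 0 (description n C) (d.+2 + 3 * (off i + a) + j)
  = nth 0 [:: nat_of_bool (gmul C i a); gfst C i a; gsnd C i a] j.
Proof.
move=> id aw j3; rewrite /description -cat_cons nth_cat [size (_ :: _)]/= size_map size_iota ifF; last by lia.
rewrite (logs_nth (false, 0, 0)).
set f := fun a => _; set k := off i + a.
have kG : k < size (flatten C).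
  rewrite size_flatten_circuit; have := off_le id; rewrite offS /k; lia.
have -> : d.+2 + 3 * k + j - d.+2 = \sum_(l < k) size (f l) + j.
  by rewrite /f /= sum_nat_const card_ord; lia.
rewrite nth_logs // /f.
have -> // : nth (false, 0, 0) (flatten C) k = gate_of C i a.
rewrite -{1}[C]map_id (logs_nth [::]) /k.
have -> : off i = \sum_(l < i) size (nth [::] C l).
  by apply: eq_bigr => l _; rewrite /width ifT //; apply: ltn_trans id.
by rewrite nth_logs ?size_layer // (size_layer n).
Qed.

Lemma description_le k : k \in description n C -> k <= S.
Proof.
rewrite /description inE mem_cat => /or3P[/eqP->|/mapP[i _ ->]|].
- exact/ltnW/depth_lt.
- exact: width_le.
case/flatten_mapP => g /flattenP[l /(nthP [::])[i id <-] gl].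
case: wfC => _ _ _ H; case: g gl => [[m b] c] /H[hb hc].
have := width_le i.+1; have := S_ge2.
by rewrite !inE => h2 hw /or3P[] /eqP-> /=; [case: (m)|..]; lia.
Qed.

Lemma nth_description_le k : nth 0 (description n C) k <= S.
Proof.
have [h|h] := ltnP k (size (description n C)); last by rewrite nth_default.
exact/description_le/mem_nth.
Qed.

End Description.

Lemma logsD T (f : nat -> seq T) a b : logs f (a + b) = logs f a ++ logs (fun k => f (a + k)) b.
Proof. by elim: b => [|b IH]; rewrite ?addn0 ?cats0 // addnS !logsS IH catA. Qed.

Definition round_log (F : fieldType) (p : {poly F}) (y : F) : seq (bool * F) :=
  [:: (true, p`_0)%R; (true, p`_1)%R; (true, p`_2)%R; (false, y)].

Section Conversation.
Variables (F : fieldType) (n : nat) (C : circuit) (coins : nat -> F) (x : seq F).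

Notation msgs := (nth 0%R (honest_messages n C coins x)).
Notation v := (lab n C).
Notation W i := (mle (layer_fun n C x i)).
Notation f i := (sumcheck_poly n C x i (point n C coins i)).
Notation r i := (chal n C coins i).

Definition layer_size i := 3 * nvars n C i + 2 + (v i.+1).+1.

Lemma size_honest_layer i : size (honest_layer n C coins x i) = layer_size i.
Proof.
rewrite /honest_layer -/(logs _ _) !size_cat size_logs /= !size_map !size_iota.
by rewrite sum_nat_const card_ord mulnC addnA.
Qed.

Lemma nth_honest i a : i < depth C -> a < layer_size i ->
  msgs (msg_start n C i + a) = nth 0%R (honest_layer n C coins x i) a.
Proof.
move=> id ha; rewrite /honest_messages /msg_start add1n addSn /=.
rewrite -/(logs _ _) (_ : \sum_(k < i) _ = \sum_(k < i) size (honest_layer n C coins x k)).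
  by rewrite nth_logs // size_honest_layer.
by apply: eq_bigr => k _; rewrite size_honest_layer.
Qed.

Lemma honest_round i j k : i < depth C -> j < nvars n C i -> k < 3 ->
  msgs (msg_start n C i + 3 * j + k) = ((round_poly (f i) (r i) j)`_k)%R.
Proof.
move=> id jm k3; rewrite -addnA nth_honest; last by rewrite /layer_size; lia.
  rewrite /honest_layer -/(logs _ _) nth_cat size_logs /= sum_nat_const card_ord ifT; last by lia.
  have -> : 3 * j + k = \sum_(l < j) size [seq ((round_poly (f i) (r i) l)`_k)%R | k <- iota 0 3] + k.
    by rewrite /= sum_nat_const card_ord mulnC.
  rewrite nth_logs //=; by case: k k3 => [|[|[|]]].
by [].
Qed.

Lemma honest_tail i k : i < depth C -> k < 2 + (v i.+1).+1 ->
  msgs (msg_start n C i + 3 * nvars n C i + k) = nth 0%R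
   ([:: ((W i.+1).@[fun j => chal1 n C coins i j])%R; ((W i.+1).@[fun j => chal2 n C coins i j])%R]
     ++ [seq ((mmap (@polyC F) (fun j : 'I__ => line (chal1 n C coins i) (chal2 n C coins i) j) (W i.+1))`_k)%R
       | k <- iota 0 (v i.+1).+1]) k.
Proof.
move=> id hk; rewrite -addnA nth_honest; last by rewrite /layer_size; lia.
  rewrite /honest_layer -/(logs _ _) [LHS]nth_cat size_logs /= sum_nat_const card_ord ifF; last by lia.
  by rewrite mulnC addKn.
by [].
Qed.

(** Expresses the transcript through the polynomials that the prover computes, in the order in which
    its program emits their coefficients. *)
Lemma honest_conversation i : i < depth C ->
  layer_conversation n C coins msgs i =
  logs (fun j => round_log (round_poly (f i) (r i) j) (r i j)) (nvars n C i)
  ++ [:: (true, ((W i.+1).@[fun j => chal1 n C coins i j])%R);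
         (true, ((W i.+1).@[fun j => chal2 n C coins i j])%R)]
  ++ [seq (true, ((mmap (@polyC F) (fun j : 'I__ => line (chal1 n C coins i) (chal2 n C coins i) j) (W i.+1))`_k)%R)
       | k <- iota 0 (v i.+1).+1] ++ [:: (false, line_chal n C coins i)].
Proof.
move=> id; rewrite /layer_conversation -/(logs _ _); congr (_ ++ _).
  apply: eq_logs => j jm; rewrite /round_log.
  rewrite -(honest_round id jm (isT : 0 < 3)) -(honest_round id jm (isT : 1 < 3)).
  by rewrite -(honest_round id jm (isT : 2 < 3)).
rewrite [in RHS]catA; congr (_ ++ _).
pose s := [:: ((W i.+1).@[fun j => chal1 n C coins i j])%R; ((W i.+1).@[fun j => chal2 n C coins i j])%R].
transitivity [seq (true, y) | y <- s ++ [seq ((mmap (@polyC F) (fun j : 'I__ => line (chal1 n C coins i) (chal2 n C coins i) j) (W i.+1))`_k)%R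
       | k <- iota 0 (v i.+1).+1]].
  apply: (@eq_from_nth _ (true, 0%R)); first by rewrite !size_map !size_cat !size_map !size_iota.
  move=> k; rewrite size_map size_iota => hk.
  rewrite (nth_map 0) ?size_iota // nth_iota // add0n honest_tail // (nth_map 0%R) //.
  by rewrite size_cat size_map size_iota.
by rewrite map_cat -map_comp.
Qed.

End Conversation.

(** * A structured language on the word RAM *)

Inductive iexp :=
| IVar (r : nat) | ICst (c : nat) | IBin (o : arith) (e1 e2 : iexp)
| IArr (m : nat) (e : iexp) | IInp (e : iexp).

Inductive fexp :=
| FVar (r : nat) | FCst (c : bool) | FBin (o : farith) (e1 e2 : fexp)
| FArr (m : nat) (e : iexp) | FInp (e : iexp).

Inductive cmd :=
| Skip
| SetI (r : nat) (e : iexp) | SetF (r : nat) (e : fexp)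
| PutI (m : nat) (e1 e2 : iexp) | PutF (m : nat) (e1 : iexp) (e2 : fexp)
| Rand (r : nat) | Out (e : fexp) | In (r : nat)
| Then (c1 c2 : cmd)
| CaseI (e : iexp) (c0 c1 : cmd)     (* [c0] when [e] is zero *)
| CaseF (e : fexp) (c0 c1 : cmd)
| For (r : nat) (e : iexp) (c : cmd) (* the number of rounds is fixed on entry *)
| While (e : iexp) (c : cmd).

(* Registers from 50 on are temporaries, so variables are below 50; cell [i] of
   array [m < 16] lives at address [16 * i + m]. *)
Fixpoint iwf e := match e with
| IVar r => r < 50 | ICst _ => true | IBin _ e1 e2 => iwf e1 && iwf e2
| IArr m e => (m < 16) && iwf e | IInp e => iwf e end.

Fixpoint fwf e := match e with
| FVar r => r < 50 | FCst _ => true | FBin _ e1 e2 => fwf e1 && fwf e2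
| FArr m e => (m < 16) && iwf e | FInp e => iwf e end.

Fixpoint cwf c := match c with
| Skip => true
| SetI r e => (r < 50) && iwf e | SetF r e => (r < 50) && fwf e
| PutI m e1 e2 => [&& m < 16, iwf e1 & iwf e2]
| PutF m e1 e2 => [&& m < 16, iwf e1 & fwf e2]
| Rand r => r < 50 | Out e => fwf e | In r => r < 50
| Then c1 c2 => cwf c1 && cwf c2
| CaseI e c0 c1 => [&& iwf e, cwf c0 & cwf c1]
| CaseF e c0 c1 => [&& fwf e, cwf c0 & cwf c1]
| For r e c => [&& r < 50, iwf e & cwf c]
| While e c => iwf e && cwf c end.

Definition addr m k := Seq (Do (ISet k.+1 16)) (Seq (Do (IOp Mul k k k.+1))
  (Seq (Do (ISet k.+1 m)) (Do (IOp Add k k k.+1)))).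

Fixpoint ci e k := match e with
| IVar r => Seq (Do (ISet k 0)) (Do (IOp Add k r k))
| ICst c => Do (ISet k c)
| IBin o e1 e2 => Seq (ci e1 k) (Seq (ci e2 k.+1) (Do (IOp o k k k.+1)))
| IArr m e => Seq (ci e k) (Seq (addr m k) (Do (ILoad k k)))
| IInp e => Seq (ci e k) (Do (IInput k k)) end.

Fixpoint cf e k := match e with
| FVar r => Seq (Do (FSet k false)) (Do (FOp FAdd k r k))
| FCst c => Do (FSet k c)
| FBin o e1 e2 => Seq (cf e1 k) (Seq (cf e2 k.+1) (Do (FOp o k k k.+1)))
| FArr m e => Seq (ci e k) (Seq (addr m k) (Do (FLoad k k)))
| FInp e => Seq (ci e k) (Do (FInput k k)) end.

(** Registers from [k] on are free temporaries. A counted loop keeps the rounds left in [k] and the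
    index in [k.+1], and its body starts at [k.+2], so the body can disturb neither these nor the
    number of rounds. *)
Fixpoint compile c k := match c with
| Skip => Nop
| SetI r e => Seq (ci e k) (Seq (Do (ISet k.+1 0)) (Do (IOp Add r k k.+1)))
| SetF r e => Seq (cf e k) (Seq (Do (FSet k.+1 false)) (Do (FOp FAdd r k k.+1)))
| PutI m e1 e2 =>
    Seq (Seq (ci e1 k) (addr m k)) (Seq (ci e2 k.+1) (Do (IStore k k.+1)))
| PutF m e1 e2 =>
    Seq (Seq (ci e1 k) (addr m k)) (Seq (cf e2 k.+1) (Do (FStore k k.+1)))
| Rand r => Do (FRand r)
| Out e => Seq (cf e k) (Do (FSend k))
| In r => Do (FRecv r)
| Then c1 c2 => Seq (compile c1 k) (compile c2 k)
| CaseI e c0 c1 => Seq (ci e k) (IfZero k (compile c0 k) (compile c1 k))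
| CaseF e c0 c1 => Seq (cf e k) (IfFZero k (compile c0 k) (compile c1 k))
| For r e c =>
    Seq (Seq (ci e k) (Do (ISet k.+1 0)))
      (WhileNZ k (Seq (Seq (Do (ISet k.+2 0)) (Do (IOp Add r k.+1 k.+2)))
        (Seq (compile c k.+2) (Seq (Do (ISet k.+2 1))
          (Seq (Do (IOp Add k.+1 k.+1 k.+2)) (Do (IOp Defs.Sub k k k.+2)))))))
| While e c => Seq (ci e k) (WhileNZ k (Seq (compile c k) (ci e k))) end.

Fixpoint icost e := match e with
| IVar _ => 2 | ICst _ => 1 | IBin _ e1 e2 => icost e1 + (icost e2 + 1)
| IArr _ e => icost e + 5 | IInp e => icost e + 1 end.

Fixpoint fcost e := match e with
| FVar _ => 2 | FCst _ => 1 | FBin _ e1 e2 => fcost e1 + (fcost e2 + 1)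
| FArr _ e => icost e + 5 | FInp e => icost e + 1 end.

Fixpoint ivars c := match c with
| SetI r _ => [:: r] | For r _ c => r :: ivars c
| Then c1 c2 | CaseI _ c1 c2 | CaseF _ c1 c2 => ivars c1 ++ ivars c2
| While _ c => ivars c | _ => [::] end.

Fixpoint fvars c := match c with
| SetF r _ | Rand r | In r => [:: r] | For _ _ c | While _ c => fvars c
| Then c1 c2 | CaseI _ c1 c2 | CaseF _ c1 c2 => fvars c1 ++ fvars c2
| _ => [::] end.

Fixpoint iarrs c := match c with
| PutI m _ _ => [:: m] | For _ _ c | While _ c => iarrs c
| Then c1 c2 | CaseI _ c1 c2 | CaseF _ c1 c2 => iarrs c1 ++ iarrs c2
| _ => [::] end.

Fixpoint farrs c := match c with
| PutF m _ _ => [:: m] | For _ _ c | While _ c => farrs c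
| Then c1 c2 | CaseI _ c1 c2 | CaseF _ c1 c2 => farrs c1 ++ farrs c2
| _ => [::] end.

Fixpoint draws c := match c with
| Rand _ => true | For _ _ c | While _ c => draws c
| Then c1 c2 | CaseI _ c1 c2 | CaseF _ c1 c2 => draws c1 || draws c2
| _ => false end.

Fixpoint talks c := match c with
| In _ | Out _ => true | For _ _ c | While _ c => talks c
| Then c1 c2 | CaseI _ c1 c2 | CaseF _ c1 c2 => talks c1 || talks c2
| _ => false end.

(** * Weakest preconditions with exact time, and frames *)

Record store (F : Type) := Store {
  iv : nat -> nat; fv : nat -> F; ia : nat -> nat -> nat; fa : nat -> nat -> F;
  drawn : nat; heard : nat; log : seq (bool * F) }.

Definition upd2 T (f : nat -> nat -> T) m i v := upd f m (upd (f m) i v).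

Section Semantics.
Variables (F : fieldType) (E : env F) (W N : nat).

Definition seti (s : store F) r x :=
  Store (upd (iv s) r x) (fv s) (ia s) (fa s) (drawn s) (heard s) (log s).
Definition setf (s : store F) r x :=
  Store (iv s) (upd (fv s) r x) (ia s) (fa s) (drawn s) (heard s) (log s).
Definition puti (s : store F) m i x :=
  Store (iv s) (fv s) (upd2 (ia s) m i x) (fa s) (drawn s) (heard s) (log s).
Definition putf (s : store F) m i x :=
  Store (iv s) (fv s) (ia s) (upd2 (fa s) m i x) (drawn s) (heard s) (log s).
Definition drawf (s : store F) r :=
  Store (iv s) (upd (fv s) r (random E (drawn s))) (ia s) (fa s) (drawn s).+1
      (heard s) (log s).
Definition hear (s : store F) r := let y := inbox E (heard s) in
  Store (iv s) (upd (fv s) r y) (ia s) (fa s) (drawn s) (heard s).+1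
      (rcons (log s) (false, y)).
Definition say (s : store F) x :=
  Store (iv s) (fv s) (ia s) (fa s) (drawn s) (heard s) (rcons (log s) (true, x)).

Fixpoint ieval e (s : store F) := match e with
| IVar r => iv s r | ICst c => c
| IBin o e1 e2 => arith_op o (ieval e1 s) (ieval e2 s)
| IArr m e => ia s m (ieval e s)
| IInp e => nth 0 (iinput E) (ieval e s) end.

Fixpoint feval e (s : store F) := match e with
| FVar r => fv s r | FCst c => (c%:R)%R
| FBin o e1 e2 => farith_op o (feval e1 s) (feval e2 s)
| FArr m e => fa s m (ieval e s)
| FInp e => nth 0%R (finput E) (ieval e s) end.

(* Subtraction and division need no bound: they never exceed their first
   operand. *)
Fixpoint isafe e s := match e with
| IVar _ => true | ICst c => c <= W
| IBin o e1 e2 => [&& isafe e1 s, isafe e2 s &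
    if o is (Add | Mul) then arith_op o (ieval e1 s) (ieval e2 s) <= W else true]
| IArr _ e => isafe e s && (ieval e s < N)
| IInp e => isafe e s && (nth 0 (iinput E) (ieval e s) <= W) end.

Fixpoint fsafe e s := match e with
| FVar _ | FCst _ => true | FBin _ e1 e2 => fsafe e1 s && fsafe e2 s
| FArr _ e => isafe e s && (ieval e s < N) | FInp e => isafe e s end.

Definition post := nat -> store F -> Prop.

(** The compiled loop spends five instructions per round on copying and updating its counters and
    one on the test; leaving costs the last test. *)
Fixpoint forwp (body : nat -> store F -> post -> Prop) n i s (Q : post) :=
  if n is n'.+1 then
    body i s (fun t s1 => forwp body n' i.+1 s1 (fun t' => Q (t + 5 + t').+1))
  else Q 1 s.

Fixpoint whilewp e (body : store F -> post -> Prop) n s (Q : post) :=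
  isafe e s /\ if ieval e s == 0 then Q (icost e + 1) s else
  if n is n'.+1 then
    body s (fun t s1 => whilewp e body n' s1 (fun t' => Q (icost e + (t + t').+1)))
  else False.

(** The postcondition also receives the exact running time. The safety conditions exclude the steps
    at which the machine would be stuck, and the iteration bound asked of [While] makes this total
    correctness. *)
Fixpoint wp c s (Q : post) {struct c} : Prop := match c with
| Skip => Q 0 s
| SetI r e => isafe e s /\ Q (icost e + 2) (seti s r (ieval e s))
| SetF r e => fsafe e s /\ Q (fcost e + 2) (setf s r (feval e s))
| PutI m e1 e2 => [&& isafe e1 s, ieval e1 s < N & isafe e2 s]
    /\ Q (icost e1 + 4 + (icost e2 + 1)) (puti s m (ieval e1 s) (ieval e2 s))
| PutF m e1 e2 => [&& isafe e1 s, ieval e1 s < N & fsafe e2 s]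
    /\ Q (icost e1 + 4 + (fcost e2 + 1)) (putf s m (ieval e1 s) (feval e2 s))
| Rand r => Q 1 (drawf s r)
| Out e => fsafe e s /\ Q (fcost e + 1) (say s (feval e s))
| In r => Q 1 (hear s r)
| Then c1 c2 => wp c1 s (fun t s1 => wp c2 s1 (fun t' => Q (t + t')))
| CaseI e c0 c1 => isafe e s /\
    (if ieval e s == 0 then wp c0 s (fun t => Q (icost e + t.+1))
     else wp c1 s (fun t => Q (icost e + t.+1)))
| CaseF e c0 c1 => fsafe e s /\
    (if (feval e s == 0)%R then wp c0 s (fun t => Q (fcost e + t.+1))
     else wp c1 s (fun t => Q (fcost e + t.+1)))
| For r e c => isafe e s /\
    forwp (fun i s => wp c (seti s r i)) (ieval e s) 0 s
          (fun t => Q (icost e + 1 + t))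
| While e c => exists n, whilewp e (wp c) n s Q end.

Lemma forwp_mono (body : nat -> store F -> post -> Prop) :
  (forall i s (Q Q' : post), (forall t s', Q t s' -> Q' t s') ->
     body i s Q -> body i s Q') ->
  forall n i s (Q Q' : post), (forall t s', Q t s' -> Q' t s') ->
    forwp body n i s Q -> forwp body n i s Q'.
Proof.
move=> Hb; elim=> [|n IH] i s Q Q' QQ /=; first exact: QQ.
by apply: Hb => t s1; apply: IH => t' s2; apply: QQ.
Qed.

Lemma whilewp_mono e (body : store F -> post -> Prop) :
  (forall s (Q Q' : post), (forall t s', Q t s' -> Q' t s') ->
     body s Q -> body s Q') ->
  forall n s (Q Q' : post), (forall t s', Q t s' -> Q' t s') ->
    whilewp e body n s Q -> whilewp e body n s Q'.
Proof.
move=> Hb; elim=> [|n IH] s Q Q' QQ /= [-> H]; split=> //; move: H; case: ifP => // _.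
- exact: QQ.
- exact: QQ.
by apply: Hb => t s1; apply: IH => t' s2; apply: QQ.
Qed.

Lemma wp_mono c s (Q Q' : post) :
  (forall t s', Q t s' -> Q' t s') -> wp c s Q -> wp c s Q'.
Proof.
elim: c s Q Q' => /=; try by move=> *; intuition auto.
- by move=> c1 IH1 c2 IH2 s Q Q' QQ; apply: IH1 => t s1; apply: IH2 => t' s2; apply: QQ.
- move=> e c0 IH0 c1 IH1 s Q Q' QQ [-> H]; split=> //; move: H.
  by case: ifP => _; [apply: IH0 | apply: IH1] => t s1; apply: QQ.
- move=> e c0 IH0 c1 IH1 s Q Q' QQ [-> H]; split=> //; move: H.
  by case: ifP => _; [apply: IH0 | apply: IH1] => t s1; apply: QQ.
- move=> r e c IH s Q Q' QQ [-> H]; split=> //; move: H.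
  by apply: forwp_mono => [i s1 P P' PP|t s1]; [apply: IH | apply: QQ].
- move=> e c IH s Q Q' QQ [n H]; exists n; move: H.
  by apply: whilewp_mono => // s1 P P' PP; apply: IH.
Qed.

Definition frame c (s s' : store F) : Prop :=
  [/\ forall r, r \notin ivars c -> iv s' r = iv s r,
      forall r, r \notin fvars c -> fv s' r = fv s r,
      forall m, m \notin iarrs c -> ia s' m = ia s m,
      forall m, m \notin farrs c -> fa s' m = fa s m
    & (~~ draws c -> drawn s' = drawn s)
      /\ (~~ talks c -> heard s' = heard s /\ log s' = log s)].

Lemma frame_refl c s : frame c s s.
Proof. by []. Qed.

Lemma frame_trans c s1 s2 s3 : frame c s1 s2 -> frame c s2 s3 -> frame c s1 s3.
Proof.
case=> A1 A2 A3 A4 [A5 A6] [B1 B2 B3 B4 [B5 B6]]; split=> [r h|r h|m h|m h|].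
- by rewrite B1 ?A1.
- by rewrite B2 ?A2.
- by rewrite B3 ?A3.
- by rewrite B4 ?A4.
split=> h; first by rewrite B5 ?A5.
by case: (B6 h) => -> ->; apply: A6.
Qed.

Lemma frame_sub c c' s s' :
  {subset ivars c <= ivars c'} -> {subset fvars c <= fvars c'} ->
  {subset iarrs c <= iarrs c'} -> {subset farrs c <= farrs c'} ->
  (draws c -> draws c') -> (talks c -> talks c') ->
  frame c s s' -> frame c' s s'.
Proof.
move=> S1 S2 S3 S4 S5 S6 [A1 A2 A3 A4 [A5 A6]]; split=> [r h|r h|m h|m h|].
- by apply/A1/(contra (S1 _)).
- by apply/A2/(contra (S2 _)).
- by apply/A3/(contra (S3 _)).
- by apply/A4/(contra (S4 _)).
by split=> h; [apply/A5/(contra S5) | apply/A6/(contra S6)].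
Qed.

Lemma frame_seti c s r x : r \in ivars c -> frame c s (seti s r x).
Proof.
move=> h; split=> //= r' h'; rewrite /upd; case: eqP => // e.
by move: h'; rewrite e h.
Qed.

(** The reference store [s0] is kept apart from the current one so that the induction passes through
    loops, where each round is compared with the start of the whole loop. *)
Lemma wp_frame0 c s0 s (Q : post) : frame c s0 s -> wp c s Q ->
  wp c s (fun t s' => Q t s' /\ frame c s0 s').
Proof.
elim: c s0 s Q => /=.
- by [].
- by move=> r e s0 s Q f [-> q]; do 2!split=> //; apply: frame_trans f (frame_seti _ _ _); rewrite inE.
- move=> r e s0 s Q f [-> q]; do 2!split=> //; apply: frame_trans f _; split=> //= r'.
  by rewrite inE /upd => /negbTE->.
- move=> m e1 e2 s0 s Q f [-> q]; do 2!split=> //; apply: frame_trans f _; split=> //= r'.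
  by rewrite inE /upd2 /upd => /negbTE->.
- move=> m e1 e2 s0 s Q f [-> q]; do 2!split=> //; apply: frame_trans f _; split=> //= r'.
  by rewrite inE /upd2 /upd => /negbTE->.
- move=> r s0 s Q f q; split=> //; apply: frame_trans f _; split=> //= r'.
  by rewrite inE /upd => /negbTE->.
- by move=> e s0 s Q f [-> q]; do 2!split=> //; apply: frame_trans f _; split.
- move=> r s0 s Q f q; split=> //; apply: frame_trans f _; split=> //= r'.
  by rewrite inE /upd => /negbTE->.
- move=> c1 IH1 c2 IH2 s0 s Q f H.
  apply: wp_mono (IH1 s s _ (frame_refl _ _) H) => t s1 [/(IH2 s1) H2 f1].
  apply: wp_mono (H2 (frame_refl _ _)) => t' s2 [q f2]; split=> //.
  apply: frame_trans f _.
  apply: frame_trans (frame_sub _ _ _ _ _ _ f1) (frame_sub _ _ _ _ _ _ f2) => /=;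
    by [move=> x; rewrite mem_cat => ->; rewrite ?orbT | move=> ->; rewrite ?orbT].
- move=> e c0 IH0 c1 IH1 s0 s Q f [-> H]; split=> //; move: H; case: ifP => _ H.
    apply: wp_mono (IH0 s s _ (frame_refl _ _) H) => t s1 [q f1]; split=> //.
    apply: frame_trans f (frame_sub _ _ _ _ _ _ f1) => /=;
    by [move=> x; rewrite mem_cat => ->; rewrite ?orbT | move=> ->; rewrite ?orbT].
  apply: wp_mono (IH1 s s _ (frame_refl _ _) H) => t s1 [q f1]; split=> //.
  apply: frame_trans f (frame_sub _ _ _ _ _ _ f1) => /=;
  by [move=> x; rewrite mem_cat => ->; rewrite ?orbT | move=> ->; rewrite ?orbT].
- move=> e c0 IH0 c1 IH1 s0 s Q f [-> H]; split=> //; move: H; case: ifP => _ H.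
    apply: wp_mono (IH0 s s _ (frame_refl _ _) H) => t s1 [q f1]; split=> //.
    apply: frame_trans f (frame_sub _ _ _ _ _ _ f1) => /=;
    by [move=> x; rewrite mem_cat => ->; rewrite ?orbT | move=> ->; rewrite ?orbT].
  apply: wp_mono (IH1 s s _ (frame_refl _ _) H) => t s1 [q f1]; split=> //.
  apply: frame_trans f (frame_sub _ _ _ _ _ _ f1) => /=;
  by [move=> x; rewrite mem_cat => ->; rewrite ?orbT | move=> ->; rewrite ?orbT].
- move=> r e c IH s0 s Q f [-> H]; split=> //.
  suff L n i s1 (P : post) : frame (For r e c) s0 s1 ->
    forwp (fun i s => wp c (seti s r i)) n i s1 P ->
    forwp (fun i s => wp c (seti s r i)) n i s1
      (fun t s' => P t s' /\ frame (For r e c) s0 s').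
    exact: L f H.
  elim: n i s1 P => [|n IHn] i s1 P f1 //= H1.
  apply: wp_mono (IH (seti s1 r i) (seti s1 r i) _ (frame_refl _ _) H1) => t s2 [q f2].
  apply: IHn q; apply: frame_trans f1 _.
  apply: frame_trans (_ : frame _ s1 (seti s1 r i)) _.
    by apply: frame_seti; rewrite /= inE eqxx.
  apply: frame_sub f2 => //= x; rewrite inE => ->; exact: orbT.
- move=> e c IH s0 s Q f [n H]; exists n; elim: n s Q f H => [|n IHn] s Q f /= [-> H].
    by split=> //; move: H; case: ifP.
  split=> //; move: H; case: ifP => // _ H.
  apply: wp_mono (IH s s _ (frame_refl _ _) H) => t s1 [q f1].
  by apply: IHn q; apply: frame_trans f f1.
Qed.

Lemma wp_frame c s (Q : post) :
  wp c s Q -> wp c s (fun t s' => Q t s' /\ frame c s s').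
Proof. exact: wp_frame0. Qed.

Lemma wp_seq c1 c2 s (Q : post) :
  wp c1 s (fun t s1 => wp c2 s1 (fun t' => Q (t + t'))) -> wp (Then c1 c2) s Q.
Proof. by []. Qed.

Lemma frame_iv c s s' r : frame c s s' -> r \notin ivars c -> iv s' r = iv s r.
Proof. by case=> h _ _ _ _; apply: h. Qed.

Lemma frame_fv c s s' r : frame c s s' -> r \notin fvars c -> fv s' r = fv s r.
Proof. by case=> _ h _ _ _; apply: h. Qed.

Lemma frame_ia c s s' m : frame c s s' -> m \notin iarrs c -> ia s' m = ia s m.
Proof. by case=> _ _ h _ _; apply: h. Qed.

Lemma frame_fa c s s' m : frame c s s' -> m \notin farrs c -> fa s' m = fa s m.
Proof. by case=> _ _ _ h _; apply: h. Qed.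

Lemma frame_drawn c s s' : frame c s s' -> ~~ draws c -> drawn s' = drawn s.
Proof. by case=> _ _ _ _ [h _]. Qed.

Lemma frame_heard c s s' : frame c s s' -> ~~ talks c -> heard s' = heard s.
Proof. by case=> _ _ _ _ [_ h] /h []. Qed.

Lemma frame_log c s s' : frame c s s' -> ~~ talks c -> log s' = log s.
Proof. by case=> _ _ _ _ [_ h] /h []. Qed.

Lemma wp_in r s (Q : post) : Q 1 (hear s r) -> wp (In r) s Q.
Proof. by []. Qed.

Lemma wp_rand r s (Q : post) : Q 1 (drawf s r) -> wp (Rand r) s Q.
Proof. by []. Qed.

Lemma wp_skip s (Q : post) : Q 0 s -> wp Skip s Q.
Proof. by []. Qed.

(* Invariant rule; the frame of the whole loop is available in each round. *)
Lemma wp_for (I : nat -> store F -> Prop) (B : nat -> nat) r e c s (n := ieval e s) :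
  isafe e s -> I 0 s ->
  (forall i s', i < n -> I i s' -> frame (For r e c) s s' ->
     wp c (seti s' r i) (fun t s'' => t <= B i /\ I i.+1 s'')) ->
  wp (For r e c) s (fun t s' => [/\ t <= icost e + 2 + \sum_(i < n) (B i + 6),
                                I n s' & frame (For r e c) s s']).
Proof.
move=> sf I0 Hb /=; split=> //.
rewrite -/n -(big_mkord xpredT (fun i => B i + 6)).
suff H k i s' : i + k = n -> I i s' -> frame (For r e c) s s' ->
   forwp (fun i0 s0 => wp c (seti s0 r i0)) k i s'
     (fun t s'' => [/\ t <= 1 + \sum_(i <= j < n) (B j + 6), I n s'' & frame (For r e c) s s'']).
  apply: forwp_mono (H n 0 s _ _ _) => //.
    by move=> i s' Q Q' QQ; apply: wp_mono.
  by move=> t s' [h1 h2 h3]; split=> //; lia.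
elim: k i s' => [|k IH] i s' ikn Ii fr /=.
  by rewrite big_geq; last lia; split=> //; have <-: i = n by lia.
have lin : i < n by lia.
apply: wp_mono (wp_frame (Hb i s' lin Ii fr)) => t s1 [[tB I1] f1].
have f2 : frame (For r e c) s s1.
  apply: frame_trans fr _.
  apply: frame_trans (_ : frame _ s' (seti s' r i)) _.
    by apply: frame_seti; rewrite /= inE eqxx.
  by apply: frame_sub f1 => //= x; rewrite inE => ->; exact: orbT.
apply: forwp_mono (IH i.+1 s1 _ I1 f2); last by lia.
  by move=> j s2 Q Q' QQ; apply: wp_mono.
move=> t' s2 [h1 h2 h3]; split=> //.
rewrite big_ltn //; lia.
Qed.

(* The invariant is indexed by the number of rounds done; [n] rounds in all. *)
Lemma wp_while (I : nat -> store F -> Prop) (B n : nat) e c s :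
  I 0 s ->
  (forall i s', i <= n -> I i s' -> isafe e s' /\ (ieval e s' == 0) = (i == n)) ->
  (forall i s', i < n -> I i s' -> frame (While e c) s s' ->
     wp c s' (fun t s'' => t <= B /\ I i.+1 s'')) ->
  wp (While e c) s (fun t s' => [/\ t <= n.+1 * (B + icost e + 1),
                                I n s' & frame (While e c) s s']).
Proof.
move=> I0 He Hb /=; exists n.
suff H k i s' : i + k = n -> I i s' -> frame (While e c) s s' ->
   whilewp e (wp c) k s'
     (fun t s'' => [/\ t <= k.+1 * (B + icost e + 1), I n s'' & frame (While e c) s s'']).
  exact: (H n 0 s (add0n n) I0 (frame_refl _ _)).
elim: k i s' => [|k IH] i s' ikn Ii fr /=.
  have [-> ->] := He i s' ltac:(lia) Ii; have -> : i = n by lia.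
  rewrite eqxx; split=> //; split=> //; first lia.
  by have <- : i = n by lia.
have [-> ->] := He i s' ltac:(lia) Ii; split=> //.
rewrite ifF; last by apply/eqP; lia.
apply: wp_mono (wp_frame (Hb i s' _ Ii fr)); last by lia.
move=> t s1 [[tB I1] f1].
apply: whilewp_mono (IH i.+1 s1 _ I1 _); last 2 first.
- lia.
- exact: frame_trans fr f1.
- by move=> *; apply: wp_mono; eauto.
by move=> t' s2 [h1 h2 h3]; split=> //; rewrite !mulSn in h1 *; lia.
Qed.

(** * Correctness of the compilation to the word RAM *)

Variable M : nat.
Hypotheses (NM : 16 * N <= M) (MW : 16 * N <= W) (W16 : 16 <= W).

(** The last two clauses bound every register and cell, temporaries included; they are what makes
    copies and loads fit in a word without a test. *)
Definition represents (s : store F) (l : state F) : Prop :=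
  [/\ forall r, r < 50 -> ireg l r = iv s r /\ freg l r = fv s r,
      forall m i, m < 16 -> imem l (16 * i + m) = ia s m i
                         /\ fmem l (16 * i + m) = fa s m i,
      [/\ nrandom l = drawn s, nreceived l = heard s & trace l = log s],
      forall r, ireg l r <= W
    & forall a, imem l a <= W].

Lemma rel_start :
  represents (Store (fun=> 0) (fun=> 0%R) (fun _ _ => 0) (fun _ _ => 0%R) 0 0 [::]) (start F).
Proof. by []. Qed.

Definition withregs (l : state F) ir fr :=
  State ir fr (imem l) (fmem l) (nrandom l) (nreceived l) (trace l).

Lemma updE T (f : nat -> T) k v j : upd f k v j = if j == k then v else f j.
Proof. by []. Qed.

Lemma runs_set l ir fr r x : x <= W -> runs E W M (Do (ISet r x)) (withregs l ir fr) 1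
  (withregs l (upd ir r x) fr).
Proof. by move=> h; constructor; rewrite /= /set_ireg h. Qed.

Lemma runs_op l ir fr o r a b : arith_op o (ir a) (ir b) <= W ->
  runs E W M (Do (IOp o r a b)) (withregs l ir fr) 1
  (withregs l (upd ir r (arith_op o (ir a) (ir b))) fr).
Proof. by move=> h; constructor; rewrite /= /set_ireg h. Qed.

Arguments runs_op : clear implicits.

Definition temps k (ir ir' : nat -> nat) :=
  (forall r, r < k -> ir' r = ir r) /\ (forall r, ir' r <= W).

Lemma temps_trans k k' ir ir1 ir2 : k <= k' ->
  temps k ir ir1 -> temps k' ir1 ir2 -> temps k ir ir2.
Proof.
by move=> kk [a1 a2] [b1 b2]; split=> // r rk; rewrite b1 ?a1 //; apply: leq_trans kk.
Qed.

Lemma temps_upd k ir ir' r x : k <= r -> x <= W ->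
  temps k ir ir' -> temps k ir (upd ir' r x).
Proof.
move=> kr xW [h1 h2]; split=> j; rewrite updE; case: eqP => // e; last exact: h1.
by move=> jk; lia.
Qed.

Lemma rel_temps k s l ir fr : 50 <= k -> represents s l -> temps k (ireg l) ir ->
  (forall r, r < k -> fr r = freg l r) -> represents s (withregs l ir fr).
Proof.
move=> k50 [R1 R2 R3 R4 R5] [T1 T2] Tf; split=> //= r rk.
by rewrite T1 ?Tf; [apply: R1 | lia | lia].
Qed.

Lemma runs_addr m k l ir fr i : m < 16 -> i < N -> ir k = i -> temps k ir ir ->
  exists ir', [/\ runs E W M (addr m k) (withregs l ir fr) 4 (withregs l ir' fr),
    temps k ir ir' & ir' k = 16 * i + m].
Proof.
move=> m16 iN irk t0.
set i1 := upd ir k.+1 16; set i2 := upd i1 k (i1 k * i1 k.+1).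
set i3 := upd i2 k.+1 m; exists (upd i3 k (i3 k + i3 k.+1)).
have e1 : i1 k * i1 k.+1 = 16 * i.
  by rewrite /i1 !updE eqxx ltn_eqF // irk mulnC.
have e3 : i3 k + i3 k.+1 = 16 * i + m.
  by rewrite /i3 !updE eqxx ltn_eqF //= /i2 updE eqxx e1.
split.
- rewrite -[4]/(1 + (1 + (1 + 1))).
  apply: runs_seq (runs_set _ _ _ _ W16) _.
  apply: runs_seq (runs_op _ _ _ Mul _ _ _ _) _.
    by rewrite /= -/i1 e1; lia.
  apply: runs_seq (runs_set _ _ _ _ _) _; first lia.
  by apply: (runs_op _ _ _ Add); rewrite /= -/i1 -/i2 -/i3 e3; lia.
- apply: temps_upd => //; first by rewrite e3; lia.
  apply: temps_upd; try lia; apply: temps_upd => //; first by rewrite e1; lia.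
  by apply: temps_upd => //; lia.
- by rewrite updE eqxx.
Qed.

Lemma withregsE l : withregs l (ireg l) (freg l) = l.
Proof. by case: l. Qed.

Lemma ci_ok e k s l : 50 <= k -> iwf e -> represents s l -> isafe e s ->
  exists ir, [/\ runs E W M (ci e k) l (icost e) (withregs l ir (freg l)),
    temps k (ireg l) ir & ir k = ieval e s].
Proof.
elim: e k s l => [r|c|o e1 IH1 e2 IH2|m e IH|e IH] k s l k50 /= w R sf;
  have [R1 R2 R3 R4 R5] := R.
- set i1 := upd (ireg l) k 0; exists (upd i1 k (i1 r + i1 k)).
  have e1 : i1 r + i1 k = iv s r.
    rewrite /i1 !updE eqxx addn0; case: eqP => [rk|_]; first by lia.
    by case: (R1 r w).
  have eW : i1 r + i1 k <= W by rewrite e1 -(proj1 (R1 r w)).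
  split.
  + rewrite -[2]/(1 + 1) -{1}[l]withregsE; apply: runs_seq (runs_set _ _ _ _ (leq0n _)) _.
    exact: (runs_op _ _ _ Add).
  + by do 2![apply: temps_upd => //].
  + by rewrite updE eqxx.
- exists (upd (ireg l) k c); split.
  + by rewrite -{1}[l]withregsE; apply: runs_set.
  + exact: temps_upd.
  + by rewrite updE eqxx.
- have /andP[w1 w2] := w; have /and3P[sf1 sf2 sf3] := sf.
  have [i1 [r1 t1 v1]] := IH1 k s l k50 w1 R sf1.
  have R' := rel_temps k50 R t1 (fun r _ => erefl (freg l r)).
  have k51 : 50 <= k.+1 by lia.
  have [i2 [r2 t2 v2]] := IH2 k.+1 s _ k51 w2 R' sf2.
  have vk : i2 k = ieval e1 s by rewrite -v1; apply: (proj1 t2).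
  have vW : arith_op o (i2 k) (i2 k.+1) <= W.
    have h : i2 k <= W by case: t2.
    rewrite v2; case: o sf3 {sf IH1 IH2 R' r1 r2} => //=; rewrite vk // => _.
      by apply: leq_trans (leq_subr _ _) _; rewrite -vk.
    by apply: leq_trans (leq_div _ _) _; rewrite -vk.
  exists (upd i2 k (arith_op o (i2 k) (i2 k.+1))); split.
  + by apply: runs_seq r1 (runs_seq r2 (runs_op _ _ _ _ _ _ _ vW)).
  + apply: temps_upd => //; exact: temps_trans _ t1 t2.
  + by rewrite updE eqxx vk v2.
- have /andP[w1 w2] := w; have /andP[sf1 sf2] := sf.
  have [i1 [r1 t1 v1]] := IH k s l k50 w2 R sf1.
  have t11 : temps k i1 i1 by case: t1 => _ ?; split.
  have [i2 [r2 t2 v2]] := runs_addr l (freg l) w1 sf2 v1 t11.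
  exists (upd i2 k (imem l (i2 k))); split.
  + have -> : icost e + 5 = icost e + (4 + 1) by [].
    apply: runs_seq r1 (runs_seq r2 _); constructor; rewrite /= /set_ireg R5 ifT //.
    by rewrite v2; lia.
  + apply: temps_upd => //; exact: temps_trans _ t1 t2.
  + by rewrite updE eqxx v2; case: (R2 m (ieval e s)).
- have /andP[sf1 sf2] := sf.
  have [i1 [r1 t1 v1]] := IH k s l k50 w R sf1.
  exists (upd i1 k (nth 0 (iinput E) (i1 k))); split.
  + by apply: runs_seq r1 _; constructor; rewrite /= /set_ireg /= v1 sf2.
  + by apply: temps_upd; rewrite ?v1.
  + by rewrite updE eqxx v1.
Qed.

Lemma cf_ok e k s l : 50 <= k -> fwf e -> represents s l -> fsafe e s ->
  exists ir fr, [/\ runs E W M (cf e k) l (fcost e) (withregs l ir fr),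
    temps k (ireg l) ir, forall r, r < k -> fr r = freg l r & fr k = feval e s].
Proof.
elim: e k s l => [r|c|o e1 IH1 e2 IH2|m e|e] k s l k50 /= w R sf;
  have [R1 R2 R3 R4 R5] := R.
- set i1 := upd (freg l) k (false%:R)%R.
  exists (ireg l), (upd i1 k (i1 r + i1 k)%R).
  split=> //.
  + by rewrite -[2]/(1 + 1); apply: (@runs_seq _ _ _ _ _ _ _ (withregs l (ireg l) i1)); constructor.
  + by move=> j jk; rewrite /i1 !updE ltn_eqF.
  + rewrite /i1 !updE eqxx /= GRing.addr0; case: eqP => [rk|_]; first by lia.
    by case: (R1 r w).
- exists (ireg l), (upd (freg l) k (c%:R)%R); split=> //; first by constructor.
    by move=> j jk; rewrite !updE ltn_eqF.
  by rewrite updE eqxx.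
- have /andP[w1 w2] := w; have /andP[sf1 sf2] := sf.
  have [i1 [f1 [r1 t1 g1 v1]]] := IH1 k s l k50 w1 R sf1.
  have R' := rel_temps k50 R t1 g1.
  have k51 : 50 <= k.+1 by lia.
  have [i2 [f2 [r2 t2 g2 v2]]] := IH2 k.+1 s _ k51 w2 R' sf2.
  exists i2, (upd f2 k (farith_op o (f2 k) (f2 k.+1))); split.
  + by apply: runs_seq r1 (runs_seq r2 _); constructor.
  + exact: temps_trans _ t1 t2.
  + by move=> j jk; have h := g2 j; rewrite updE ltn_eqF // h /= ?g1 //; lia.
  + by have h := g2 k (ltnSn k); rewrite updE eqxx v2 h /= v1.
- have /andP[w1 w2] := w; have /andP[sf1 sf2] := sf.
  have [i1 [r1 t1 v1]] := ci_ok k50 w2 R sf1.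
  have t11 : temps k i1 i1 by case: t1 => _ ?; split.
  have [i2 [r2 t2 v2]] := runs_addr l (freg l) w1 sf2 v1 t11.
  exists i2, (upd (freg l) k (fmem l (i2 k))); split.
  + have -> : icost e + 5 = icost e + (4 + 1) by [].
    apply: runs_seq r1 (runs_seq r2 _); constructor; rewrite /= ifT //.
    by rewrite v2; lia.
  + exact: temps_trans _ t1 t2.
  + by move=> j jk; rewrite updE ltn_eqF.
  + by rewrite updE eqxx v2; case: (R2 m (ieval e s)).
- have [i1 [r1 t1 v1]] := ci_ok k50 w R sf.
  exists i1, (upd (freg l) k (nth 0%R (finput E) (i1 k))); split=> //.
  + by apply: runs_seq r1 _; constructor.
  + by move=> j jk; rewrite updE ltn_eqF.
  + by rewrite updE eqxx v1.
Qed.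

Lemma rel_seti s l r x : r < 50 -> x <= W -> represents s l ->
  represents (seti s r x) (withregs l (upd (ireg l) r x) (freg l)).
Proof.
move=> r50 xW [R1 R2 R3 R4 R5]; split=> //= j; rewrite !updE.
  by move=> jk; have [? ?] := R1 j jk; case: eqP.
by case: eqP.
Qed.

Lemma rel_setf s l r x : r < 50 -> represents s l ->
  represents (setf s r x) (withregs l (ireg l) (upd (freg l) r x)).
Proof.
move=> r50 [R1 R2 R3 R4 R5]; split=> //= j; rewrite !updE.
by move=> jk; have [? ?] := R1 j jk; case: eqP.
Qed.

Lemma addr_inj m m' i i' : m < 16 -> m' < 16 ->
  (16 * i + m == 16 * i' + m') = (m == m') && (i == i').
Proof. lia. Qed.

(** Induction on the command. The last clause says that temporaries below [k] survive; an enclosing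
    loop relies on it for its two counters. *)
Lemma wp_runs c k s l (Q : post) : 50 <= k -> cwf c -> represents s l -> wp c s Q ->
  exists t l' s', [/\ runs E W M (compile c k) l t l', represents s' l', Q t s'
    & forall r, 50 <= r < k -> ireg l' r = ireg l r].
Proof.
elim: c k s l Q => /=.
- by move=> k s l Q k50 _ R q; exists 0, l, s; split=> //; constructor.
- move=> r e k s l Q k50 /andP[r50 w] R [sf q].
  have [i1 [r1 t1 v1]] := ci_ok k50 w R sf.
  set i2 := upd i1 k.+1 0.
  have v2 : i2 k + i2 k.+1 = ieval e s by rewrite /i2 !updE eqxx ltn_eqF // addn0.
  have t2 : temps k (ireg l) i2 by apply: temps_upd => //; lia.
  have vW : ieval e s <= W by rewrite -v1; case: t1.
  exists (icost e + 2), (withregs l (upd i2 r (ieval e s)) (freg l)), (seti s r (ieval e s)).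
  split=> //.
  + rewrite -[2]/(1 + 1); apply: runs_seq r1 _.
    apply: runs_seq (runs_set _ _ _ _ (leq0n _)) _; rewrite -/i2 -v2.
    by apply: (runs_op _ _ _ Add); rewrite /= v2.
  + exact: (rel_seti r50 vW (rel_temps k50 R t2 (fun r _ => erefl (freg l r)))).
  + move=> j /= h; rewrite updE; case: eqP => [?|_]; first by lia.
    by apply: (proj1 t2); lia.
- move=> r e k s l Q k50 /andP[r50 w] R [sf q].
  have [i1 [f1 [r1 t1 g1 v1]]] := cf_ok k50 w R sf.
  set f2 := upd f1 k.+1 (false%:R)%R.
  have v2 : (f2 k + f2 k.+1)%R = feval e s.
    by rewrite /f2 !updE eqxx ltn_eqF //= GRing.addr0.
  exists (fcost e + 2), (withregs l i1 (upd f2 r (feval e s))), (setf s r (feval e s)).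
  split=> //.
  + rewrite -[2]/(1 + 1); apply: runs_seq r1 _.
    apply: (@runs_seq _ _ _ _ _ _ _ (withregs l i1 f2)); first by constructor.
    by constructor; rewrite -v2.
  + apply: (rel_setf _ r50 (rel_temps k50 R t1 _)) => j jk.
    by rewrite /f2 updE ltn_eqF ?g1 //; lia.
  + by move=> j /= h; apply: (proj1 t1); lia.
- move=> m e1 e2 k s l Q k50 /and3P[m16 w1 w2] R [/and3P[sf1 sfN sf2] q].
  have [i1 [r1 t1 v1]] := ci_ok k50 w1 R sf1.
  have t11 : temps k i1 i1 by case: t1 => _ ?; split.
  have [i2 [r2 t2 v2]] := runs_addr l (freg l) m16 sfN v1 t11.
  have t12 := temps_trans (leqnn k) t1 t2.
  have R2 := rel_temps k50 R t12 (fun r _ => erefl (freg l r)).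
  have k51 : 50 <= k.+1 by lia.
  have [i3 [r3 t3 v3]] := ci_ok k51 w2 R2 sf2.
  have t13 := temps_trans (leqnSn k) t12 t3.
  have vk : i3 k = 16 * ieval e1 s + m by rewrite (proj1 t3).
  exists (icost e1 + 4 + (icost e2 + 1)), (State i3 (freg l) (upd (imem l) (i3 k) (i3 k.+1)) (fmem l)
    (nrandom l) (nreceived l) (trace l)), (puti s m (ieval e1 s) (ieval e2 s)).
  split=> //.
  + apply: runs_seq (runs_seq r1 r2) (runs_seq r3 _); constructor.
    by rewrite /= ifT // vk; lia.
  + have [R31 R32 R33 R34 R35] := rel_temps k50 R t13 (fun r _ => erefl (freg l r)).
    split=> //= [m' i h|a].
      rewrite /upd2 !updE vk addr_inj // v3; have [h1 h2] := R32 m' i h.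
      by split=> //; case: (m' =P m) h1 => [->|_] h1 //=; rewrite updE h1.
    by rewrite updE; case: eqP => _; [exact: (R34 k.+1) | exact: (R35 a)].
  + by move=> j /= h; apply: (proj1 t13); lia.
- move=> m e1 e2 k s l Q k50 /and3P[m16 w1 w2] R [/and3P[sf1 sfN sf2] q].
  have [i1 [r1 t1 v1]] := ci_ok k50 w1 R sf1.
  have t11 : temps k i1 i1 by case: t1 => _ ?; split.
  have [i2 [r2 t2 v2]] := runs_addr l (freg l) m16 sfN v1 t11.
  have t12 := temps_trans (leqnn k) t1 t2.
  have R2 := rel_temps k50 R t12 (fun r _ => erefl (freg l r)).
  have k51 : 50 <= k.+1 by lia.
  have [i3 [f3 [r3 t3 g3 v3]]] := cf_ok k51 w2 R2 sf2.
  have t13 := temps_trans (leqnSn k) t12 t3.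
  have vk : i3 k = 16 * ieval e1 s + m by rewrite (proj1 t3).
  exists (icost e1 + 4 + (fcost e2 + 1)), (State i3 f3 (imem l) (upd (fmem l) (i3 k) (f3 k.+1))
    (nrandom l) (nreceived l) (trace l)), (putf s m (ieval e1 s) (feval e2 s)).
  split=> //.
  + apply: runs_seq (runs_seq r1 r2) (runs_seq r3 _); constructor.
    by rewrite /= ifT // vk; lia.
  + have g13 j : j < k -> f3 j = freg l j by move=> jk; rewrite g3 //; lia.
    have [R31 R32 R33 R34 R35] := rel_temps k50 R t13 g13.
    split=> //= m' i h.
    rewrite /upd2 !updE vk addr_inj // v3; have [h1 h2] := R32 m' i h.
    by split=> //; case: (m' =P m) h2 => [->|_] h2 //=; rewrite updE h2.
  + by move=> j /= h; apply: (proj1 t13); lia.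
- move=> r k s l Q k50 r50 [R1 R2 [R3 R4 R5] R6 R7] q.
  do 3!eexists; split; [by constructor| |exact: q|by []].
  split=> //=; last by split; rewrite ?R3.
  by move=> j jk; rewrite !updE R3; case: eqP => [_|_]; case: (R1 j jk).
- move=> e k s l Q k50 w R [sf q].
  have [i1 [f1 [r1 t1 g1 v1]]] := cf_ok k50 w R sf.
  have [R1 R2 [R3 R4 R5] R6 R7] := rel_temps k50 R t1 g1.
  do 3!eexists; split; [by apply: runs_seq r1 _; constructor| |exact: q|].
    by split=> //=; split=> //; rewrite v1 -R5.
  by move=> j /= h; apply: (proj1 t1); lia.
- move=> r k s l Q k50 r50 [R1 R2 [R3 R4 R5] R6 R7] q.
  do 3!eexists; split; [by constructor| |exact: q|by []].
  split=> //=; last by split; rewrite ?R4 ?R5.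
  by move=> j jk; rewrite !updE R4; case: eqP => [_|_]; case: (R1 j jk).
- move=> c1 IH1 c2 IH2 k s l Q k50 /andP[w1 w2] R H.
  have [t1 [l1 [s1 [r1 R1 H1 k1]]]] := IH1 k s l _ k50 w1 R H.
  have [t2 [l2 [s2 [r2 R2 H2 k2]]]] := IH2 k s1 l1 _ k50 w2 R1 H1.
  exists (t1 + t2), l2, s2; split=> //; first exact: runs_seq r1 r2.
  by move=> r h; rewrite k2 ?k1.
- move=> e c0 IH0 c1 IH1 k s l Q k50 /and3P[w w0 w1] R [sf H].
  have [i1 [r1 t1 v1]] := ci_ok k50 w R sf.
  have R' := rel_temps k50 R t1 (fun r _ => erefl (freg l r)).
  have [t2 [l2 [s2 [r2 R2 q k2]]]] : exists t2 l2 s2,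
    [/\ runs E W M (if i1 k == 0 then compile c0 k else compile c1 k)
          (withregs l i1 (freg l)) t2 l2, represents s2 l2, Q (icost e + t2.+1) s2
       & forall r, 50 <= r < k -> ireg l2 r = i1 r].
    rewrite v1; move: H; case: ifP => _ H; first exact: (IH0 _ _ _ _ k50 w0 R' H).
    exact: (IH1 _ _ _ _ k50 w1 R' H).
  exists (icost e + t2.+1), l2, s2; split=> //; first exact: runs_seq r1 (@runs_if _ _ _ _ k _ _ (withregs l i1 (freg l)) _ _ r2).
  by move=> r h; rewrite k2 //; apply: (proj1 t1); lia.
- move=> e c0 IH0 c1 IH1 k s l Q k50 /and3P[w w0 w1] R [sf H].
  have [i1 [f1 [r1 t1 g1 v1]]] := cf_ok k50 w R sf.
  have R' := rel_temps k50 R t1 g1.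
  have [t2 [l2 [s2 [r2 R2 q k2]]]] : exists t2 l2 s2,
    [/\ runs E W M (if f1 k == 0%R then compile c0 k else compile c1 k)
          (withregs l i1 f1) t2 l2, represents s2 l2, Q (fcost e + t2.+1) s2
       & forall r, 50 <= r < k -> ireg l2 r = i1 r].
    rewrite v1; move: H; case: ifP => _ H; first exact: (IH0 _ _ _ _ k50 w0 R' H).
    exact: (IH1 _ _ _ _ k50 w1 R' H).
  exists (fcost e + t2.+1), l2, s2; split=> //; first exact: runs_seq r1 (@runs_iff _ _ _ _ k _ _ (withregs l i1 f1) _ _ r2).
  by move=> r h; rewrite k2 //; apply: (proj1 t1); lia.
- move=> r e c IH k s l Q k50 /and3P[r50 w wc] R [sf H].
  have [i1 [r1 t1 v1]] := ci_ok k50 w R sf.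
  have vW : ieval e s <= W by rewrite -v1; case: t1.
  set i2 := upd i1 k.+1 0.
  have t2 : temps k (ireg l) i2 by apply: temps_upd => //; lia.
  have R2 := rel_temps k50 R t2 (fun r _ => erefl (freg l r)).
  (* Inner induction on the rounds left; [i + m <= W] keeps the index register within a word. *)
  have L m i s0 l0 (P : post) : represents s0 l0 -> ireg l0 k = m -> ireg l0 k.+1 = i -> i + m <= W ->
      forwp (fun i s => wp c (seti s r i)) m i s0 P ->
      exists t l' s', [/\ runs E W M (WhileNZ k (Seq (Seq (Do (ISet k.+2 0)) (Do (IOp Add r k.+1 k.+2)))
        (Seq (compile c k.+2) (Seq (Do (ISet k.+2 1))
          (Seq (Do (IOp Add k.+1 k.+1 k.+2)) (Do (IOp Defs.Sub k k k.+2))))))) l0 t l', represents s' l', P t s'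
        & forall r, 50 <= r < k -> ireg l' r = ireg l0 r].
    elim: m i s0 l0 P => [|m IHm] i s0 l0 P R0 ek ek1 iW /=.
      by move=> p; exists 1, l0, s0; split=> //; apply: runs_while_end.
    move=> Hb.
    pose j1 := upd (ireg l0) k.+2 0; pose j2 := upd j1 r i.
    have t3 : temps k.+2 (ireg l0) j1.
      by apply: temps_upd => //; split=> //; case: R0.
    have iW' : i <= W by lia.
    have k52 : 50 <= k.+2 by lia.
    have Rj := rel_seti r50 iW' (rel_temps k52 R0 t3 (fun r _ => erefl (freg l0 r))).
    have [t4 [l4 [s4 [r4 R4 H4 k4]]]] := IH k.+2 _ _ _ k52 wc Rj Hb.
    have e4k : ireg l4 k = m.+1.
      rewrite k4 /=; last by lia.
      by rewrite /j1 !updE !ifF ?ek //; apply/eqP; lia.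
    have e4k1 : ireg l4 k.+1 = i.
      rewrite k4 /=; last by lia.
      by rewrite /j1 !updE !ifF ?ek1 //; apply/eqP; lia.
    pose j5 := upd (ireg l4) k.+2 1; pose j6 := upd j5 k.+1 i.+1; pose j7 := upd j6 k m.
    have e5 : j5 k.+1 + j5 k.+2 = i.+1.
      by rewrite /j5 !updE eqxx ifF ?e4k1 ?addn1 //; apply/eqP; lia.
    have e6 : j6 k - j6 k.+2 = m.
      rewrite /j6 /j5 !updE eqxx !ifF ?e4k ?subn1 //; apply/eqP; lia.
    have t7 : temps k (ireg l4) j7.
      apply: temps_upd; try lia; apply: temps_upd; try lia; apply: temps_upd; try lia.
      by split=> //; case: R4.
    have R7 := rel_temps k50 R4 t7 (fun r _ => erefl (freg l4 r)).
    have [t8 [l8 [s8 [r8 R8 H8 k8]]]] := IHm i.+1 s4 _ _ R7 ltac:(by rewrite /= /j7 updE eqxx)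
       ltac:(rewrite /= /j7 /j6 !updE eqxx ifF //; apply/eqP; lia) ltac:(lia) H4.
    exists (t4 + 5 + t8).+1, l8, s8; split=> //.
      have -> : t4 + 5 = 1 + 1 + (t4 + (1 + (1 + 1))) by lia.
      apply: runs_while r8; first by rewrite ek.
      apply: (@runs_seq _ _ _ _ _ _ _ (withregs l0 j2 (freg l0))).
        rewrite -{1}[l0]withregsE; apply: runs_seq (runs_set _ _ _ _ (leq0n _)) _.
        have e2 : j1 k.+1 + j1 k.+2 = i.
          by rewrite /j1 !updE eqxx ifF ?ek1 ?addn0 //; apply/eqP; lia.
        by rewrite -/j1 /j2 -e2; apply: (runs_op _ _ _ Add); rewrite /= e2.
      apply: runs_seq r4 _; rewrite -{1}[l4]withregsE.
      apply: runs_seq (runs_set _ _ _ _ _) _; first by lia.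
      apply: (@runs_seq _ _ _ _ _ _ _ (withregs l4 j6 (freg l4))).
        by rewrite -/j5 /j6 -e5; apply: (runs_op _ _ _ Add); rewrite /= e5; lia.
      by rewrite /j7 -e6; apply: (runs_op _ _ _ Defs.Sub); rewrite /= e6; lia.
    move=> r' h; rewrite k8 //= /j7 /j6 /j5 !updE !ifF; try by apply/eqP; lia.
    rewrite k4 /=; last by lia.
    by rewrite /j1 !updE !ifF //; apply/eqP; lia.
  have [t3 [l3 [s3 [r3 R3 H3 k3]]]] := L _ _ _ _ _ R2
     ltac:(rewrite /= /i2 updE ifF //; apply/eqP; lia)
     ltac:(by rewrite /= /i2 updE eqxx) ltac:(by rewrite v1) ltac:(by rewrite v1; exact: H).
  exists (icost e + 1 + t3), l3, s3; split=> //.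
    apply: runs_seq (runs_seq r1 (runs_set _ _ _ _ (leq0n _))) r3.
  by move=> r' h; rewrite k3 //=; apply: (proj1 t2); lia.
- move=> e c IH k s l Q k50 /andP[w wc] R [n H].
  elim: n s l Q R H => [|n IHn] s l Q R /= [sf H];
    have [i1 [r1 t1 v1]] := ci_ok k50 w R sf;
    have R' := rel_temps k50 R t1 (fun r _ => erefl (freg l r)).
    case: ifP H => // /eqP e0 q; exists (icost e + 1), (withregs l i1 (freg l)), s.
    split=> //; last by move=> r h; apply: (proj1 t1); lia.
    by apply: runs_seq r1 _; apply: runs_while_end; rewrite /= v1.
  case: ifP H => [/eqP e0 q|/eqP e0 H].
    exists (icost e + 1), (withregs l i1 (freg l)), s.
    split=> //; last by move=> r h; apply: (proj1 t1); lia.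
    by apply: runs_seq r1 _; apply: runs_while_end; rewrite /= v1.
  have [t2 [l2 [s2 [r2 R2 H2 k2]]]] := IH k s _ _ k50 wc R' H.
  have [t3 [l3 [s3 [r3 R3 H3 k3]]]] := IHn _ _ _ R2 H2.
  exists (icost e + (t2 + t3).+1), l3, s3; split=> //; last first.
    by move=> r h; rewrite k3 // k2 //=; apply: (proj1 t1); lia.
  (* The run given by the induction hypothesis starts with an evaluation of the test; that piece is
     cut off and becomes the end of the first loop body. *)
  apply: runs_seq r1 _; inversion r3; subst.
  rewrite addnA; apply: runs_while; [by rewrite /= v1|by apply: runs_seq r2 _; eassumption|by []].
Qed.

End Semantics.

Arguments wp : simpl never.

Declare Scope cmd_scope.
Delimit Scope cmd_scope with cmd.
Notation "c1 ;; c2" := (Then c1 c2) (at level 90, right associativity) : cmd_scope.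
Notation "$ r" := (IVar r) (at level 1, r at level 0, format "$ r") : cmd_scope.
Notation "# c" := (ICst c) (at level 1, c at level 0, format "# c") : cmd_scope.
Notation "m $[ e ]" := (IArr m e) (at level 1, e at level 50, left associativity, format "m $[ e ]") : cmd_scope.
Notation "a +$ b" := (IBin Add a b) (at level 50, left associativity) : cmd_scope.
Notation "a -$ b" := (IBin Defs.Sub a b) (at level 50, left associativity) : cmd_scope.
Notation "a *$ b" := (IBin Mul a b) (at level 40, left associativity) : cmd_scope.
Notation "a /$ b" := (IBin Div a b) (at level 40, left associativity) : cmd_scope.
Notation "! r" := (FVar r) (at level 1, r at level 0, format "! r") : cmd_scope.
Notation "m ! [ e ]" := (FArr m e) (at level 1, e at level 50, left associativity, format "m ! [ e ]") : cmd_scope.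
Notation "a +^ b" := (FBin FAdd a b) (at level 50, left associativity) : cmd_scope.
Notation "a -^ b" := (FBin FSub a b) (at level 50, left associativity) : cmd_scope.
Notation "a *^ b" := (FBin FMul a b) (at level 40, left associativity) : cmd_scope.
Notation "r :=$ e" := (SetI r e) (at level 80, e at level 70) : cmd_scope.
Notation "r :=! e" := (SetF r e) (at level 80, e at level 70) : cmd_scope.
Notation "m :[ e1 ] :=$ e2" := (PutI m e1 e2) (at level 80, e1 at level 50, e2 at level 70) : cmd_scope.
Notation "m :[ e1 ] :=! e2" := (PutF m e1 e2) (at level 80, e1 at level 50, e2 at level 70) : cmd_scope.
Open Scope cmd_scope.

Ltac simp := rewrite /= /upd2 /upd /=.
Ltac bounds := simp; repeat (apply/andP; split); try done; try lia.
Ltac step := apply: wp_seq; split; [bounds | simp].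
Ltac io_step := apply: wp_seq; (apply: wp_in || apply: wp_rand); simp.
Ltac last_step := split; [bounds | simp].
Ltac name_state z := match goal with |- wp _ _ _ _ ?x _ => set z := x end.

Ltac frame_step := match goal with
| H : frame _ _ ?s |- context [iv ?s ?r] => rewrite (@frame_iv _ _ _ _ r H isT)
| H : frame _ _ ?s |- context [fv ?s ?r] => rewrite (@frame_fv _ _ _ _ r H isT)
| H : frame _ _ ?s |- context [ia ?s ?r] => rewrite (@frame_ia _ _ _ _ r H isT)
| H : frame _ _ ?s |- context [fa ?s ?r] => rewrite (@frame_fa _ _ _ _ r H isT)
| H : frame _ _ ?s |- context [drawn ?s] => rewrite (@frame_drawn _ _ _ _ H isT)
| H : frame _ _ ?s |- context [heard ?s] => rewrite (@frame_heard _ _ _ _ H isT)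
| H : frame _ _ ?s |- context [log ?s] => rewrite (@frame_log _ _ _ _ H isT)
end.
Ltac frames := repeat (progress (simp; try frame_step)).

(** * Evaluating Lagrange basis polynomials *)

(* [chi] of the label in register 42 at the point stored from [arr[$44]] on, with
   [$43] variables. *)
Definition chi_prog (dst arr : nat) : cmd :=
  dst :=! FCst true;;
  40 :=$ $42;;
  For 41 $43
    (CaseI ($40 -$ #2 *$ ($40 /$ #2))
       (dst :=! !dst *^ (FCst true -^ arr![$44 +$ $41]))
       (dst :=! !dst *^ arr![$44 +$ $41]);;
     40 :=$ $40 /$ #2).

Section Programs.
Variables (F : fieldType) (E : env F) (W N : nat).
Hypotheses (NW : 16 * N <= W) (W16 : 16 <= W).

Lemma chi_progP dst arr (s : store F) v a : iv s 42 = a -> iv s 43 = v -> a <= W -> iv s 44 + v <= N ->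
  wp E W N (chi_prog dst arr) s (fun t s' => [/\ t <= 60 * v + 60,
    fv s' dst = chi v a (fun k => fa s arr (iv s 44 + k)) &
    frame (chi_prog dst arr) s s']).
Proof.
move=> ea ev aW hN.
suff H : wp E W N (chi_prog dst arr) s (fun t s' => t <= 60 * v + 60 /\
    fv s' dst = chi v a (fun k => fa s arr (iv s 44 + k))).
  by apply: wp_mono (wp_frame H) => t s' [[]].
rewrite /chi_prog; step. step. 

apply: wp_mono (wp_for (I := fun j s' => iv s' 40 = a %/ 2 ^ j /\ 
  fv s' dst = chi j a (fun k => fa s arr (iv s 44 + k))) (B := fun=> 50) _ _ _) => //=.
- simp. rewrite ev sum_nat_const card_ord; move=> t s' [h [_ ->] _]; split=> //; lia.
- by rewrite /upd /= eqxx /chi big_ord0 expn0 divn1 ea.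
- move=> j s' jv [e40 ed] [fr1 _ _ fr4 _].
  have E44 : iv s' 44 = iv s 44 by rewrite fr1.
  have Ea : fa s' arr = fa s arr by rewrite fr4.
  rewrite /= /upd /= ev in jv.
  have aj : a %/ 2 ^ j <= a by apply: leq_div.
  apply: wp_seq; split; first by bounds.
  (* The machine has no parity test, so the low bit is the remainder [x - 2 * (x / 2)]; register 40
     holds [a] shifted right by [j]. *)
  have -> : ieval E ($40 -$ #2 *$ ($40 /$ #2)) (seti s' 41 j) = bit a j.
    by rewrite /= /upd /= e40 /bit; lia.
  have Es : chi j.+1 a (fun k => fa s arr (iv s 44 + k)) =
    (chi j a (fun k => fa s arr (iv s 44 + k)) * lin (bit a j) (fa s arr (iv s 44 + j)))%R.
    by rewrite chiSr.
  case: (bit a j) Es => /= Es; last_step; last_step;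
    rewrite eqxx /= ed Ea E44 Es e40 -divnMA expnSr; split; try lia; split=> //.
Qed.
End Programs.

(** * Sum-check rounds over one block of variables *)

Local Open Scope ring_scope.

(** The table left once the first [j] variables are bound to [r]. For a table on [m] variables the
    entries below [2 ^ (m - j)] are the relevant ones; this is what the prover's array holds after
    [j] rounds. *)
Fixpoint tab (R : comNzRingType) (T r : nat -> R) j e : R :=
  if j is j'.+1 then
    tab T r j' (2 * e)%N + r j' * (tab T r j' (2 * e).+1 - tab T r j' (2 * e)%N)
  else T e.

Lemma mlx_tab (R : comNzRingType) (T r y : nat -> R) j k :
  (forall l, (l < j)%N -> y l = r l) ->
  mlx (j + k) T y = mlx k (tab T r j) (fun l => y (j + l)%N).
Proof.
elim: j k => [|j IH] k hy; first exact: eq_mlx.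
rewrite addSnnS IH => [|l lj]; last by apply: hy; lia.
rewrite mlxS addn0 hy //; apply: eq_mlx => // l _; congr y; lia.
Qed.

Lemma rmorph_tab (R S : comNzRingType) (f : {rmorphism R -> S}) T r j e :
  f (tab T r j e) = tab (fun a => f (T a)) (fun a => f (r a)) j e.
Proof. by elim: j e => //= j IH e; rewrite rmorphD rmorphM rmorphB !IH. Qed.

(** One gate's share of a round polynomial: its wiring factor in the current variable times the
    interpolation between two entries of the folded table. Both factors have degree at most one,
    whence three coefficients per message. *)
Definition gterm (F : fieldType) b (c p q t0 t1 : F) : {poly F} :=
  lin b 'X * ((c * (p + q * t0))%:P + (c * (q * (t1 - t0)))%:P * 'X).

Lemma coef_gterm (F : fieldType) b (c p q t0 t1 : F) k : (k < 3)%N ->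
  (gterm b c p q t0 t1)`_k = let al := c * (p + q * t0) in let ga := c * (q * (t1 - t0)) in
   nth 0 (if b then [:: 0; al; ga] else [:: al; ga - al; 0 - ga]) k.
Proof.
rewrite /gterm; set al := c * _; set ga := c * _.
case: b; rewrite /= ?mulrBl ?mul1r ?coefB coefXM ?coefD ?coefC ?coefMX ?coefC;
 case: k => [|[|[|]]] //= _; by rewrite ?coefC ?coefMX ?coefC /= ?coefD ?coefC ?coefMX ?coefC /=; ring.
Qed.

(** After variable [j] the argument consists of the bits of the gate's own index, and there a
    multilinear extension returns a table entry. The extension of the folded table thus collapses to
    the two entries that differ in variable [j]. *)
Lemma phase_polyE (F : fieldType) m N idx (c p q T r : nat -> F) j :
  (j < m)%N -> (forall a, (a < N)%N -> (idx a < 2 ^ m)%N) ->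
  phase_poly m N idx c p q T r j = \sum_(a < N) let e := (idx a %/ 2 ^ j.+1)%N in
    gterm (bit (idx a) j) (c a * \prod_(k < j) lin (bit (idx a) k) (r k)) (p a) (q a)
     (tab T r j (2 * e)%N) (tab T r j (2 * e).+1).
Proof.
move=> jm hidx; apply: eq_bigr => a _ /=; set e := (_ %/ _)%N.
have -> : mlx m (fun b => (T b)%:P) (mix r (bit (idx a)) j)
  = (tab T r j (2 * e)%N)%:P + 'X * (tab T r j (2 * e).+1 - tab T r j (2 * e)%N)%:P.
  have -> : m = (j + (m - j.+1).+1)%N by lia.
  rewrite (@mlx_tab _ _ (fun l => (r l)%:P)) => [|l lj]; last by rewrite /mix lj.
  rewrite mlxS addn0 {1}/mix ltnn eqxx rmorphB /=.
  transitivity (mlx (m - j.+1) (fun e => (tab T r j (2 * e)%N)%:P + 'X * ((tab T r j (2 * e).+1)%:P - (tab T r j (2 * e)%N)%:P))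
     (fun k => (bit e k)%:R)).
    apply: eq_mlx => [b _|l _]; first by rewrite -!(rmorph_tab (@polyC F)).
    rewrite /mix !ifF ?polyC_natr; try lia.
    by rewrite /bit /e -divnMA -expnD addSnnS.
  rewrite mlx_bits // /e ltn_divLR ?expn_gt0 // -expnD subnK //; exact: hidx.
by rewrite /gterm !(polyCM, polyCB, polyCD); ring.
Qed.

(** Integer array 0 holds the index of each gate shifted right by the number of bound variables;
    field array 0 holds the folded table, and field arrays 1, 2, 3 hold [c] (with its product of
    bound factors), [p] and [q]. Registers 10, 11, 12 collect the coefficients. *)
Definition accum_prog : cmd :=
  For 35 $31
    (36 :=$ 0$[$35] /$ #2;;
     13 :=! 0![#2 *$ $36];;
     14 :=! 0![#2 *$ $36 +$ #1] -^ !13;;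
     15 :=! 1![$35] *^ (2![$35] +^ 3![$35] *^ !13);;
     16 :=! 1![$35] *^ (3![$35] *^ !14);;
     CaseI (0$[$35] -$ #2 *$ $36)
       (10 :=! !10 +^ !15;; 11 :=! !11 +^ (!16 -^ !15);; 12 :=! !12 +^ (FCst false -^ !16))
       (11 :=! !11 +^ !15;; 12 :=! !12 +^ !16)).

Definition bind_prog : cmd :=
  For 35 $31
    (36 :=$ 0$[$35] /$ #2;;
     CaseI (0$[$35] -$ #2 *$ $36)
       (1:[$35] :=! 1![$35] *^ (FCst true -^ !17))
       (1:[$35] :=! 1![$35] *^ !17);;
     0:[$35] :=$ $36).

Definition fold_prog : cmd :=
  For 35 $34
    (0:[$35] :=! 0![#2 *$ $35] +^ !17 *^ (0![#2 *$ $35 +$ #1] -^ 0![#2 *$ $35])).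

(** [$30] rounds over [$31] gates. [$34] is the current table length, and the challenges are kept in
    array 4 from [$32] on, because the line and the next point need them later. *)
Definition phase_prog : cmd :=
  For 33 $30
    (10 :=! FCst false;; 11 :=! FCst false;; 12 :=! FCst false;;
     accum_prog;;
     Out !10;; Out !11;; Out !12;; In 17;;
     4:[$32 +$ $33] :=! !17;;
     bind_prog;;
     34 :=$ $34 /$ #2;;
     fold_prog).

Section Programs.
Variables (F : fieldType) (E : env F) (W N : nat).
Hypotheses (NW : (16 * N <= W)%N) (W16 : (16 <= W)%N).

Lemma accum_progP (s : store F) : (iv s 31 <= N)%N -> fv s 10 = 0 -> fv s 11 = 0 -> fv s 12 = 0 ->
  (forall a, (a < iv s 31)%N -> ((2 * (ia s 0 a %/ 2)).+1 < N)%N) ->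
  wp E W N accum_prog s (fun t s' => [/\ (t <= 200 * iv s 31 + 10)%N,
    forall k, (k < 3)%N -> fv s' (10 + k) = (\sum_(a < iv s 31)
      let e := (ia s 0 a %/ 2)%N in gterm (odd (ia s 0 a)) (fa s 1 a) (fa s 2 a) (fa s 3 a)
        (fa s 0 (2 * e)%N) (fa s 0 (2 * e).+1))`_k &
    frame accum_prog s s']).
Proof.
move=> gN f10 f11 f12 iN.
pose G a := let e := (ia s 0 a %/ 2)%N in gterm (odd (ia s 0 a)) (fa s 1 a) (fa s 2 a) (fa s 3 a)
        (fa s 0 (2 * e)%N) (fa s 0 (2 * e).+1).
apply: wp_mono (wp_for (I := fun j s' => forall k, (k < 3)%N ->
  fv s' (10 + k) = (\sum_(a < j) G a)`_k) (B := fun=> 190%N) _ _ _) => //.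
- move=> t s' [h1 h2 h3]; split=> //; move: h1.
  by rewrite sum_nat_const card_ord /=; lia.
- by rewrite big_ord0 => -[|[|[|]]] // _; rewrite coef0.
move=> a s' /= ag hs [_ _ fr3 fr4 _].
have E0 : ia s' 0 = ia s 0 by rewrite fr3.
have [Ef0 Ef1 Ef2 Ef3] : [/\ fa s' 0 = fa s 0, fa s' 1 = fa s 1, fa s' 2 = fa s 2 & fa s' 3 = fa s 3].
  by rewrite !fr4.
have ha := iN a ag.
set x := ia s 0 a in ha *.
have o1 : (x - 2 * (x %/ 2))%N = odd x by lia.
have hG k : (k < 3)%N -> (\sum_(b < a.+1) G b)`_k = (\sum_(b < a) G b)`_k + (G a)`_k.
  by rewrite big_ord_recr coefD.
have cG k (k3 : (k < 3)%N) : (G a)`_k = _ := @coef_gterm F (odd x) (fa s 1 a) (fa s 2 a)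
  (fa s 3 a) (fa s 0 (2 * (x %/ 2))%N) (fa s 0 (2 * (x %/ 2)).+1) k k3.
do 5! (apply: wp_seq; split; [by bounds; rewrite ?E0 -/x; lia|simp]).
rewrite E0 -/x Ef0 Ef1 Ef2 Ef3.
split; first by bounds; rewrite ?E0 -/x; lia.
simp; rewrite E0 -/x o1.
have h0 := hs 0 isT; have h1 := hs 1%N isT; have h2 := hs 2%N isT.
case Ex: (odd x) cG => cG /=; [do 1! step| do 2! step]; last_step; (split; first lia);
  case=> [|[|[|]]] // _; rewrite /= (hG _) // cG //= ?h0 ?h1 ?h2 ?addn1 ?addr0 //.
Qed.

Lemma bind_progP (s : store F) : (iv s 31 <= N)%N ->
  (forall a, (a < iv s 31)%N -> (ia s 0 a < N)%N) ->
  wp E W N bind_prog s (fun t s' => [/\ (t <= 100 * iv s 31 + 10)%N,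
    forall a, (a < iv s 31)%N -> ia s' 0 a = (ia s 0 a %/ 2)%N
       /\ fa s' 1 a = fa s 1 a * lin (odd (ia s 0 a)) (fv s 17) &
    frame bind_prog s s']).
Proof.
move=> gN iN.
apply: wp_mono (wp_for (I := fun j s' =>
   (forall a, (a < j)%N -> ia s' 0 a = (ia s 0 a %/ 2)%N
       /\ fa s' 1 a = fa s 1 a * lin (odd (ia s 0 a)) (fv s 17)) /\
   (forall a, (j <= a)%N -> ia s' 0 a = ia s 0 a /\ fa s' 1 a = fa s 1 a))
   (B := fun=> 90%N) _ _ _) => //.
- move=> t s' [h1 [h2 _] h3]; split=> //; move: h1.
  by rewrite sum_nat_const card_ord /=; lia.
move=> a s' /= ag [hs1 hs2] [_ fr2 _ _ _].
have E17 : fv s' 17 = fv s 17 by rewrite fr2.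
have ha := iN a ag; have [ea fa1] := hs2 a (leqnn a).
have o1 : (ia s 0 a - 2 * (ia s 0 a %/ 2))%N = odd (ia s 0 a) by lia.
step; rewrite ea.
apply: wp_seq; split; first by bounds; rewrite ?ea; lia.
simp; rewrite ea o1; case Ex: (odd (ia s 0 a)) => /=; last_step; last_step; split; try lia;
  (split=> b hb; [case: (b =P a) => [->|nb]; [by rewrite Ex /= fa1 E17 | by apply: hs1; lia]
                | rewrite ifF; [by rewrite ifF; [apply: hs2; lia | apply/eqP; lia] | by apply/eqP; lia]]).
Qed.

(** Folding in place is safe: round [a] writes entry [a] and reads [2 * a] and [2 * a + 1], which no
    earlier round has overwritten. *)
Lemma fold_progP (s : store F) : (2 * iv s 34 <= N)%N ->
  wp E W N fold_prog s (fun t s' => [/\ (t <= 100 * iv s 34 + 10)%N,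
    forall a, (a < iv s 34)%N -> fa s' 0 a =
      fa s 0 (2 * a)%N + fv s 17 * (fa s 0 (2 * a).+1 - fa s 0 (2 * a)%N) &
    frame fold_prog s s']).
Proof.
move=> gN.
apply: wp_mono (wp_for (I := fun j s' =>
   (forall a, (a < j)%N -> fa s' 0 a =
      fa s 0 (2 * a)%N + fv s 17 * (fa s 0 (2 * a).+1 - fa s 0 (2 * a)%N)) /\
   (forall a, (j <= a)%N -> fa s' 0 a = fa s 0 a))
   (B := fun=> 90%N) _ _ _) => //.
- move=> t s' [h1 [h2 _] h3]; split=> //; move: h1.
  by rewrite sum_nat_const card_ord /=; lia.
move=> a s' /= ag [hs1 hs2] [_ fr2 _ _ _].
have E17 : fv s' 17 = fv s 17 by rewrite fr2.
last_step; split; first lia.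
split=> b hb; case: (b =P a) => [eb|nb].
- by rewrite eb addn1 E17 !hs2 //; lia.
- by apply: hs1; lia.
- by lia.
- by apply: hs2; lia.
Qed.

(** Bounding each folded table by its initial length [2 ^ m] is enough, since gates are revisited in
    every round anyway. What the stretch leaves behind feeds the next one: entry 0 of the table is
    the extension at the challenges, and array 1 carries the basis value of each index. *)
Lemma phase_progP (s : store F) m n idx T
    (r := fun k => inbox E (heard s + k)%N)
    (g := phase_poly m n idx (fa s 1) (fa s 2) (fa s 3) T r) :
  iv s 30 = m -> iv s 31 = n -> iv s 34 = (2 ^ m)%N ->
  (n <= N)%N -> (2 ^ m <= N)%N -> (iv s 32 + m <= N)%N ->
  (forall a, (a < n)%N -> (idx a < 2 ^ m)%N /\ ia s 0 a = idx a) ->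
  (forall e, (e < 2 ^ m)%N -> fa s 0 e = T e) ->
  wp E W N phase_prog s (fun t s' => [/\ (t <= m * (400 * (n + 2 ^ m) + 200) + 10)%N,
    [/\ fa s' 0 0 = mlx m T r,
       forall a, (a < n)%N -> fa s' 1 a = fa s 1 a * chi m (idx a) r,
       forall k, (k < m)%N -> fa s' 4 (iv s 32 + k)%N = r k
     & forall k, (k < iv s 32)%N -> fa s' 4 k = fa s 4 k],
    heard s' = (heard s + m)%N,
    log s' = log s ++ logs (fun j => round_log (g j) (r j)) m
  & frame phase_prog s s']).
Proof.
move=> e30 e31 e34 nN mN oN hidx hT.
apply: wp_mono (wp_for (I := fun j s' =>
  [/\ iv s' 34 = (2 ^ (m - j))%N /\ (forall e, (e < 2 ^ (m - j))%N -> fa s' 0 e = tab T r j e),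
     forall a, (a < n)%N -> ia s' 0 a = (idx a %/ 2 ^ j)%N
        /\ fa s' 1 a = fa s 1 a * \prod_(k < j) lin (bit (idx a) k) (r k),
     (forall k, (k < j)%N -> fa s' 4 (iv s 32 + k)%N = r k)
      /\ (forall k, (k < iv s 32)%N -> fa s' 4 k = fa s 4 k),
     heard s' = (heard s + j)%N
   & log s' = log s ++ logs (fun j => round_log (g j) (r j)) j])
  (B := fun=> (400 * (n + 2 ^ m) + 190)%N) _ _ _) => //.
- move=> t s' /= [h1 [[h2 h3] h4 [h5 h6] h7 h8] h9]; split=> //.
  + by move: h1; rewrite sum_nat_const card_ord /= e30; lia.
  + split=> // [|a an|k].
    rewrite e30 subnn expn0 in h3; rewrite h3 // -{2}(addn0 m) (@mlx_tab _ _ r) //.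
      by rewrite /mlx big_ord1 /chi big_ord0 mulr1.
    by have [_ ->] := h4 a an; rewrite e30.
    by rewrite -e30; apply: h5.
  + by rewrite h7 e30.
  + by rewrite h8 e30.
- split=> //=.
  + by rewrite subn0 e34.
  + by move=> a an; rewrite big_ord0 mulr1 expn0 divn1; case: (hidx a an).
  + by rewrite ?addn0 ?cats0.
  + by rewrite logs0 cats0.
move=> j s' /= jm [[h34 hT'] hg [h4a h4b] hh hl] [fr1 _ _ fr4 _].
rewrite e30 in jm.
have E31 : iv s' 31 = n by rewrite fr1.
have E32 : iv s' 32 = iv s 32 by rewrite fr1.
have E2 : fa s' 2 = fa s 2 by rewrite fr4.
have E3 : fa s' 3 = fa s 3 by rewrite fr4.
have mj : (m - j = (m - j.+1).+1)%N by lia.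
have pm : (2 ^ (m - j) <= 2 ^ m)%N by apply: leq_pexp2l; lia.
have hq a : (a < n)%N -> (idx a %/ 2 ^ j.+1 < 2 ^ (m - j.+1))%N.
  move=> an; rewrite ltn_divLR ?expn_gt0 // -expnD subnK //; exact: (proj1 (hidx a an)).
have hq2 a : (idx a %/ 2 ^ j %/ 2 = idx a %/ 2 ^ j.+1)%N by rewrite -divnMA -expnSr.
have pj : (2 ^ (m - j) = 2 * 2 ^ (m - j.+1))%N by rewrite mj expnS.
do 3! step.
apply: wp_seq; apply: wp_mono (accum_progP _ _ _ _ _) => //=.
- move=> t1 s1 [ht1 hc1 [f11 f12 f13 f14 [_ f15]]].
  have [hh1 hl1] := f15 isT; rewrite /= in hh1 hl1.
  have Hc k : (k < 3)%N -> fv s1 (10 + k) = (g j)`_k.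
    move=> k3; rewrite hc1 // /g phase_polyE // => [|a an]; last by case: (hidx a an).
    rewrite /upd /= E31; congr ((polyseq _)`_k); apply: eq_bigr => a _.
    have [-> ->] := hg a (ltn_ord a); have := hq a (ltn_ord a) => haq.
    by rewrite /= E2 E3 hq2 !hT' //; lia.
  have [c0 c1 c2] := And3 (Hc 0 isT) (Hc 1%N isT) (Hc 2%N isT).
  rewrite /= in c0 c1 c2.
  have G31 : iv s1 31 = n by rewrite f11.
  have G32 : iv s1 32 = iv s 32 by rewrite f11.
  have G33 : iv s1 33 = j by rewrite f11.
  have G34 : iv s1 34 = (2 ^ (m - j))%N by rewrite f11.
  have Gfa k : fa s1 k = fa s' k by rewrite f14.
  have Gia : ia s1 0 = ia s' 0 by rewrite f13.
  do 3! step.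
  io_step.
  step.
  name_state s2.
  have B31 : iv s2 31 = n by [].
  apply: wp_seq; apply: wp_mono (@bind_progP s2 _ _) => //=.
  + move=> t2 s3 [ht2 hb2 [f31 f32 f33 f34 f35]]; rewrite B31 in ht2 hb2.
    have [hh3 hl3] := proj2 f35 isT; rewrite /= in hh3 hl3.
    have H34 : iv s3 34 = (2 ^ (m - j))%N by rewrite f31.
    have H17 : fv s3 17 = r j by rewrite f32 // /r /s2 /= hh1 hh.
    step.
    name_state s4.
    have D34 : iv s4 34 = (2 ^ (m - j.+1))%N by rewrite /s4 /= H34 pj mulKn.
    have Hf : (2 * iv s4 34 <= N)%N by rewrite D34; lia.
    have := fold_progP Hf; rewrite D34; apply: wp_mono.
    move=> t3 s5 [ht3 hf [f51 f52 f53 f54 f55]].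
    have [hh5 hl5] := proj2 f55 isT; rewrite /= in hh5 hl5.
    split; last split.
    * rewrite /upd /= in ht1 ht2; rewrite E31 in ht1. lia.
    * rewrite f51 //; split=> // e he; rewrite hf //= !f34 // /s2; simp; rewrite !Gfa !hT' ?H17 //; lia.
    * move=> a an; rewrite f53 // f54 //=.
      have [-> ->] := hb2 a an; have [ea ec] := hg a an.
      rewrite /s2 /= Gia ea hq2 /upd2 /upd /= Gfa ec hh1 hh.
      by rewrite big_ord_recr /= mulrA.
    * rewrite f54 //= f34 // /s2 /= /upd2 /upd /= G32 G33; split=> k hk.
        rewrite eqn_add2l; case: (k =P j) => [->|kj]; first by rewrite hh1 hh.
        by rewrite Gfa h4a //; lia.
      by rewrite ifF ?Gfa ?h4b //; apply/eqP; lia.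
    * by rewrite hh5 hh3 hh1 hh addnS.
    * rewrite hl5 hl3 hl1 hl logsS catA /= c0 c1 c2 hh1 hh.
      by rewrite -!cats1 -!catA.
  + by rewrite B31.
  + by move=> a; rewrite B31 /s2 /= Gia => an; have [-> _] := hg a an; have := hq a an; rewrite -hq2; lia.
- by rewrite /upd /= E31.
- move=> a; rewrite /upd /= E31 => an; have := hq a an.
  have [-> _] := hg a an; rewrite hq2; lia.
Qed.

End Programs.

Local Close Scope ring_scope.

(** * The honest prover: tables and gate data *)

(** Doubles [$41] until it reaches the width in [$42]. The loop takes as many rounds as the width,
    the surplus ones doing nothing, because a linear cost is affordable wherever a label length is
    computed. *)
Definition lab_prog : cmd :=
  40 :=$ #0;; 41 :=$ #1;;
  For 43 $42 (CaseI ($42 -$ $41) Skip (41 :=$ #2 *$ $41;; 40 :=$ $40 +$ #1)).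

Lemma lab_progP (F : fieldType) (E : env F) W N (s : store F) w :
  iv s 42 = w -> 4 * w <= W -> 16 <= W ->
  wp E W N lab_prog s (fun t s' => [/\ t <= 50 * w + 20,
    iv s' 40 = up_log 2 w, iv s' 41 = 2 ^ up_log 2 w & frame lab_prog s s']).
Proof.
move=> e42 wW W16.
suff H : wp E W N lab_prog s (fun t s' => [/\ t <= 50 * w + 20,
    iv s' 40 = up_log 2 w & iv s' 41 = 2 ^ up_log 2 w]).
  by apply: wp_mono (wp_frame H) => t s' [[]].
rewrite /lab_prog; step. step.
have upw : up_log 2 w <= w by apply: up_log_min => //; apply/ltnW/ltn_expl.
apply: wp_mono (wp_for (I := fun j s' => [/\ iv s' 41 = 2 ^ iv s' 40,
   iv s' 40 <= up_log 2 w & iv s' 40 = up_log 2 w \/ iv s' 40 = j])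
   (B := fun=> 40) _ _ _) => //.
- move=> t s' /= [h1 [h2 h3 h4] _]; move: h1 h2 h3 h4; rewrite /upd /= e42.
  rewrite sum_nat_const card_ord => h1 h2 h3 h4.
  have e40 : iv s' 40 = up_log 2 w by lia.
  by rewrite h2 e40; split=> //; lia.
- by rewrite /upd /=; split=> //; right.
move=> j s' /=; rewrite /upd /= e42 => jw [h1 h2 h3] f.
have E42 : iv s' 42 = w by frames.
last_step; rewrite E42 h1 subn_eq0.
case: leqP => hw.
  split; first by lia.
  have := up_log_min (isT : 1 < 2) hw; simp => h; split; [exact: h1 | exact: h2 | lia].
step; last_step; split; first lia.
have lt40 : iv s' 40 < up_log 2 w.
  rewrite ltnNge; apply/negP => h; move: hw; rewrite ltnNge => /negP; apply.
  by apply: leq_trans (up_logP w (isT : 1 < 2)) _; rewrite leq_pexp2l.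
by split; [rewrite addn1 expnS h1 | lia | lia].
Qed.

(** The description opens with the depth and the [d + 1] widths, so the gates start at cell [d + 2]
    and take three cells each. Register 8 is the number of gates in earlier layers. *)
Definition gate_addr : iexp := #2 +$ $2 +$ #3 *$ ($8 +$ $22).

(* Array 5 holds the values of layer [i] from index [off i] on. *)
Definition value_layer_prog : cmd :=
  6 :=$ IInp (#1 +$ $4);; 9 :=$ $8;; 8 :=$ $8 -$ $6;;
  For 22 $6
    (10 :=$ gate_addr;;
     14 :=! 5![$9 +$ IInp ($10 +$ #1)];;
     15 :=! 5![$9 +$ IInp ($10 +$ #2)];;
     CaseI (IInp $10) (5:[$8 +$ $22] :=! !14 +^ !15) (5:[$8 +$ $22] :=! !14 *^ !15)).

Definition values_prog : cmd :=
  2 :=$ IInp #0;;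
  1 :=$ IInp (#1 +$ $2);;
  8 :=$ #0;;
  For 3 $2 (8 :=$ $8 +$ IInp (#1 +$ $3));;
  For 3 $1 (5:[$8 +$ $3] :=! FInp $3);;
  For 3 $2 (4 :=$ $2 -$ #1 -$ $3;; value_layer_prog).

Section Prover.
Variables (F : fieldType) (n : nat) (C : circuit) (x : seq F) (coins : nat -> F).
Hypotheses (wfC : wf_circuit n C) (xn : size x <= n).
Variables (W N : nat).
Notation S := (csize n C).
Notation L := (up_log 2 S).
Notation d := (depth C).
Variable ds : seq nat.
Hypothesis dsE : ds = description n C.
Notation E := (Env ds x (fun=> 0%R) coins).
Hypotheses (NW : 16 * N <= W) (SN : 10 * S * S <= N).

Let S2 : 2 <= S := S_ge2 wfC.

Lemma SN10 : 10 * S <= N.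
Proof. by apply: leq_trans SN; rewrite -[leqLHS]muln1 leq_mul2l; lia. Qed.

Lemma W16 : 16 <= W.
Proof. by have := SN10; have := S2; lia. Qed.

Lemma lval_input a : lval C x d a = (x`_a)%R.
Proof. by rewrite /lval /layer_values drop_oversize. Qed.

Lemma lval_gate i a : i < d -> a < width n C i ->
  lval C x i a = gop C i a (lval C x i.+1 (gfst C i a)) (lval C x i.+1 (gsnd C i a)).
Proof.
move=> id aw; rewrite /lval /layer_values (drop_nth [::] (id : i < size C)) /=.
rewrite (nth_map (false, 0, 0)) ?(size_layer n id) //.
Qed.

Lemma lval_default i a : i <= d -> width n C i <= a -> lval C x i a = 0%R.
Proof.
rewrite leq_eqVlt => /orP[/eqP->|id]; rewrite /width.
  by rewrite ltnn lval_input => na; rewrite nth_default //; apply: leq_trans na.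
rewrite id /lval /layer_values (drop_nth [::] (id : i < size C)) /= => h.
by rewrite nth_default // size_map.
Qed.

Definition has_values i (s : store F) := forall j a, i <= j <= d -> a < width n C j ->
  fa s 5 (off n C j + a) = lval C x j a.

Lemma value_layer_progP (s : store F) i : i < d -> iv s 2 = d -> iv s 4 = i ->
  iv s 8 = off n C i.+1 -> has_values i.+1 s ->
  wp E W N value_layer_prog s (fun t s' => t <= 200 * width n C i + 50 /\
    [/\ iv s' 8 = off n C i, has_values i s' & frame value_layer_prog s s']).
Proof.
move=> id e2 e4 e8 hv.
suff H : wp E W N value_layer_prog s (fun t s' => t <= 200 * width n C i + 50 /\
    (iv s' 8 = off n C i /\ has_values i s')).
  by apply: wp_mono (wp_frame H) => t s' [[? []]].
have hN := SN10; have hS := S2; have hi := @off_width n C i (ltnW id); have hi1 := @off_width n C i.+1 id.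
have hw1 k : nth 0 ds k <= S by rewrite dsE nth_description_le.
have hd := depth_lt wfC.
have Ew : nth 0 ds (1 + i) = width n C i by rewrite dsE nth_width // ltnW.
have E8 : off n C i.+1 - width n C i = off n C i by rewrite offS addnK.
rewrite /value_layer_prog; have hwi := width_le n C i.
step; rewrite ?e4 ?Ew; try lia.
step. step. name_state s1.
have [a2 a6 a8 a9] : [/\ iv s1 2 = d, iv s1 6 = width n C i, iv s1 8 = off n C i & iv s1 9 = off n C i.+1].
  by rewrite /s1; simp; rewrite ?e4 ?Ew ?e8 ?E8.
have hv1 : has_values i.+1 s1 by [].
clearbody s1.
apply: wp_mono (wp_for (I := fun k s' => has_values i.+1 s' /\
    (forall a, a < k -> fa s' 5 (off n C i + a) = lval C x i a))
   (B := fun=> 150) _ _ _) => //.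
- move=> t s' /= [h1 [h2 h3] f]; move: h1; rewrite a6 sum_nat_const card_ord => h1.
  split; first by lia.
  split; first by frames.
  move=> j a /andP[ij jd] aw; case: (ltngtP i j) ij aw => // [ij|<-] _ aw; last by apply: h3; rewrite a6.
  by apply: h2; rewrite ?ij.
move=> a s' /=; rewrite a6 => aw [h1 h2] f.
have [e2' e8' e9'] : [/\ iv s' 2 = d, iv s' 8 = off n C i & iv s' 9 = off n C i.+1] by frames; split.
have [g1 g2] := gate_wf wfC id aw.
have Ej j : j < 3 -> nth 0 ds (2 + d + 3 * (off n C i + a) + j) =
   nth 0 [:: nat_of_bool (gmul C i a); gfst C i a; gsnd C i a] j.
  by move=> j3; rewrite dsE add2n nth_gate.
have E0 := Ej 0 isT; have E1 := Ej 1 isT; have E2 := Ej 2 isT; rewrite addn0 in E0.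
rewrite /= in E0 E1 E2.
rewrite /gate_addr.
step; rewrite e2' e8'; try lia.
step; rewrite ?E1 ?e9'; try lia.
step; rewrite ?E2 ?e9'; try lia.
have V1 := h1 i.+1 _ _ g1; have V2 := h1 i.+1 _ _ g2; rewrite ltnSn id /= in V1 V2.
have Hv v : lval C x i a = v -> has_values i.+1 (putf s' 5 (off n C i + a) v) /\
   (forall b, b < a.+1 -> fa (putf s' 5 (off n C i + a) v) 5 (off n C i + b) = lval C x i b).
  move=> ev; split=> [j b /andP[ij jd] bw|b ba]; simp.
    rewrite ifF ?h1 ?ij //; apply/eqP; have := @off_le n C _ _ ij; rewrite offS; lia.
  by rewrite eqn_add2l; case: eqP => [->|?] //; apply: h2; lia.
have Eg := lval_gate id aw; rewrite /gop in Eg.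
last_step; rewrite E0.
case: (gmul C i a) Eg => Eg /=; last_step; rewrite ?e8' ?e9'; try lia;
  (split; first lia); apply: Hv; rewrite Eg V1 ?V2 // ?V1 //.
Qed.

Lemma values_progP (s : store F) :
  wp E W N values_prog s (fun t s' => t <= 700 * S /\
    [/\ iv s' 1 = n, iv s' 2 = d, has_values 0 s' & frame values_prog s s']).
Proof.
suff H : wp E W N values_prog s (fun t s' => t <= 700 * S /\
    [/\ iv s' 1 = n, iv s' 2 = d & has_values 0 s']).
  by apply: wp_mono (wp_frame H) => t s' [[? []]].
have hN := SN10; have hS := S2; have hd := depth_lt wfC; have hE := csizeE n C.
have E0 : nth 0 ds 0 = d by rewrite dsE.
have Ew k : k <= d -> nth 0 ds (1 + k) = width n C k by move=> kd; rewrite dsE nth_width.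
have Ed : nth 0 ds (1 + d) = n by rewrite Ew // /width ltnn.
rewrite /values_prog.
step; rewrite ?E0; try lia.
step; rewrite ?Ed; try lia.
step.
apply: wp_seq; apply: wp_mono (wp_for (I := fun k s' => iv s' 8 = off n C k) (B := fun=> 20) _ _ _) => //; last first.
- move=> k s' /=; rewrite /upd /= => kd h8 f.
  have hk := @off_width n C k (ltnW kd).
  last_step; rewrite ?Ew ?h8 ?offS; lia.
- by rewrite /off big_ord0.
move=> t1 s1 /= [ht1 h8 f1]; rewrite /upd /= sum_nat_const card_ord in ht1 h8.
apply: wp_seq; apply: wp_mono (wp_for (I := fun k s' => forall a, a < k ->
  fa s' 5 (off n C d + a) = lval C x d a) (B := fun=> 20) _ _ _) => //; last first.
- move=> a s' /=.
  have -> : iv s1 1 = n by frames.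
  move=> an ha f; have E8 : iv s' 8 = off n C d by frames.
  last_step; try lia.
  split; first lia.
  move=> b ba; rewrite E8 eqn_add2l; case: eqP => [->|?]; first by rewrite lval_input.
  by apply: ha; lia.
move=> t2 s2 /=; have -> : iv s1 1 = n by frames.
rewrite sum_nat_const card_ord => -[ht2 hv f2].
have e2 : iv s2 2 = d by frames.
apply: wp_mono (wp_for (I := fun k s' => iv s' 8 = off n C (d - k) /\ has_values (d - k) s')
   (B := fun k => 200 * width n C (d - k.+1) + 80) _ _ _) => //=; last first.
- move=> k s'; rewrite e2 => kd [h8' hvk] f.
  have dk : d - k = (d - k.+1).+1 by lia.
  rewrite dk in h8' hvk.
  have e2' : iv s' 2 = d by frames.
  step.
  name_state s3.
  have b2 : iv s3 2 = d by rewrite /s3; simp.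
  have b4 : iv s3 4 = d - k.+1 by rewrite /s3; simp; rewrite e2'; lia.
  apply: wp_mono (@value_layer_progP s3 (d - k.+1) _ b2 b4 h8' hvk); last by lia.
  by move=> t s4 [h1 [h2 h3 h4]]; split=> //; lia.
- rewrite subn0; split; first by frames.
  move=> j a jd; have -> : j = d by lia.
  by rewrite /width ltnn; apply: hv.
move=> t3 s3; rewrite e2 subnn => -[ht3 [_ hv3] f3]; split; last first.
  by split=> //; frames.
move: ht3; rewrite big_split big_split -big_distrr /= !sum_nat_const card_ord.
have -> : \sum_(k < d) width n C (d - k.+1) = off n C d.
  rewrite /off (reindex_inj rev_ord_inj) /=; apply: eq_bigr => k _; congr width; have := ltn_ord k; lia.
lia.
Qed.

Definition table_A_prog : cmd :=
  For 22 $21 (42 :=$ $22;; 43 :=$ $4;; 44 :=$ #0;; chi_prog 10 6;; 0:[$22] :=! !10).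

(** Sets up the data [idx], [c], [p], [q] of [round_A]; [gates_B_prog] and [gates_C_prog] do so for
    the other two stretches. *)
Definition gates_A_prog : cmd :=
  For 22 $6
    (0:[$22] :=$ $22;; 1:[$22] :=! FCst true;; 2:[$22] :=! FCst false;;
     3:[$22] :=! 5![$8 +$ $22]).

(** Labels beyond the width get value 0, in agreement with the default of [nth] in [layer_fun]. *)
Definition table_V_prog : cmd :=
  For 22 $20 (CaseI ($7 -$ $22) (0:[$22] :=! FCst false) (0:[$22] :=! 5![$9 +$ $22])).

Definition gates_B_prog : cmd :=
  For 22 $6
    (10 :=$ gate_addr;;
     14 :=! 5![$9 +$ IInp ($10 +$ #2)];;
     0:[$22] :=$ IInp ($10 +$ #1);;
     1:[$22] :=! !18 *^ 1![$22];;
     CaseI (IInp $10)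
       (2:[$22] :=! !14;; 3:[$22] :=! FCst true)
       (2:[$22] :=! FCst false;; 3:[$22] :=! !14)).

(** Array 1 is left as the second stretch ended: binding has already multiplied in the basis value
    of the first input. *)
Definition gates_C_prog : cmd :=
  For 22 $6
    (10 :=$ gate_addr;;
     0:[$22] :=$ IInp ($10 +$ #2);;
     CaseI (IInp $10)
       (2:[$22] :=! !19;; 3:[$22] :=! FCst true)
       (2:[$22] :=! FCst false;; 3:[$22] :=! !19)).

(** Each Lagrange coefficient is computed from scratch in time [O(v)]. With [2 ^ v] at most twice
    the width this fits the budget of [O(log S)] per gate. *)
Lemma table_A_progP (s : store F) v : iv s 4 = v -> iv s 21 = 2 ^ v -> v <= N -> 2 ^ v <= N ->
  wp E W N table_A_prog s (fun t s' => [/\ t <= 2 ^ v * (60 * v + 100) + 10,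
    forall e, e < 2 ^ v -> fa s' 0 e = chi v e (fa s 6)
  & frame table_A_prog s s']).
Proof.
move=> e4 e21 vN pN; have w16 := W16.
apply: wp_mono (wp_for (I := fun k s' => forall e, e < k -> fa s' 0 e = chi v e (fa s 6))
   (B := fun=> 60 * v + 90) _ _ _) => //=.
- by move=> t s'; rewrite e21 sum_nat_const card_ord => -[h1 h2 h3]; split=> //; lia.
move=> a s'; rewrite e21 => av h f.
have e4' : iv s' 4 = v by frames.
have e6 : fa s' 6 = fa s 6 by frames.
step. step. step. name_state s1.
apply: wp_seq; apply: wp_mono (@chi_progP _ E W N NW w16 10 6 s1 v a _ _ _ _) => //; last by rewrite /s1; simp; lia.
  move=> t s2 [h1 h2 f2]; last_step; first by frames; lia.
  split; first by lia.
  move=> e ea; frames; case: eqP => [->|ne]; last by apply: h; lia.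
  rewrite h2; apply: eq_chi => j jv; rewrite /s1; simp; rewrite add0n.
  by rewrite e6.
Qed.

Lemma gates_A_progP (s : store F) i : i < d -> iv s 6 = width n C i -> iv s 8 = off n C i ->
  has_values 0 s ->
  wp E W N gates_A_prog s (fun t s' => [/\ t <= 100 * width n C i + 10,
    forall a, a < width n C i -> [/\ ia s' 0 a = a, fa s' 1 a = 1%R, fa s' 2 a = 0%R
       & fa s' 3 a = lval C x i a]
  & frame gates_A_prog s s']).
Proof.
move=> id e6 e8 hv; have hN := SN10; have hi := @off_width n C i (ltnW id).
apply: wp_mono (wp_for (I := fun k s' => forall a, a < k ->
   [/\ ia s' 0 a = a, fa s' 1 a = 1%R, fa s' 2 a = 0%R & fa s' 3 a = lval C x i a])
   (B := fun=> 90) _ _ _) => //=.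
- by move=> t s'; rewrite e6 sum_nat_const card_ord => -[h1 h2 h3]; split=> //; lia.
move=> a s'; rewrite e6 => aw h f.
have e8' : iv s' 8 = off n C i by frames.
have e5 : fa s' 5 = fa s 5 by frames.
do 3! (step; try lia). last_step; rewrite ?e8'; try lia.
split; first by lia.
move=> b ba; case: (b =P a) => [->|ne]; last by apply: h; lia.
by split=> //; rewrite e5 hv //; lia.
Qed.

Lemma table_V_progP (s : store F) i u : i < d -> iv s 7 = width n C i.+1 ->
  iv s 9 = off n C i.+1 -> iv s 20 = 2 ^ u -> 2 ^ u <= N -> has_values 0 s ->
  wp E W N table_V_prog s (fun t s' => [/\ t <= 100 * 2 ^ u + 10,
    forall e, e < 2 ^ u -> fa s' 0 e = lval C x i.+1 e
  & frame table_V_prog s s']).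
Proof.
move=> id e7 e9 e20 uN hv; have hN := SN10; have hi := @off_width n C i.+1 id.
apply: wp_mono (wp_for (I := fun k s' => forall e, e < k -> fa s' 0 e = lval C x i.+1 e)
   (B := fun=> 90) _ _ _) => //=.
- by move=> t s'; rewrite e20 sum_nat_const card_ord => -[h1 h2 h3]; split=> //; lia.
move=> a s'; rewrite e20 => aw h f.
have e7' : iv s' 7 = width n C i.+1 by frames.
have e9' : iv s' 9 = off n C i.+1 by frames.
have e5 : fa s' 5 = fa s 5 by frames.
last_step; rewrite e7' subn_eq0; case: leqP => hw; last_step; rewrite ?e9'; try lia;
  (split; first lia); move=> e ea; case: (e =P a) => [->|ne]; try (by apply: h; lia).
  by rewrite lval_default.
by rewrite e5 hv // id.
Qed.

Lemma gates_B_progP (s : store F) i : i < d -> iv s 2 = d -> iv s 6 = width n C i ->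
  iv s 8 = off n C i -> iv s 9 = off n C i.+1 -> has_values 0 s ->
  wp E W N gates_B_prog s (fun t s' => [/\ t <= 200 * width n C i + 10,
    forall a, a < width n C i -> [/\ ia s' 0 a = gfst C i a, fa s' 1 a = (fv s 18 * fa s 1 a)%R,
       fa s' 2 a = if gmul C i a then 0%R else lval C x i.+1 (gsnd C i a)
     & fa s' 3 a = if gmul C i a then lval C x i.+1 (gsnd C i a) else 1%R]
  & frame gates_B_prog s s']).
Proof.
move=> id e2 e6 e8 e9 hv; have hN := SN10; have hi := @off_width n C i (ltnW id).
have hi1 := @off_width n C i.+1 id; have hd := depth_lt wfC; have hS := S2.
have hw1 k : nth 0 ds k <= S by rewrite dsE nth_description_le.
apply: wp_mono (wp_for (I := fun k s' => (forall a, a < k ->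
   [/\ ia s' 0 a = gfst C i a, fa s' 1 a = (fv s 18 * fa s 1 a)%R,
       fa s' 2 a = if gmul C i a then 0%R else lval C x i.+1 (gsnd C i a)
     & fa s' 3 a = if gmul C i a then lval C x i.+1 (gsnd C i a) else 1%R]) /\
   (forall a, k <= a -> fa s' 1 a = fa s 1 a))
   (B := fun=> 190) _ _ _) => //=.
- by move=> t s'; rewrite e6 sum_nat_const card_ord => -[h1 [h2 _] h3]; split=> //; lia.
move=> a s'; rewrite e6 => aw [h h'] f.
have [e2' e8' e9'] : [/\ iv s' 2 = d, iv s' 8 = off n C i & iv s' 9 = off n C i.+1] by frames; split.
have e5 : fa s' 5 = fa s 5 by frames.
have e18 : fv s' 18 = fv s 18 by frames.
have [g1 g2] := gate_wf wfC id aw.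
have Ej j : j < 3 -> nth 0 ds (2 + d + 3 * (off n C i + a) + j) =
   nth 0 [:: nat_of_bool (gmul C i a); gfst C i a; gsnd C i a] j.
  by move=> j3; rewrite dsE add2n nth_gate.
have E0 := Ej 0 isT; have E1 := Ej 1 isT; have E2 := Ej 2 isT; rewrite addn0 in E0.
rewrite /= in E0 E1 E2.
rewrite /gate_addr.
step; rewrite e2' e8'; try lia.
step; rewrite ?E2 ?e9'; try lia.
step; rewrite ?E1; try lia.
step; try lia.
have V2 : fa s' 5 (off n C i.+1 + gsnd C i a) = lval C x i.+1 (gsnd C i a).
  by rewrite e5 hv // id.
have h1a := h' a (leqnn a).
last_step; rewrite ?E0; try lia.
case Eg: (gmul C i a) => /=; step; try lia; last_step; try lia; (split; first lia);
 (split=> b hb; [case: (b =P a) => [->|ne]; [by rewrite Eg e18 h1a; split|apply: h; lia]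
               | by rewrite ifF; [apply: h'; lia | apply/eqP; lia]]).
Qed.

Lemma gates_C_progP (s : store F) i : i < d -> iv s 2 = d -> iv s 6 = width n C i ->
  iv s 8 = off n C i ->
  wp E W N gates_C_prog s (fun t s' => [/\ t <= 200 * width n C i + 10,
    forall a, a < width n C i -> [/\ ia s' 0 a = gsnd C i a,
       fa s' 2 a = if gmul C i a then 0%R else fv s 19
     & fa s' 3 a = if gmul C i a then fv s 19 else 1%R]
  & frame gates_C_prog s s']).
Proof.
move=> id e2 e6 e8; have hN := SN10; have hi := @off_width n C i (ltnW id).
have hd := depth_lt wfC; have hS := S2.
have hw1 k : nth 0 ds k <= S by rewrite dsE nth_description_le.
apply: wp_mono (wp_for (I := fun k s' => forall a, a < k ->
   [/\ ia s' 0 a = gsnd C i a, fa s' 2 a = if gmul C i a then 0%R else fv s 19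
     & fa s' 3 a = if gmul C i a then fv s 19 else 1%R])
   (B := fun=> 190) _ _ _) => //=.
- by move=> t s'; rewrite e6 sum_nat_const card_ord => -[h1 h2 h3]; split=> //; lia.
move=> a s'; rewrite e6 => aw h f.
have [e2' e8'] : iv s' 2 = d /\ iv s' 8 = off n C i by frames; split.
have e19 : fv s' 19 = fv s 19 by frames.
have [g1 g2] := gate_wf wfC id aw; have hi1 := @off_width n C i.+1 id.
have Ej j : j < 3 -> nth 0 ds (2 + d + 3 * (off n C i + a) + j) =
   nth 0 [:: nat_of_bool (gmul C i a); gfst C i a; gsnd C i a] j.
  by move=> j3; rewrite dsE add2n nth_gate.
have E0 := Ej 0 isT; have E2 := Ej 2 isT; rewrite addn0 in E0.
rewrite /= in E0 E2.
rewrite /gate_addr.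
step; rewrite e2' e8'; try lia.
step; rewrite ?E2; try lia.
last_step; rewrite ?E0; try lia.
case Eg: (gmul C i a) => /=; step; try lia; last_step; try lia; (split; first lia);
 (move=> b hb; case: (b =P a) => [->|ne]; [by rewrite Eg e19; split|apply: h; lia]).
Qed.

End Prover.

(** * The honest prover: restriction to a line *)

(* Row [e] of array 7, of length [$23], holds the low coefficients of a polynomial;
   products are computed modulo ['X^$23]. *)
Definition line_init_prog : cmd :=
  For 22 $20
    (For 24 $23 (7:[$22 *$ $23 +$ $24] :=! FCst false);;
     CaseI ($7 -$ $22) Skip (7:[$22 *$ $23] :=! 5![$9 +$ $22])).

Definition line_row_prog : cmd :=
  16 :=! FCst false;;
  For 24 $23
    (10 :=! 7![#2 *$ $22 *$ $23 +$ $24];;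
     11 :=! 7![(#2 *$ $22 +$ #1) *$ $23 +$ $24] -^ !10;;
     7:[$22 *$ $23 +$ $24] :=! !10 +^ (!14 *^ !11 +^ !15 *^ !16);;
     16 :=! !11).

Definition line_fold_prog : cmd := For 22 $26 line_row_prog.

Definition line_prog : cmd :=
  23 :=$ $5 +$ #1;;
  line_init_prog;;
  26 :=$ $20;;
  For 25 $5
    (26 :=$ $26 /$ #2;;
     14 :=! 4![$4 +$ $25];;
     15 :=! 4![$4 +$ $5 +$ $25] -^ !14;;
     line_fold_prog);;
  For 24 $23 (Out 7![$24]).

(** The row counts of successive folds form a geometric series, so all folds together cost no more
    than one pass over the full coefficient table. *)
Lemma sum_pow2 u : \sum_(j < u) 2 ^ (u - j.+1) < 2 ^ u.
Proof.
elim: u => [|u IH]; first by rewrite big_ord0.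
rewrite big_ord_recl /= subn1 /= expnS mul2n -addnn ltn_add2l.
by apply: leq_ltn_trans IH; apply: leq_sum => j _; rewrite /bump /= add1n subSS.
Qed.

Section Programs.
Variables (F : fieldType) (E : env F) (W N : nat).
Hypotheses (NW : 16 * N <= W) (W16 : 16 <= W).

Definition rows (s : store F) u1 h (p : nat -> {poly F}) :=
  forall e k, e < h -> k < u1 -> fa s 7 (e * u1 + k) = ((p e)`_k)%R.

Lemma rows_addr e e' k u1 : k < u1 -> e' < e -> e' * u1 + k < e * u1.
Proof.
move=> ku ee; have : e'.+1 * u1 <= e * u1 by rewrite leq_mul2r ee orbT.
by rewrite mulSn; lia.
Qed.

(** Coefficient [k] of a product with a linear polynomial needs the coefficients [k] and [k - 1] of
    the other factor; register 16 remembers the latter. Each position is read before it is written,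
    so row [e] may overwrite a row being read, as happens for [e = 0]. *)
Lemma line_row_progP (s : store F) e u1 (P0 P1 : {poly F})
    (l := ((fv s 14)%:P + (fv s 15)%:P * 'X)%R) :
  iv s 22 = e -> iv s 23 = u1 -> (2 * e + 1).+1 * u1 <= N ->
  (forall k, k < u1 -> fa s 7 (2 * e * u1 + k) = (P0`_k)%R) ->
  (forall k, k < u1 -> fa s 7 ((2 * e + 1) * u1 + k) = (P1`_k)%R) ->
  wp E W N line_row_prog s (fun t s' => [/\ t <= 150 * u1 + 20,
    forall k, k < u1 -> fa s' 7 (e * u1 + k) = ((P0 + l * (P1 - P0))`_k)%R,
    forall i, (i < e * u1) || (e.+1 * u1 <= i) -> fa s' 7 i = fa s 7 i
  & frame line_row_prog s s']).
Proof.
move=> e22 e23 eN h0 h1.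
suff H : wp E W N line_row_prog s (fun t s' => [/\ t <= 150 * u1 + 20,
    forall k, k < u1 -> fa s' 7 (e * u1 + k) = ((P0 + l * (P1 - P0))`_k)%R
  & forall i, (i < e * u1) || (e.+1 * u1 <= i) -> fa s' 7 i = fa s 7 i]).
  by apply: wp_mono (wp_frame H) => t s' [[]].
rewrite /line_row_prog; step; name_state s1.
have a22 : iv s1 22 = e by [].
have a23 : iv s1 23 = u1 by [].
have [a14 a15] : fv s1 14 = fv s 14 /\ fv s1 15 = fv s 15 by [].
have a16 : fv s1 16 = 0%R by [].
have a7 : fa s1 7 = fa s 7 by [].
clearbody s1.
set D := (P1 - P0)%R.
have D0 k : (D`_k = P1`_k - P0`_k)%R by rewrite coefB.
have lD k : ((l * D)`_k = fv s 14 * D`_k + fv s 15 * (D * 'X)`_k)%R.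
  by rewrite /l mulrDl coefD -mulrA !coefCM [('X * D)%R]mulrC.
have Ee : 2 * e * u1 = e * u1 + e * u1 by rewrite mul2n -addnn mulnDl.
have Ee1 : (2 * e + 1) * u1 = e * u1 + e * u1 + u1 by rewrite mulnDl Ee mul1n.
have Ee2 : (2 * e + 1).+1 * u1 = e * u1 + e * u1 + u1 + u1 by rewrite mulSn Ee1 addnC.
have Ee3 : e.+1 * u1 = e * u1 + u1 by rewrite mulSn addnC.
(* Bounds the intermediate word [2 * e + 1] by an array address; when [u1 = 0] the loop has no
   rounds. *)
have le1 : 2 * e + 1 <= (2 * e + 1) * u1 \/ u1 = 0 by case: (u1); [right|move=> m; left; rewrite leq_pmulr].
apply: wp_mono (wp_for (I := fun k s' => [/\ fv s' 16 = ((D * 'X)`_k)%R,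
     forall j, j < k -> fa s' 7 (e * u1 + j) = ((P0 + l * D)`_j)%R
   & forall i, (i < e * u1) || (e * u1 + k <= i) -> fa s' 7 i = fa s 7 i])
   (B := fun=> 140) _ _ _) => //=; last first.
- move=> k s'; rewrite a23 => ku [h16 hnew hold] f.
  have e22' : iv s' 22 = e by frames.
  have e23' : iv s' 23 = u1 by frames.
  have e14' : fv s' 14 = fv s 14 by frames.
  have e15' : fv s' 15 = fv s 15 by frames.
  case: le1 => le1; last by lia.
  step; rewrite ?e22' ?e23'; try lia.
  step; rewrite ?e22' ?e23'; try lia.
  step; rewrite ?e22' ?e23'; try lia.
  last_step; split; first by lia.
  have r0 : fa s' 7 (2 * e * u1 + k) = (P0`_k)%R by rewrite hold ?h0 //; lia.
  have r1 : fa s' 7 ((2 * e + 1) * u1 + k) = (P1`_k)%R by rewrite hold ?h1 //; lia.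
  rewrite r0 r1; split=> [|j jk|i hi].
  + by rewrite coefMX.
  + rewrite eqn_add2l; case: eqP => [->|?]; last by apply: hnew; lia.
    by rewrite e14' e15' h16  [in RHS]coefD lD D0.
  + by rewrite ifF; [apply: hold; lia | apply/eqP; lia].
- rewrite a16 coefMX; split=> // i _.
  by rewrite a7.
move=> t s' /=; rewrite a23 sum_nat_const card_ord => -[h2 [h3 h4 h5] h6]; split=> //; first by lia.
by move=> i hi; apply: h5; lia.
Qed.

Lemma line_fold_progP (s : store F) h u1 (p : nat -> {poly F})
    (l := ((fv s 14)%:P + (fv s 15)%:P * 'X)%R) :
  iv s 26 = h -> iv s 23 = u1 -> 2 * h * u1 <= N -> rows s u1 (2 * h) p ->
  wp E W N line_fold_prog s (fun t s' => [/\ t <= h * (150 * u1 + 50) + 20,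
    rows s' u1 h (fun e => p (2 * e) + l * (p (2 * e).+1 - p (2 * e)))%R
  & frame line_fold_prog s s']).
Proof.
move=> e26 e23 hN hr.
apply: wp_mono (wp_for (I := fun k s' =>
    rows s' u1 k (fun e => p (2 * e) + l * (p (2 * e).+1 - p (2 * e)))%R /\
    (forall i, k * u1 <= i -> fa s' 7 i = fa s 7 i))
   (B := fun=> 150 * u1 + 30) _ _ _) => //.
- by move=> t s' /=; rewrite e26 sum_nat_const card_ord => -[h2 [h3 h4] h5]; split=> //; lia.
move=> e s' /=; rewrite e26 => eh [h1 h2] f.
have e14' : fv s' 14 = fv s 14 by frames.
have e15' : fv s' 15 = fv s 15 by frames.
have e23' : iv s' 23 = u1 by frames.
have le2 : (2 * e + 1).+1 * u1 <= 2 * h * u1 by rewrite leq_mul2r; apply/orP; right; lia.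
have Ee2 : (2 * e + 1).+1 * u1 = 2 * e * u1 + u1 + u1 by rewrite mulSn mulnDl; lia.
have Ee1 : (2 * e + 1) * u1 = 2 * e * u1 + u1 by rewrite mulnDl; lia.
have Ee3 : 2 * e * u1 = e * u1 + e * u1 by rewrite mul2n -addnn mulnDl.
apply: wp_mono (@line_row_progP (seti s' 22 e) e u1 (p (2 * e)) (p (2 * e).+1) _ _ _ _ _) => //=.
- rewrite e14' e15' => t s2 [g1 g2 g3 g4]; split; first by lia.
  split=> [e' k|i] hk.
    move=> ku; have [lt|->] : e' < e \/ e' = e by lia.
      by rewrite g3 /= ?h1 // rows_addr.
    exact: g2.
  by rewrite g3 ?h2 // ?hk ?orbT //; rewrite mulSn in hk; lia.
- by lia.
- by move=> k ku; rewrite h2 ?hr //; lia.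
- by move=> k ku; rewrite h2; last lia; rewrite addn1 hr //; lia.
Qed.

Lemma line_init_progP (s : store F) w o u1 h (V : nat -> F) :
  iv s 20 = h -> iv s 23 = u1 -> iv s 7 = w -> iv s 9 = o -> 0 < u1 ->
  h * u1 <= N -> o + w <= N ->
  (forall a, a < w -> fa s 5 (o + a) = V a) -> (forall a, w <= a -> V a = 0%R) ->
  wp E W N line_init_prog s (fun t s' => [/\ t <= h * (50 * u1 + 100) + 20,
    rows s' u1 h (fun e => (V e)%:P)%R
  & frame line_init_prog s s']).
Proof.
move=> e20 e23 e7 e9 u0 hN oN hV hV0.
apply: wp_mono (wp_for (I := fun k s' => rows s' u1 k (fun e => (V e)%:P)%R)
   (B := fun=> 50 * u1 + 90) _ _ _) => //.
- by move=> t s' /=; rewrite e20 sum_nat_const card_ord => -[h2 h3 h4]; split=> //; lia.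
move=> e s' /=; rewrite e20 => eh h1 f.
have [e23' e7' e9'] : [/\ iv s' 23 = u1, iv s' 7 = w & iv s' 9 = o] by frames; split.
have e5' : fa s' 5 = fa s 5 by frames.
have le1 : e.+1 * u1 <= h * u1 by rewrite leq_mul2r eh orbT.
have Ee3 : e.+1 * u1 = e * u1 + u1 by rewrite mulSn addnC.
apply: wp_seq; apply: wp_mono (wp_for (I := fun k s2 => rows s2 u1 e (fun e => (V e)%:P)%R /\
    forall j, j < k -> fa s2 7 (e * u1 + j) = 0%R) (B := fun=> 40) _ _ _) => //=; last first.
- rewrite /upd /= e23'; move=> k s2 ku [h2 h3] f2.
  have g22 : iv s2 22 = e by frames.
  have g23 : iv s2 23 = u1 by frames.
  last_step; rewrite ?g22 ?g23; try lia.
  split; first by lia.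
  split=> [e' j ee ju|j jk].
    by have := rows_addr ju ee => lt; simp; rewrite ifF ?h2 //; apply/eqP; lia.
  by rewrite eqn_add2l; case: eqP => // ?; apply: h3; lia.
move=> t s2; rewrite /upd /= e23' sum_nat_const card_ord => -[h2 [h3 h4] h5].
have g22 : iv s2 22 = e by frames.
have [g23 g7 g9] : [/\ iv s2 23 = u1, iv s2 7 = w & iv s2 9 = o] by frames; split.
have g5 : fa s2 5 = fa s 5 by frames.
last_step; rewrite g7 g22 subn_eq0; case: leqP => ew.
  apply: wp_skip; split; first by lia.
  move=> e' k ee ku; have [lt|->] : e' < e \/ e' = e by lia.
    exact: h3.
  by rewrite h4 // hV0 // coefC; case: eqP.
last_step; rewrite ?g22 ?g23 ?g9; try lia; split; first by lia.
move=> e' k ee ku; have [lt|->] : e' < e \/ e' = e by lia.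
  by have := rows_addr ku lt => lt'; simp; rewrite ifF ?h3 //; apply/eqP; lia.
simp; rewrite coefC -{2}[e * u1]addn0 eqn_add2l; case: eqP => _; last exact: h4.
by rewrite g5 hV.
Qed.

(** Restricting the extension to the line means evaluating it in the ring of polynomials at linear
    arguments, so it can be folded there like any other table. Low coefficients of a product depend
    only on low coefficients of its factors, hence rows of length [u + 1] suffice. *)
Lemma line_progP (s : store F) w o u (V : nat -> F)
    (a := fun j => fa s 4 (iv s 4 + j)) (b := fun j => fa s 4 (iv s 4 + u + j)) :
  iv s 20 = 2 ^ u -> iv s 5 = u -> iv s 7 = w -> iv s 9 = o ->
  2 ^ u * u.+1 <= N -> o + w <= N -> iv s 4 + u + u <= N ->
  (forall a, a < w -> fa s 5 (o + a) = V a) -> (forall a, w <= a -> V a = 0%R) ->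
  wp E W N line_prog s (fun t s' => [/\ t <= 600 * (u.+1 * 2 ^ u) + 300,
    log s' = log s ++ [seq (true, ((mlx u (fun e => (V e)%:P) (line a b))`_k)%R) | k <- iota 0 u.+1],
    heard s' = heard s
  & frame line_prog s s']).
Proof.
move=> e20 e5 e7 e9 hN oN RN hV hV0.
suff H : wp E W N line_prog s (fun t s' => [/\ t <= 600 * (u.+1 * 2 ^ u) + 300,
    log s' = log s ++ [seq (true, ((mlx u (fun e => (V e)%:P) (line a b))`_k)%R) | k <- iota 0 u.+1]
  & heard s' = heard s]).
  by apply: wp_mono (wp_frame H) => t s' [[]].
have p0 : 0 < 2 ^ u by rewrite expn_gt0.
have pu : u < 2 ^ u by apply: ltn_expl.
have uN : u.+1 <= 2 ^ u * u.+1 by rewrite leq_pmull.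
have pN : 2 ^ u <= 2 ^ u * u.+1 by rewrite leq_pmulr.
rewrite /line_prog; step; rewrite ?e5; try lia.
name_state s1.
have c23 : iv s1 23 = u.+1 by rewrite /s1; simp; rewrite ?e5 addn1.
have [c20 c7 c9 c4 c5] : [/\ iv s1 20 = 2 ^ u, iv s1 7 = w, iv s1 9 = o, iv s1 4 = iv s 4 & iv s1 5 = u] by [].
have [cl ch cf5 cf4] : [/\ log s1 = log s, heard s1 = heard s, fa s1 5 = fa s 5 & fa s1 4 = fa s 4] by [].
clearbody s1.
apply: wp_seq; apply: wp_mono (line_init_progP c20 c23 c7 c9 (ltn0Sn u) hN oN _ hV0) => [t2 s2 [ht2 r2 f2]|];
  last by rewrite cf5.
step; name_state s3.
have d26 : iv s3 26 = 2 ^ u by rewrite /s3; frames.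
have [d23 d4 d5] : [/\ iv s3 23 = u.+1, iv s3 4 = iv s 4 & iv s3 5 = u] by rewrite /s3; frames; split.
have d4a : fa s3 4 = fa s 4 by rewrite /s3; frames.
have [dl dh] : log s3 = log s /\ heard s3 = heard s by rewrite /s3; frames; split.
have r3 : rows s3 u.+1 (2 ^ u) (fun e => (V e)%:P)%R by exact: r2.
clearbody s3.
pose q := tab (fun e => (V e)%:P)%R (line a b).
apply: wp_seq; apply: wp_mono (wp_for (I := fun j s' =>
   iv s' 26 = 2 ^ (u - j) /\ rows s' u.+1 (2 ^ (u - j)) (q j))
   (B := fun j => 2 ^ (u - j.+1) * (150 * u.+1 + 50) + 100) _ _ _) => //=; last first.
- rewrite d5 => j s' ju [g26 gr] f.
  have [h23 h4 h5] : [/\ iv s' 23 = u.+1, iv s' 4 = iv s 4 & iv s' 5 = u] by frames; split.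
  have h4a : fa s' 4 = fa s 4 by frames.
  have uj : 2 ^ (u - j) = 2 * 2 ^ (u - j.+1) by rewrite -expnS; congr (2 ^ _); lia.
  have ple : 2 ^ (u - j) <= 2 ^ u by apply: leq_pexp2l; lia.
  step. step; rewrite ?h4; try lia. step; rewrite ?h4 ?h5; try lia. name_state s4.
  have k26 : iv s4 26 = 2 ^ (u - j.+1) by rewrite /s4; simp; rewrite g26 uj mulKn.
  have k23 : iv s4 23 = u.+1 by rewrite /s4.
  have k14 : fv s4 14 = a j by rewrite /s4; simp; rewrite ?h4 h4a.
  have k15 : fv s4 15 = (b j - a j)%R by rewrite /s4; simp; rewrite ?h4 ?h5 h4a.
  have kr : rows s4 u.+1 (2 * 2 ^ (u - j.+1)) (q j) by rewrite -uj.
  clearbody s4.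
  have kN : 2 * 2 ^ (u - j.+1) * u.+1 <= N by rewrite -uj (leq_trans _ hN) // leq_mul2r ple orbT.
  apply: wp_mono (line_fold_progP k26 k23 kN kr) => t4 s5 [ht4 r5 f5]; split; first by lia.
  split; first by frames.
  move=> e k eh ku; rewrite r5 // k14 k15 /q /=; congr ((polyseq _)`_k)%R.
  by congr (_ + _ * _)%R; rewrite /line polyCB; ring.
- by rewrite subn0; split.
rewrite d5 subnn => t4 s4 [ht4 [g26 gr] f4].
have [g23 g5] : iv s4 23 = u.+1 /\ iv s4 5 = u by frames; split.
have [gl gh] : log s4 = log s /\ heard s4 = heard s by frames; split.
apply: wp_mono (wp_for (I := fun k s' => log s' = log s ++
     [seq (true, ((mlx u (fun e => (V e)%:P) (line a b))`_k)%R) | k <- iota 0 k] /\ heard s' = heard s)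
   (B := fun=> 40) _ _ _) => //.
- move=> t5 s5; rewrite [ieval _ _ _]/= [icost _]/= g23 sum_nat_const card_ord => -[ht5 [hl5 hh5] f5]; split=> //.
  move: ht4; rewrite big_split big_split -big_distrl /= !sum_nat_const card_ord.
  have := sum_pow2 u => hs h4.
  have hh : (\sum_(j < u) 2 ^ (u - j.+1)) * (150 * u.+1 + 50) <= 2 ^ u * (150 * u.+1 + 50).
    by rewrite leq_mul2r ltnW ?orbT.
  have {}h4 := leq_trans h4 (leq_add (leqnn _) (leq_add (leq_add hh (leqnn _)) (leqnn _))).
  lia.
- by rewrite gl cats0.
move=> k s5; rewrite [ieval _ _ _]/= g23 => ku [hl5 hh5] f5.
have h7 : fa s5 7 = fa s4 7 by frames.
split; first by bounds.
split; first by [].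
split=> //; rewrite [log _]/= hl5 -cats1 -catA; congr (_ ++ _).
rewrite -[in RHS]addn1 iotaD map_cat /= h7; congr (_ ++ [:: (_, _)]).
have := gr 0 k isT ku; rewrite mul0n add0n => ->; congr ((polyseq _)`_k)%R.
(* After all [u] folds a single row is left, which is the extension on the line. *)
have := @mlx_tab _ (fun e => (V e)%:P)%R (line a b) (line a b) u 0 (fun _ _ => erefl).
by rewrite addn0 => ->; rewrite /mlx big_ord1 /chi big_ord0 mulr1.
Qed.

End Programs.

(** * The honest prover: a complete run *)

Lemma eq_phase_poly (F : fieldType) m N idx idx' (c c' p p' q q' T T' r r' : nat -> F) j :
  j < m ->
  (forall a, a < N -> [/\ idx a = idx' a, c a = c' a, p a = p' a & q a = q' a]) ->
  (forall e, e < 2 ^ m -> T e = T' e) -> (forall k, k < m -> r k = r' k) ->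
  phase_poly m N idx c p q T r j = phase_poly m N idx' c' p' q' T' r' j.
Proof.
move=> jm h hT hr; apply: eq_bigr => a _; have [-> -> -> ->] := h a (ltn_ord a).
congr (_ %:P * _ * (_ + _ * _))%R.
  by congr (_ * _)%R; apply: eq_bigr => k _; rewrite hr // (ltn_trans (ltn_ord k)).
apply: eq_mlx => [e he|k km]; first by rewrite hT.
by rewrite /mix; case: ifP => // kj; rewrite hr.
Qed.

Lemma horner_line (F : fieldType) (a b : nat -> F) j (t : F) :
  ((line a b j).[t] = (1 - t) * a j + t * b j)%R.
Proof. by rewrite /line !hornerE. Qed.

Lemma mle_eval (F : fieldType) n C (x : seq F) k (y : nat -> F) :
  ((mle (layer_fun n C x k)).@[fun j => y j])%R = mlx (lab n C k) (lval C x k) y.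
Proof. exact: (@mle_layer F n C F idfun k x y). Qed.

Definition point_prog : cmd :=
  For 22 $5 (6:[$22] :=! (FCst true -^ !17) *^ 4![$4 +$ $22] +^ !17 *^ 4![$4 +$ $5 +$ $22]).

(** Registers 4, 6, 8, 21 hold the label length, width, offset and table length of the current
    layer; 5, 7, 9, 20 hold those of the next one and are moved over at the end. Register 18
    receives [beta] at the challenges and 19 the value at the first point. *)
Definition layer_prog : cmd :=
  9 :=$ $8 +$ $6;; 7 :=$ IInp (#2 +$ $3);; 42 :=$ $7;; lab_prog;; 5 :=$ $40;; 20 :=$ $41;;
  table_A_prog;; gates_A_prog;;
  30 :=$ $4;; 31 :=$ $6;; 32 :=$ #0;; 34 :=$ $21;; phase_prog;;
  18 :=! 0![#0];;
  table_V_prog;; gates_B_prog;;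
  30 :=$ $5;; 32 :=$ $4;; 34 :=$ $20;; phase_prog;;
  19 :=! 0![#0];;
  table_V_prog;; gates_C_prog;;
  32 :=$ $4 +$ $5;; 34 :=$ $20;; phase_prog;;
  Out !19;; Out 0![#0];;
  line_prog;;
  In 17;;
  point_prog;;
  8 :=$ $9;; 6 :=$ $7;; 4 :=$ $5;; 21 :=$ $20.

Definition prover_cmd : cmd :=
  values_prog;;
  Out 5![#0];;
  8 :=$ #0;; 4 :=$ #0;; 6 :=$ #1;; 21 :=$ #1;;
  For 3 $2 layer_prog.

Definition store0 (F : fieldType) : store F :=
  Store (fun=> 0) (fun=> 0%R) (fun _ _ => 0) (fun _ _ => 0%R) 0 0 [::].

Section Prover.
Variables (F : fieldType) (n : nat) (C : circuit) (x : seq F) (coins : nat -> F).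
Hypotheses (wfC : wf_circuit n C) (xn : size x <= n).
Variables (W N : nat).
Notation S := (csize n C).
Notation L := (up_log 2 S).
Notation d := (depth C).
Variable ds : seq nat.
Hypothesis dsE : ds = description n C.
Notation E := (Env ds x (fun=> 0%R) coins).
Hypotheses (NW : 16 * N <= W) (SN : 10 * S * S <= N).
Notation v := (lab n C).
Notation msgs := (nth 0%R (honest_messages n C coins x)).
Notation r i := (chal n C coins i).
Notation lv i := (lval C x i).

Let w16 := W16 wfC xn NW SN.

Lemma point_progP (s : store F) u (a b : nat -> F) :
  iv s 5 = u -> iv s 4 + u + u <= N ->
  (forall j, j < u -> fa s 4 (iv s 4 + j) = a j) ->
  (forall j, j < u -> fa s 4 (iv s 4 + u + j) = b j) ->
  wp E W N point_prog s (fun t s' => [/\ t <= 50 * u + 10,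
    forall j, j < u -> fa s' 6 j = ((line a b j).[fv s 17])%R
  & frame point_prog s s']).
Proof.
move=> e5 uN ha hb.
apply: wp_mono (wp_for (I := fun k s' => forall j, j < k -> fa s' 6 j = ((line a b j).[fv s 17])%R)
   (B := fun=> 44) _ _ _) => //=.
- by rewrite e5 sum_nat_const card_ord => t s' [h1 h2 h3]; split=> //; lia.
rewrite e5 => j s' ju h f.
have [e4' e5'] : iv s' 4 = iv s 4 /\ iv s' 5 = u by frames; split.
have e4a : fa s' 4 = fa s 4 by frames.
have e17 : fv s' 17 = fv s 17 by frames.
last_step; rewrite ?e4' ?e5'; try lia.
split; first by lia.
move=> k kj; case: eqP => [->|?]; last by apply: h; lia.
by rewrite e4a e17 ha // hb // horner_line.
Qed.

Definition layer_inv i (s : store F) :=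
  [/\ iv s 2 = d, [/\ iv s 4 = v i, iv s 6 = width n C i, iv s 8 = off n C i & iv s 21 = 2 ^ v i],
      has_values n C x 0 s, forall j, j < v i -> fa s 6 j = point n C coins i j
    & heard s = coin_start n C i].

Lemma size_bounds i : [/\ v i <= L, 2 ^ v i <= 2 * width n C i, width n C i <= S,
  2 ^ v i <= N & (v i).+1 * 2 ^ v i <= N].
Proof.
have h1 := lab_le n C i; have h2 := pow_lab wfC i; have h3 := width_le n C i.
have h4 := SN10 wfC xn NW SN; have h5 := L_lt wfC; split=> //; first by lia.
apply: leq_trans SN; apply: (@leq_trans (S * (10 * S))); last by rewrite mulnC.
by apply: leq_mul; lia.
Qed.

Definition static i (s : store F) :=
  [/\ iv s 2 = d, iv s 4 = v i, iv s 5 = v i.+1, iv s 6 = width n C i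
    & [/\ iv s 7 = width n C i.+1, iv s 8 = off n C i, iv s 9 = off n C i.+1,
          iv s 20 = 2 ^ v i.+1 & has_values n C x 0 s]].

Ltac static H := let hv := fresh in let a := fresh in
  (move: (H) => [? ? ? ? [? ? ? ? hv]]; split; last split;
   try (first [by simp | by simp; frame_step; simp | by frames]);
   move=> a *; simp; first [exact: hv | frame_step; exact: hv | frames; exact: hv]).

(** Each of the three stretches costs a label length times a layer width, and so do the Lagrange
    table and the line. The three stretches of rounds concatenate to the full sum-check because
    array 4 and the message counters continue across them. *)
Lemma layer_progP i (s : store F) : i < d -> iv s 3 = i -> layer_inv i s ->
  wp E W N layer_prog s (fun t s' => [/\
    t <= 2 * 4000 * ((width n C i + width n C i.+1) * L), layer_inv i.+1 s'
  & log s' = log s ++ layer_conversation n C coins msgs i]).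
Proof.
move=> id e3 [e2 [e4 e6 e8 e21] hv hz hh].
have hN := SN10 wfC xn NW SN; have hS := S_ge2 wfC; have hd := depth_lt wfC.
have [b1 b2 b3 b4 b5] := size_bounds i; have [c1 c2 c3 c4 c5] := size_bounds i.+1.
have hL := L_lt wfC.
have hi := @off_width n C i (ltnW id); have hi1 := @off_width n C i.+1 id.
have Ew : nth 0 ds (2 + i) = width n C i.+1 by rewrite dsE add2n nth_width.
rewrite /layer_prog; step; rewrite ?e6 ?e8; try lia.
step; rewrite ?e3 ?Ew; try lia.
step; name_state s1.
have a42 : iv s1 42 = width n C i.+1 by [].
have a7 : iv s1 7 = width n C i.+1 by [].
have a9 : iv s1 9 = off n C i.+1 by rewrite /s1; simp; rewrite offS.
have [a2 a4 a6 a8 a21] : [/\ iv s1 2 = d, iv s1 4 = v i, iv s1 6 = width n C i,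
   iv s1 8 = off n C i & iv s1 21 = 2 ^ v i] by [].
have av : has_values n C x 0 s1 by [].
have az : forall j, j < v i -> fa s1 6 j = point n C coins i j by [].
have [ah al] : heard s1 = coin_start n C i /\ log s1 = log s by [].
clearbody s1; clear e2 e3 e4 e6 e8 e21 hv hz hh.
apply: wp_seq; apply: wp_mono (@lab_progP F E W N s1 _ a42 _ w16) => [t2 s2 [T2 l1 l2 f2]|]; last by lia.
step. step. name_state s3.
have k5 : iv s3 5 = v i.+1 by rewrite /s3; frames; rewrite l1.
have k20 : iv s3 20 = 2 ^ v i.+1 by rewrite /s3; frames; rewrite l2.
have [k2 k4 k6 k8 k21] : [/\ iv s3 2 = d, iv s3 4 = v i, iv s3 6 = width n C i,
   iv s3 8 = off n C i & iv s3 21 = 2 ^ v i] by rewrite /s3; frames; split.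
have [k7 k9] : iv s3 7 = width n C i.+1 /\ iv s3 9 = off n C i.+1 by rewrite /s3; frames; split.
have kv : has_values n C x 0 s3 by move=> *; rewrite /s3; frames; apply: av.
have kz : forall j, j < v i -> fa s3 6 j = point n C coins i j.
  by move=> j ju; rewrite /s3; frames; apply: az.
have [kh kl] : heard s3 = coin_start n C i /\ log s3 = log s by rewrite /s3; frames; split.
clearbody s3; clear s1 a42 a2 a4 a6 a8 a21 a7 a9 av az ah al l1 l2 f2.
apply: wp_seq; apply: wp_mono (table_A_progP coins wfC xn ds NW SN k4 k21 _ b4) => [t4 s4 [T4 g4 f4]|]; last by lia.
have q6 : iv s4 6 = width n C i by frames.
have q8 : iv s4 8 = off n C i by frames.
have qv : has_values n C x 0 s4 by move=> *; frames; apply: kv.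
apply: wp_seq; apply: wp_mono (gates_A_progP coins wfC xn ds NW SN id q6 q8 qv) => t5 s5 [T5 g5 f5].
do 4! step. name_state s6.
have [p30 p31 p32 p34] : [/\ iv s6 30 = v i, iv s6 31 = width n C i, iv s6 32 = 0 & iv s6 34 = 2 ^ v i].
  by rewrite /s6; frames; split.
have ps6 : [/\ fa s6 = fa s5, ia s6 = ia s5, heard s6 = coin_start n C i & log s6 = log s].
  by split=> //; rewrite /s6; frames.
have [P1 P2 P3 P4] := ps6.
have ST3 : static i s3 by [].
have ST6 : static i s6 by rewrite /s6; static ST3.
have pz : fa s6 0 = fa s4 0 by rewrite P1; frames.
clearbody s6.
apply: wp_seq; apply: wp_mono (@phase_progP _ E W N NW w16 s6 (v i) (width n C i) (fun a => a)
   (fun b => chi (v i) b (point n C coins i)) p30 p31 p34 _ b4 _ _ _) => //=; try lia; last 2 first.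
- move=> a aw; have [h0 _ _] := gate_lt wfC id aw; rewrite P2; have [-> _ _ _] := g5 a aw.
  by split.
- by move=> e he; rewrite pz g4 //; apply: eq_chi => j ju; apply: kz.
move=> t7 s7 [T7 [R7 C7 Ch7 _] H7 L7 f7].
rewrite P3 in R7 C7 Ch7 H7 L7; rewrite p32 in Ch7.
have ST7 : static i s7 by static ST6.
step. name_state s8.
have z18 : fv s8 18 = mlx (v i) (fun b => chi (v i) b (point n C coins i)) (r i) by rewrite -R7.
have C8 a : a < width n C i -> fa s8 1 a = chi (v i) a (r i).
  move=> aw; rewrite /s8; simp; rewrite C7 // P1; have [_ -> _ _] := g5 a aw.
  by rewrite mul1r.
have Ch8 k : k < v i -> fa s8 4 k = r i k.
  by move=> kv'; have := Ch7 k kv'; rewrite add0n.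
have ST8 : static i s8 by rewrite /s8; static ST7.
have H8 : heard s8 = coin_start n C i + v i by [].
have i8 : iv s8 31 = width n C i by rewrite /s8; frames.
have L8 : log s8 = log s ++ logs (fun j => round_log
    (round_poly (sumcheck_poly n C x i (point n C coins i)) (r i) j) (r i j)) (v i).
  rewrite /s8; simp; rewrite L7 P4; congr (_ ++ _); apply: eq_logs => j ju; congr round_log.
  rewrite (round_A wfC id) //; apply: eq_phase_poly => // a aw; rewrite P1.
  by have [_ -> -> ->] := g5 a aw.
clearbody s8; clear s3 k5 k20 k2 k4 k6 k8 k21 k7 k9 kv kz kh kl s4 g4 f4 q6 q8 qv s5 g5 f5
  s6 p30 p31 p32 p34 ps6 P1 P2 P3 P4 ST3 ST6 pz s7 R7 C7 Ch7 H7 L7 f7 ST7.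
have [_ _ _ _ [m7 _ m9 m20 mv]] := ST8.
apply: wp_seq; apply: wp_mono (table_V_progP coins wfC xn ds NW SN id m7 m9 m20 c4 mv) => t9 s9 [T9 g9 f9].
have ST9 : static i s9 by static ST8.
have [m2 m4 m5 m6 [_ m8 m9' m20' mv']] := ST9.
apply: wp_seq; apply: wp_mono (gates_B_progP coins wfC xn dsE NW SN id m2 m6 m8 m9' mv') => t10 s10 [T10 g10 f10].
have ST10 : static i s10 by static ST9.
do 3! step. name_state s11.
have [p30 p31 p32 p34] : [/\ iv s11 30 = v i.+1, iv s11 31 = width n C i, iv s11 32 = v i & iv s11 34 = 2 ^ v i.+1].
  by have [_ ? ? _ [_ _ _ ? _]] := ST10; rewrite /s11; split; [simp|frames|simp|simp].
have P1 : [/\ fa s11 = fa s10, ia s11 = ia s10, heard s11 = coin_start n C i + v i & log s11 = log s8].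
  by split=> //; rewrite /s11; frames.
have [Q1 Q2 Q3 Q4] := P1; clear P1.
have ST11 : static i s11 by rewrite /s11; static ST10.
have Ch11 k : k < v i -> fa s11 4 k = r i k by move=> kv'; rewrite Q1; frames; apply: Ch8.
have C9 a : a < width n C i -> fa s9 1 a = chi (v i) a (r i) by move=> aw; frames; apply: C8.
have z9 : fv s9 18 = mlx (v i) (fun b => chi (v i) b (point n C coins i)) (r i) by frames.
have g11 e : e < 2 ^ v i.+1 -> fa s11 0 e = lv i.+1 e by move=> he; rewrite Q1; frames; apply: g9.
clearbody s11.
apply: wp_seq; apply: wp_mono (@phase_progP _ E W N NW w16 s11 (v i.+1) (width n C i) (gfst C i)
   (lv i.+1) p30 p31 p34 _ c4 _ _ g11) => //=; try lia; last first.
  move=> a aw; have [_ h0 _] := gate_lt wfC id aw; rewrite Q2; have [-> _ _ _] := g10 a aw.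
  by split.
move=> t12 s12 [T12 [R12 C12 Ch12 Ch12' ] H12 L12 f12].
rewrite Q3 in R12 C12 Ch12 H12 L12; rewrite p32 in Ch12 Ch12'.
have ST12 : static i s12 by static ST11.
have er k : coins (coin_start n C i + v i + k) = r i (v i + k) by rewrite /chal addnA.
step. name_state s13.
have z19 : fv s13 19 = mlx (v i.+1) (lv i.+1) (fun k => r i (v i + k)).
  by rewrite /s13; simp; rewrite R12; apply: eq_mlx.
have C13 a : a < width n C i -> fa s13 1 a = (mlx (v i) (fun b => chi (v i) b (point n C coins i)) (r i)
    * chi (v i) a (r i) * chi (v i.+1) (gfst C i a) (fun k => r i (v i + k)))%R.
  move=> aw; rewrite /s13; simp; rewrite C12 // Q1; have [_ -> _ _] := g10 a aw.
  by rewrite z9 C9 //; congr (_ * _)%R; apply: eq_chi.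
have Ch13 k : k < v i + v i.+1 -> fa s13 4 k = r i k.
  move=> kv'; rewrite /s13; simp; have [lt|ge] := ltnP k (v i); first by rewrite Ch12' ?Ch11.
  by rewrite -(subnKC ge) Ch12 ?er //; lia.
have ST13 : static i s13 by rewrite /s13; static ST12.
have H13 : heard s13 = coin_start n C i + v i + v i.+1 by [].
have i13 : iv s13 31 = width n C i /\ iv s13 30 = v i.+1 by rewrite /s13; frames; split.
have L13 : log s13 = log s ++ logs (fun j => round_log
    (round_poly (sumcheck_poly n C x i (point n C coins i)) (r i) j) (r i j)) (v i + v i.+1).
  rewrite /s13; simp; rewrite L12 Q4 L8 -catA logsD; congr (_ ++ (_ ++ _)).
  apply: eq_logs => j ju; rewrite er; congr round_log.
  rewrite (round_B wfC id) //; apply: eq_phase_poly => // a aw.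
  by rewrite Q1; have [_ -> -> ->] := g10 a aw; rewrite z9 C9.
clearbody s13; clear s8 z18 C8 Ch8 ST8 H8 i8 L8 m7 m9 m20 mv s9 g9 f9 ST9 m2 m4 m5 m6 m8 m9' m20' mv'
  s10 g10 f10 ST10 s11 p30 p31 p32 p34 Q1 Q2 Q3 Q4 ST11 Ch11 C9 z9 g11 s12 R12 C12 Ch12 Ch12' H12 L12 f12 ST12.
have [_ _ _ _ [m7 _ m9 m20 mv]] := ST13.
apply: wp_seq; apply: wp_mono (table_V_progP coins wfC xn ds NW SN id m7 m9 m20 c4 mv) => t14 s14 [T14 g14 f14].
have ST14 : static i s14 by static ST13.
have [m2 m4 m5 m6 [_ m8 m9' m20' mv']] := ST14.
apply: wp_seq; apply: wp_mono (gates_C_progP coins wfC xn dsE NW SN id m2 m6 m8) => t15 s15 [T15 g15 f15].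
have ST15 : static i s15 by static ST14.
have [_ n4 n5 _ _] := ST15.
step; rewrite ?n4 ?n5; try lia.
step. name_state s16.
have [p30 p31 p32 p34] : [/\ iv s16 30 = v i.+1, iv s16 31 = width n C i, iv s16 32 = v i + v i.+1 & iv s16 34 = 2 ^ v i.+1].
  by have [_ ? ? _ [_ _ _ ? _]] := ST15; case: i13 => ? ?; rewrite /s16; split; [frames|frames|simp|simp].
have P1 : [/\ fa s16 = fa s15, ia s16 = ia s15, heard s16 = coin_start n C i + v i + v i.+1 & log s16 = log s13].
  by split=> //; rewrite /s16; frames.
have [Q1 Q2 Q3 Q4] := P1; clear P1.
have ST16 : static i s16 by rewrite /s16; static ST15.
have g16 e : e < 2 ^ v i.+1 -> fa s16 0 e = lv i.+1 e by move=> he; rewrite Q1; frames; apply: g14.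
have z16 : fv s16 19 = mlx (v i.+1) (lv i.+1) (fun k => r i (v i + k)) by rewrite /s16; frames.
have z15 : fv s14 19 = mlx (v i.+1) (lv i.+1) (fun k => r i (v i + k)) by frames.
have C15 a : a < width n C i -> fa s16 1 a = (mlx (v i) (fun b => chi (v i) b (point n C coins i)) (r i)
    * chi (v i) a (r i) * chi (v i.+1) (gfst C i a) (fun k => r i (v i + k)))%R.
  by move=> aw; rewrite Q1; frames; apply: C13.
have Ch16 k : k < v i + v i.+1 -> fa s16 4 k = r i k by move=> hk; rewrite Q1; frames; apply: Ch13.
clearbody s16.
apply: wp_seq; apply: wp_mono (@phase_progP _ E W N NW w16 s16 (v i.+1) (width n C i) (gsnd C i)
   (lv i.+1) p30 p31 p34 _ c4 _ _ g16) => //=; try lia; last first.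
  move=> a aw; have [_ _ h0] := gate_lt wfC id aw; rewrite Q2; have [-> _ _] := g15 a aw.
  by split.
move=> t17 s17 [T17 [R17 C17 Ch17 Ch17' ] H17 L17 f17].
rewrite Q3 in R17 C17 Ch17 H17 L17; rewrite p32 in Ch17 Ch17'.
have ST17 : static i s17 by static ST16.
have er2 k : coins (coin_start n C i + v i + v i.+1 + k) = r i (v i + v i.+1 + k).
  by rewrite /chal !addnA.
have z17 : fv s17 19 = mlx (v i.+1) (lv i.+1) (fun k => r i (v i + k)) by frames.
have R17' : fa s17 0 0 = mlx (v i.+1) (lv i.+1) (fun k => r i (v i + v i.+1 + k)).
  by rewrite R17; apply: eq_mlx.
have Ch18 k : k < nvars n C i -> fa s17 4 k = r i k.
  move=> hk; have [lt|ge] := ltnP k (v i + v i.+1); first by rewrite Ch17' ?Ch16.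
  by rewrite -(subnKC ge) Ch17 ?er2 //; rewrite /nvars in hk; lia.
have L17' : log s17 = log s ++ logs (fun j => round_log
    (round_poly (sumcheck_poly n C x i (point n C coins i)) (r i) j) (r i j)) (nvars n C i).
  rewrite L17 Q4 L13 -catA.
  set g := fun j => round_log (round_poly _ _ j) (r i j).
  rewrite /nvars addnA (logsD g (v i + v i.+1)); congr (_ ++ (_ ++ _)).
  apply: eq_logs => j ju; rewrite er2 /g; congr round_log.
  rewrite (round_C wfC id) //; apply: eq_phase_poly => // a aw; rewrite C15 //.
  by rewrite Q1; have [_ -> ->] := g15 a aw; rewrite z15.
step. step. name_state s18.
have L18 : log s18 = log s17 ++ [:: (true, fv s17 19); (true, fa s17 0 0)].
  by rewrite /s18; simp; rewrite -!cats1 -catA.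
have H18 : heard s18 = coin_start n C i + nvars n C i.
  by rewrite /s18; simp; rewrite H17 /nvars !addnA.
have ST18 : static i s18 by rewrite /s18; static ST17.
have F18 : fa s18 4 = fa s17 4 by [].
clearbody s18.
have [m2'' m4' m5' m6' [m7' m8' m9'' m20'' mv'']] := ST18.
apply: wp_seq; apply: wp_mono (@line_progP _ E W N NW w16 s18 (width n C i.+1) (off n C i.+1) (v i.+1) (lv i.+1)
   m20'' m5' m7' m9'' _ _ _ _ _); try lia; last 2 first.
- by move=> a aw; apply: mv''; rewrite //= id.
- by move=> a aw; apply: (lval_default xn id).
move=> t19 s19 [T19 L19 H19 f19].
have ST19 : static i s19 by static ST18.
io_step. name_state s20.
have ST20 : static i s20 by rewrite /s20; static ST19.
have [k20 h20] : fv s20 17 = line_chal n C coins i /\ heard s20 = coin_start n C i.+1.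
  rewrite /s20; simp; rewrite H19 H18; split=> //.
  by rewrite [in RHS]/coin_start big_ord_recr /= addnS.
have F20 : fa s20 4 = fa s17 4 by rewrite /s20; frames.
have L20 : log s20 = log s19 ++ [:: (false, line_chal n C coins i)].
  by rewrite /s20; simp; rewrite H19 H18 -cats1.
clearbody s20.
have [o2 o4 o5 o6 [o7 o8 o9 o20 ov]] := ST20.
apply: wp_seq; apply: wp_mono (@point_progP s20 (v i.+1) (chal1 n C coins i) (chal2 n C coins i) o5 _ _ _); last 3 first.
- by rewrite o4; lia.
- by move=> j ju; rewrite o4 F20 Ch18 // /nvars; lia.
- by move=> j ju; rewrite o4 F20 Ch18 // /nvars; lia.
move=> t21 s21 [T21 g21 f21].
have ST21 : static i s21 by static ST20.
have [u2 u4 u5 u6 [u7 u8 u9 u20 uv]] := ST21.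
step. step. step. last_step; split.
(* Every product in the accumulated time is first bounded by a multiple of [w * L] or [w' * L]; the
   products then become atoms of a linear inequality. *)
- set w := width n C i; set w' := width n C i.+1.
  have q0 : w <= w * L by rewrite leq_pmulr // L_gt0.
  have q0' : w' <= w' * L by rewrite leq_pmulr // L_gt0.
  have q1 : 2 ^ v i * v i <= 2 * w * L by apply: leq_mul.
  have q2 : v i * w <= w * L by rewrite mulnC leq_mul.
  have q3 : v i.+1 * w <= w * L by rewrite mulnC leq_mul.
  have q4 : 2 ^ v i.+1 * v i.+1 <= 2 * w' * L by apply: leq_mul.
  have q7 : 0 < w by case: wfC => _ _ wg _; apply: wg.
  have q8 : 0 < w' by case: wfC => _ _ wg _; apply: wg.
  have q5 : v i <= w * L by apply: leq_trans b1 _; rewrite leq_pmull.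
  have q6 : v i.+1 <= w' * L by apply: leq_trans c1 _; rewrite leq_pmull.
  rewrite -/w -/w' in b2 c2 T2 T4 T5 T7 T9 T10 T12 T14 T15 T17 T19.
  clear - T2 T4 T5 T7 T9 T10 T12 T14 T15 T17 T19 T21 q0 q0' q1 q2 q3 q4 q5 q6 q7 q8 b2 c2.
  move: (2 ^ v i) (2 ^ v i.+1) b2 c2 T4 T7 T9 T12 T14 T17 T19 q1 q4 => A A1 b2 c2 T4 T7 T9 T12 T14 T17 T19 q1 q4. clearbody w w'. move: (v i) (v i.+1) L T4 T7 T12 T17 T19 T21 q0 q0' q1 q2 q3 q4 q5 q6 => p1 p2 l T4 T7 T12 T17 T19 T21 q0 q0' q1 q2 q3 q4 q5 q6. lia.
- split=> //; simp.
  by move=> j ju; rewrite g21 // k20.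
  by frames.
have -> : log s21 = log s20 by frames.
rewrite L20 L19 L18 L17' z17 R17' -!catA (@honest_conversation F n C coins x i id).
congr (_ ++ (_ ++ (_ ++ _))).
- by rewrite !mle_eval.
congr (_ ++ _); apply/eq_in_map => k _; congr (_, (polyseq _)`_k)%R.
rewrite (mle_layer _ _ (@polyC F)); apply: eq_mlx => // j ju.
by rewrite /line F18 m4' !Ch18 // /nvars; lia.
Qed.

(** Each layer is charged for its own width and the next one's, so every width is counted at most
    twice and the layers add up to a multiple of [S * L]. *)
Lemma prover_cmdP :
  wp E W N prover_cmd (store0 F) (fun t s => t <= 5 * 4000 * (S * L)
    /\ log s = conversation n C coins msgs).
Proof.
have hN := SN10 wfC xn NW SN; have hS := S_ge2 wfC.
have d0 : 0 < d by case: wfC.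
have w0 : width n C 0 = 1 by case: wfC.
rewrite /prover_cmd.
apply: wp_seq; apply: wp_mono (values_progP coins wfC xn dsE NW SN (store0 F)) => t1 s1 [T1 [a1 a2 av f1]].
do 5! step. name_state s2.
have I0 : layer_inv 0 s2.
  split=> //.
  - by split=> //; rewrite /s2; simp; rewrite ?lab0 // /off big_ord0.
  - by rewrite (lab0 wfC).
  - by rewrite /s2; frames; rewrite /coin_start big_ord0.
have k2 : iv s2 2 = d by [].
have L2 : log s2 = [:: (true, msgs 0)].
  rewrite /s2; simp; rewrite (frame_log f1) //=.
  by have := av 0 0 isT; rewrite /off big_ord0 w0 => ->.
clearbody s2.
apply: wp_mono (wp_for (I := fun i s => layer_inv i s /\
    log s = (true, msgs 0) :: logs (layer_conversation n C coins msgs) i)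
   (B := fun i => 2 * 4000 * ((width n C i + width n C i.+1) * L)) _ _ _) => //.
- move=> t s; rewrite [ieval _ _ _]/= k2 => -[T2 [_ hl] _]; split; last by rewrite hl.
  move: T2; rewrite big_split -big_distrr -big_distrl /= big_split sum_nat_const card_ord /= => T2.
  have e1 : \sum_(i < d) width n C i <= S by rewrite csizeE /off leq_addr.
  have e2 : \sum_(i < d) width n C i.+1 <= S.
    by rewrite /csize big_ord_recl /= leq_addl.
  have e3 : (\sum_(i < d) width n C i + \sum_(i < d) width n C i.+1) * L <= 2 * (S * L).
    by rewrite mulnA leq_mul2r mul2n -addnn leq_add ?orbT.
  have T3 := leq_trans T2 (leq_add (leqnn _) (leq_add (leq_mul (leqnn (2 * 4000)) e3) (leqnn _))).
  have e4 : S <= S * L by rewrite leq_pmulr // L_gt0.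
  have hd := depth_lt wfC.
  clear - T1 T3 e4 hd hS; move: (S * L) T3 e4 => Q T3 e4; lia.
move=> i s; rewrite [ieval _ _ _]/= k2 => id [[b2 bb bv bz bh] hl] f.
have Ii : layer_inv i (seti s 3 i) by split.
apply: wp_mono (@layer_progP i (seti s 3 i) id erefl Ii) => t s3 [T3 I3 L3].
by split=> //; split=> //; rewrite L3 /= hl logsS.
Qed.

End Prover.

(** * Running time of a space-bounded Turing machine *)

Section RunTime.
Variables (M : tm) (n : nat).
Notation config := (tm_config M).

Lemma generates_run sp (c : config) out : tm_generates n sp c out ->
  exists T (cs : nat -> config), [/\ cs 0 = c, forall k, k < T -> tm_next n (cs k) = Some (cs k.+1),
    tm_next n (cs T) = None, forall k, k <= T -> tm_pos (cs k) < sp & tm_out (cs T) = out].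
Proof.
elim=> [{}c h1 h2|{}c c' {}out h1 h2 _ [T [cs [e0 hs hT hp ho]]]].
  by exists 0, (fun=> c).
exists T.+1, (fun k => if k is k'.+1 then cs k' else c); split=> // -[|k] //.
- by rewrite e0.
- exact: hs.
- exact: hp.
Qed.

(** The output tape is write-only, so it is left out: the rest of a configuration determines the
    rest of the next one. *)
Definition same_core (c c' : config) :=
  [/\ tm_q c = tm_q c', tm_inpos c = tm_inpos c', tm_pos c = tm_pos c'
    & tm_tape c =1 tm_tape c'].

Lemma same_core_next c c' : same_core c c' ->
  match tm_next n c, tm_next n c' with
  | Some d, Some d' => same_core d d' | None, None => True | _, _ => False end.
Proof.
case=> e1 e2 e3 e4; rewrite /tm_next e1 e2 e3 e4.
case: tm_delta => [[[[[q a] mi] mw] o]|] //; split=> //= p.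
by rewrite /upd e4.
Qed.

Variables (sp T : nat) (cs : nat -> config).
Hypotheses (cs0 : cs 0 = tm_init M)
  (csS : forall k, k < T -> tm_next n (cs k) = Some (cs k.+1))
  (csT : tm_next n (cs T) = None)
  (cs_pos : forall k, k <= T -> tm_pos (cs k) < sp).

Lemma run_next k : k < T ->
  if tm_delta (tm_q (cs k)) (tm_inpos (cs k) == 0) (tm_inpos (cs k) == n)
       (tm_tape (cs k) (tm_pos (cs k))) is Some (q, a, mi, mw, o)
  then cs k.+1 = TMConfig q (minn n (moved mi (tm_inpos (cs k)))) (moved mw (tm_pos (cs k)))
     (upd (tm_tape (cs k)) (tm_pos (cs k)) a) (tm_out (cs k) ++ seq_of_opt o)
  else False.
Proof.
move=> /csS; rewrite /tm_next; case: tm_delta => [[[[[q a] mi] mw] o]|] //.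
by case=> <-.
Qed.

Lemma run_inpos k : k <= T -> tm_inpos (cs k) <= n.
Proof.
case: k => [|k] kT; first by rewrite cs0.
have := run_next kT; case: tm_delta => [[[[[q a] mi] mw] o]|] // -> /=.
exact: geq_minl.
Qed.

Lemma run_blank k p : k <= T -> sp <= p -> tm_tape (cs k) p = tm_blank M.
Proof.
elim: k => [|k IH] kT hp; first by rewrite cs0.
have := run_next kT; case: tm_delta => [[[[[q a] mi] mw] o]|] // -> /=.
have h := cs_pos (ltnW kT); have np : p <> tm_pos (cs k) by lia.
by rewrite /upd; case: eqP => // _; apply: IH => //; apply: ltnW.
Qed.

(** If two cores agreed, then [T - k'] steps later the earlier one would agree with the halting
    configuration, although it is before time [T] and has a successor. *)
Lemma run_inj k k' : k < k' -> k' <= T -> ~ same_core (cs k) (cs k').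
Proof.
move=> kk kT sc.
have H j : k' + j <= T -> same_core (cs (k + j)) (cs (k' + j)).
  elim: j => [|j IH] jT; first by rewrite !addn0.
  have h1 : k + j < T by lia.
  have h2 : k' + j < T by lia.
  have := same_core_next (IH (ltnW h2)); rewrite !csS // !addnS //.
have := same_core_next (H (T - k') ltac:(lia)).
by rewrite subnKC // csT csS //; lia.
Qed.

(** Pigeonhole over state, input position, work position and the first [sp] tape cells. Cells beyond
    [sp] are never reached and stay blank, so these data determine the core. *)
Lemma run_time : T < #|tm_state M| * n.+1 * sp * #|tm_sym M| ^ sp.
Proof.
have sp0 : 0 < sp by have := cs_pos (leq0n T); lia.
pose core (k : 'I_T.+1) : tm_state M * 'I_n.+1 * 'I_sp * {ffun 'I_sp -> tm_sym M} :=
  (tm_q (cs k), inord (tm_inpos (cs k)), Ordinal (cs_pos (leq_ord k)),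
   [ffun p : 'I_sp => tm_tape (cs k) p]).
have core_inj : injective core.
  move=> k k' e; apply: val_inj => /=.
  have sc : same_core (cs k) (cs k').
    case: e => e1 e2 e3 /ffunP e4; split=> // [|p].
      by rewrite -(@inordK n (tm_inpos (cs k))) ?e2 ?inordK // ltnS run_inpos // leq_ord.
    have [hp|hp] := ltnP p sp; last by rewrite !run_blank ?leq_ord.
    by have := e4 (Ordinal hp); rewrite !ffunE.
  case: (ltngtP k k') => // kk; [case: (run_inj kk (leq_ord _) sc)|].
  by case: sc => *; case: (run_inj kk (leq_ord _)); split=> // p.
have := leq_card _ core_inj.
by rewrite !card_prod !card_ord card_ffun card_ord.
Qed.

End RunTime.

(* Decoding state after some output: separators seen, value of the digits of entry
   [idx] so far, and weight of its next digit. *)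
Definition dec_step idx (st : nat * nat * nat) (o : option bool) : nat * nat * nat :=
  let: (cnt, acc, pw) := st in
  if o is Some b then
    if cnt == idx then (cnt, acc + b * pw, 2 * pw) else (cnt, acc, pw)
  else (cnt.+1, acc, pw).

Definition dec idx (out : seq (option bool)) := foldl (dec_step idx) (0, 0, 1) out.

Definition le3 (a b : nat * nat * nat) := [/\ a.1.1 <= b.1.1, a.1.2 <= b.1.2 & a.2 <= b.2].

(** The decoding counters never decrease, so their final values bound them throughout; this is what
    keeps the simulation from overflowing a word. *)
Lemma dec_mono idx out out' st :
  le3 (foldl (dec_step idx) st out) (foldl (dec_step idx) st (out ++ out')).
Proof.
rewrite foldl_cat; move: (foldl _ st out) => {}st.
elim: out' st => [|o out' IH] [[cnt acc] pw] /=; first by split.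
have [h1 h2 h3] := IH (dec_step idx (cnt, acc, pw) o).
have [k1 k2 k3] : le3 (cnt, acc, pw) (dec_step idx (cnt, acc, pw) o).
  by case: o {h1 h2 h3} => [b|]; split=> //=; case: ifP => _ /=; lia.
by split; [apply: leq_trans k1 h1 | apply: leq_trans k2 h2 | apply: leq_trans k3 h3].
Qed.

Definition digits k := [seq Some (odd (k %/ 2 ^ j)) | j <- iota 0 (up_log 2 k.+1)].

Lemma encode_cons k s : encode (k :: s) = rcons (digits k) None ++ encode s.
Proof. by []. Qed.

Lemma dec_skip idx cnt acc pw (ds : seq bool) : cnt != idx ->
  foldl (dec_step idx) (cnt, acc, pw) (map Some ds) = (cnt, acc, pw).
Proof. by move=> /negbTE h; elim: ds => //= b ds IH; rewrite h. Qed.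

Lemma dec_digits idx k m :
  foldl (dec_step idx) (idx, 0, 1) [seq Some (odd (k %/ 2 ^ j)) | j <- iota 0 m]
  = (idx, k %% 2 ^ m, 2 ^ m).
Proof.
elim: m => [|m IH]; first by rewrite modn1.
have -> : iota 0 m.+1 = iota 0 m ++ [:: m] by rewrite -[m.+1]addn1 iotaD.
rewrite map_cat foldl_cat IH /= eqxx expnS; congr (_, _, _).
have pm : 0 < 2 ^ m by rewrite expn_gt0.
set q := k %/ 2 ^ m; have rm := ltn_pmod k pm.
have ek : k = q %/ 2 * (2 * 2 ^ m) + (odd q * 2 ^ m + k %% 2 ^ m).
  rewrite addnA mulnA -mulnDl {1}(divn_eq k (2 ^ m)) -/q; congr (_ * _ + _).
  by rewrite -modn2 -divn_eq.
have -> : k %% (2 * 2 ^ m) = (odd q * 2 ^ m + k %% 2 ^ m) %% (2 * 2 ^ m).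
  by rewrite {1}ek modnMDl.
rewrite [RHS]modn_small; first by rewrite addnC.
clear ek; move: (k %% 2 ^ m) rm => p rm; case: (odd q); rewrite ?mul1n ?mul0n; lia.
Qed.

Lemma digits_bools k : exists ds, digits k = map Some ds.
Proof. by exists [seq odd (k %/ 2 ^ j) | j <- iota 0 (up_log 2 k.+1)]; rewrite -map_comp. Qed.

Lemma dec_encode_past idx cnt acc pw s : idx < cnt ->
  foldl (dec_step idx) (cnt, acc, pw) (encode s) = (cnt + size s, acc, pw).
Proof.
elim: s cnt => [|k s IH] cnt h; first by rewrite addn0.
rewrite encode_cons foldl_cat foldl_rcons; have [ds ->] := digits_bools k.
rewrite dec_skip ?IH /= ?addnS ?addSn //; lia.
Qed.

Lemma dec_encode idx s : idx < size s -> dec idx (encode s) =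
  (size s, nth 0 s idx, 2 ^ up_log 2 (nth 0 s idx).+1).
Proof.
(* [m] counts the entries still to be skipped before entry [idx]. *)
rewrite /dec => h; suff H m : m <= idx -> foldl (dec_step idx) (idx - m, 0, 1) (encode (drop (idx - m) s))
   = (size s, nth 0 s idx, 2 ^ up_log 2 (nth 0 s idx).+1).
  by have := H idx (leqnn _); rewrite subnn drop0.
elim: m => [|m IH] mi.
  rewrite subn0 (drop_nth 0 h) encode_cons foldl_cat foldl_rcons /digits dec_digits /=.
  rewrite dec_encode_past // size_drop modn_small; first by congr (_, _, _); lia.
  exact: up_logP.
have hm : idx - m.+1 < size s by lia.
rewrite (drop_nth 0 hm) encode_cons foldl_cat foldl_rcons; have [ds ->] := digits_bools (nth 0 s (idx - m.+1)).
rewrite dec_skip /=; last by lia.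
have -> : (idx - m.+1).+1 = idx - m by lia.
by apply: IH; lia.
Qed.

Definition rank (T : finType) (x : T) : nat := enum_rank x.
Arguments rank : simpl never.

Lemma rank_lt (T : finType) (x : T) : rank x < #|T|.
Proof. exact: ltn_ord. Qed.

(** * An interpreter for the uniformity machine that retains one output word *)

Section Interpreter.
Variable M : tm.
Notation Q := (tm_state M).
Notation G := (tm_sym M).

Fixpoint switch r k (l : seq cmd) : cmd :=
  if l is c :: l' then CaseI ($r -$ #k) c (switch r k.+1 l') else Skip.

(** Registers 25, 26, 27 are the state of [dec_step] and 28 is the wanted entry. Subtraction is
    truncated, so the sum of the two differences is zero exactly when the registers are equal. *)
Definition emit (o : option (option bool)) : cmd := match o with
| None => Skip
| Some None => 25 :=$ $25 +$ #1
| Some (Some b) =>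
    CaseI ($25 -$ $28 +$ ($28 -$ $25))
      ((if b then 26 :=$ $26 +$ $27 else Skip);; 27 :=$ #2 *$ $27) Skip
end.

Definition move_input (m : move) : cmd := match m with
| Left => 21 :=$ $21 -$ #1 | Stay => Skip
| Right => CaseI ($1 -$ $21) Skip (21 :=$ $21 +$ #1) end.

Definition move_work (m : move) : cmd := match m with
| Left => 22 :=$ $22 -$ #1 | Stay => Skip | Right => 22 :=$ $22 +$ #1 end.

(** The transition table is finite and does not depend on [n], so each of its entries is unrolled
    into straight-line code. *)
Definition tm_leaf (q : Q) b0 b1 (a : G) : cmd :=
  if tm_delta q b0 b1 a is Some (q', a', mi, mw, o) then
    20 :=$ #(rank q');; 1:[$22] :=$ #(rank a');;
    move_input mi;; move_work mw;; emit o
  else 24 :=$ #0.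

Definition tm_body : cmd :=
  29 :=$ 1$[$22];;
  switch 20 0 [seq switch 29 0 [seq
      CaseI $21 (CaseI ($1 -$ $21) (tm_leaf q true true a) (tm_leaf q true false a))
                (CaseI ($1 -$ $21) (tm_leaf q false true a) (tm_leaf q false false a))
    | a <- enum G] | q <- enum Q];;
  CaseI ($22 -$ $23) Skip (23 :=$ $22;; 1:[$22] :=$ #(rank (tm_blank M))).

(* Cells beyond the largest position visited, in register 23, are only blanked
   when first reached, so that the tape array needs no clearing between runs. *)
Definition get_prog : cmd :=
  20 :=$ #(rank (tm_start M));; 21 :=$ #0;; 22 :=$ #0;; 23 :=$ #0;; 24 :=$ #1;;
  25 :=$ #0;; 26 :=$ #0;; 27 :=$ #1;;
  1:[#0] :=$ #(rank (tm_blank M));;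
  While $24 tm_body.

End Interpreter.

(** * Reading the circuit off the Turing machine *)

Section Get.
Variables (M : tm) (F : fieldType) (E : env F) (W N n sp B nQ nG : nat).
Notation Q := (tm_state M).
Notation G := (tm_sym M).
Hypotheses (QQ : #|Q| <= nQ) (GG : #|G| <= nG) (QW' : nQ <= W) (GW' : nG <= W) (nW : n < W) (NW : 16 * N <= W)
  (spN : sp <= N) (sp0 : 0 < sp) (BW : 3 * B + 3 <= W).

Let QW : #|Q| <= W := leq_trans QQ QW'.
Let GW : #|G| <= W := leq_trans GG GW'.

Lemma switch_wp r k l (s : store F) (P : post F) :
  k <= iv s r -> iv s r - k < size l -> k + size l <= W ->
  wp E W N (nth Skip l (iv s r - k)) s (fun t => P (5 * (iv s r - k).+1 + t)) ->
  wp E W N (switch r k l) s P.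
Proof.
elim: l k P => //= c l IH k P kr rl kW H.
split; first by bounds.
rewrite /= subn_eq0; case: leqP => hk.
  have e0 : iv s r - k = 0 by lia.
  rewrite e0 /= in H; apply: wp_mono H => t s'; congr P; lia.
apply: IH; [lia|lia|lia|].
have e1 : iv s r - k = (iv s r - k.+1).+1 by lia.
rewrite e1 /= in H; apply: wp_mono H => t s'; congr P; lia.
Qed.

Lemma switch_enum (T : finType) (f : T -> cmd) (x : T) r (s : store F) (P : post F) :
  iv s r = rank x -> #|T| <= W ->
  wp E W N (f x) s (fun t => P (5 * (rank x).+1 + t)) ->
  wp E W N (switch r 0 [seq f y | y <- enum T]) s P.
Proof.
move=> er TW H; have sz : size [seq f y | y <- enum T] = #|T| by rewrite size_map -cardE.
apply: switch_wp; rewrite ?er ?subn0 ?sz ?rank_lt //.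
by rewrite (nth_map x) -?cardE ?rank_lt // nth_enum_rank.
Qed.

Definition dec_regs (s : store F) := (iv s 25, iv s 26, iv s 27).

Lemma emit_wp o (s : store F) : iv s 25 <= B -> iv s 26 <= B -> iv s 27 <= B -> iv s 28 <= B ->
  wp E W N (emit o) s (fun t s' => t <= 40 /\
   dec_regs s' = foldl (dec_step (iv s 28)) (dec_regs s) (seq_of_opt o)).
Proof.
move=> h25 h26 h27 h28; rewrite /dec_regs; case: o => [[b|]|] /=.
- last_step.
  have -> : (iv s 25 - iv s 28 + (iv s 28 - iv s 25) == 0) = (iv s 25 == iv s 28) by lia.
  case: eqP => _; last by apply: wp_skip.
  apply: wp_seq; case: b.
    last_step; last_step; split; first lia.
    by rewrite mul1n.
  apply: wp_skip; last_step; split; first lia.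
  by rewrite mul0n addn0.
- last_step; split; first lia.
  by rewrite addn1.
- exact: wp_skip.
Qed.

Lemma move_input_wp m (s : store F) : iv s 1 = n -> iv s 21 <= n ->
  wp E W N (move_input m) s (fun t s' => t <= 20 /\ iv s' 21 = minn n (moved m (iv s 21))).
Proof.
move=> e1 h21; case: m => /=.
- by last_step; split; first lia; rewrite subn1; lia.
- by apply: wp_skip; split; last lia.
last_step; rewrite e1 subn_eq0; case: leqP => h.
  by apply: wp_skip; split; lia.
by last_step; split; lia.
Qed.

Lemma move_work_wp m (s : store F) : iv s 22 < sp ->
  wp E W N (move_work m) s (fun t s' => t <= 20 /\ iv s' 22 = moved m (iv s 22)).
Proof.
move=> h; case: m => /=.
- by last_step; split; first lia; rewrite subn1.
- exact: wp_skip.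
- by last_step; split; first lia; rewrite addn1.
Qed.

(* Its modified variables stand for those of the interpreter, which are not
   computable for an abstract machine. *)
Definition get_mods : cmd :=
  20 :=$ #0;; 21 :=$ #0;; 22 :=$ #0;; 23 :=$ #0;; 24 :=$ #0;; 25 :=$ #0;; 26 :=$ #0;;
  27 :=$ #0;; 29 :=$ #0;; 1:[#0] :=$ #0.

Definition tame c := [/\ {subset ivars c <= ivars get_mods}, fvars c = [::],
  {subset iarrs c <= iarrs get_mods}, farrs c = [::] & ~~ draws c && ~~ talks c && cwf c].

Lemma tame_switch r k l : r < 50 ->
  (forall j, j < size l -> tame (nth Skip l j)) -> tame (switch r k l).
Proof.
move=> r50; elim: l k => [|c l IH] k H; first by split.
have [a1 a2 a3 a4 a5] := H 0 isT.
have [b1 b2 b3 b4 b5] := IH k.+1 (fun j (jl : j < size l) => H j.+1 jl).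
split=> /=.
- by move=> y; rewrite mem_cat => /orP[/a1|/b1].
- by rewrite [X in X ++ _]a2 b2.
- by move=> y; rewrite mem_cat => /orP[/a3|/b3].
- by rewrite [X in X ++ _]a4 b4.
- rewrite r50; move: a5 b5; rewrite /= => /andP[/andP[/negbTE-> /negbTE->] ->].
  by case/andP => /andP[/negbTE-> /negbTE->] ->.
Qed.

Lemma tame_seq c1 c2 : tame c1 -> tame c2 -> tame (c1;; c2).
Proof.
case=> a1 a2 a3 a4 a5 [b1 b2 b3 b4 b5]; split=> /=.
- by move=> y; rewrite mem_cat => /orP[/a1|/b1].
- by rewrite a2 b2.
- by move=> y; rewrite mem_cat => /orP[/a3|/b3].
- by rewrite a4 b4.
- move: a5 b5 => /andP[/andP[/negbTE-> /negbTE->] ->].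
  by case/andP => /andP[/negbTE-> /negbTE->] ->.
Qed.

Lemma tame_case e c1 c2 : iwf e -> tame c1 -> tame c2 -> tame (CaseI e c1 c2).
Proof.
move=> we t1 t2; have [b1 b2 b3 b4 b5] := tame_seq t1 t2; split=> //.
by move: b5; rewrite /= we.
Qed.

Lemma tame_leaf q b0 b1 (a : G) : tame (tm_leaf q b0 b1 a).
Proof.
rewrite /tm_leaf; case: tm_delta => [[[[[q' a'] mi] mw] o]|]; last by split=> // r; rewrite !inE => /eqP->.
by case: mi; case: mw; case: o => [[[]|]|]; split=> // r /=; rewrite !inE => h;
  repeat (case/orP: h => h); rewrite ?(eqP h).
Qed.

Lemma tame_body : tame (tm_body M).
Proof.
rewrite /tm_body; apply: tame_seq; first by split=> // r; rewrite !inE => /eqP->.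
apply: tame_seq.
  apply: tame_switch => // j; rewrite size_map => hj.
  have q0 : Q by case: (enum Q) hj.
  rewrite (nth_map q0) //; apply: tame_switch => // l; rewrite size_map => hl.
  have a0 : G by case: (enum G) hl.
  by rewrite (nth_map a0) //; repeat (apply: tame_case => //); apply: tame_leaf.
by split=> // r /=; rewrite !inE => h; repeat (case/orP: h => h); rewrite ?(eqP h).
Qed.

Lemma tame_get : tame (get_prog M).
Proof.
rewrite /get_prog; repeat (apply: tame_seq; first by split=> // r; rewrite !inE => /eqP->).
by case: tame_body => t1 t2 t3 t4 t5; split.
Qed.

Lemma tame_frame c (s s' : store F) : tame c -> frame c s s' -> frame get_mods s s'.
Proof.
case=> t1 t2 t3 t4 /andP[/andP[t5 t6] _]; apply: frame_sub => //.
- by rewrite t2.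
- by rewrite t4.
- by rewrite (negbTE t5).
- by rewrite (negbTE t6).
Qed.

Variables (ds : seq nat) (T : nat) (cs : nat -> tm_config M).
Hypotheses (cs0 : cs 0 = tm_init M)
  (csS : forall k, k < T -> tm_next n (cs k) = Some (cs k.+1))
  (csT : tm_next n (cs T) = None)
  (cs_pos : forall k, k <= T -> tm_pos (cs k) < sp)
  (csO : tm_out (cs T) = encode ds).

(** Up to the mark in register 23 the array agrees with the tape. Beyond it the tape is blank, while
    the array may still hold symbols of an earlier run. *)
Definition encodes (c : tm_config M) (s : store F) :=
  [/\ iv s 1 = n, iv s 20 = rank (tm_q c), iv s 21 = tm_inpos c, iv s 22 = tm_pos c &
   [/\ tm_pos c <= iv s 23, forall p, p <= iv s 23 -> ia s 1 p = rank (tm_tape c p)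
     , forall p, iv s 23 < p -> tm_tape c p = tm_blank M
     & dec_regs s = dec (iv s 28) (tm_out c)]].

Lemma out_prefix k j : k + j <= T -> exists o, tm_out (cs (k + j)) = tm_out (cs k) ++ o.
Proof.
elim: j => [|j IH] h; first by exists [::]; rewrite addn0 cats0.
have [o eo] := IH ltac:(lia).
have kj : k + j < T by lia.
have := run_next csS kj; case: tm_delta => [[[[[q a] mi] mw] o']|] //.
by rewrite addnS => ->; exists (o ++ seq_of_opt o'); rewrite /= eo catA.
Qed.

(** Every output so far is a prefix of the encoded description, so [dec_mono] bounds the counters by
    their final values; the weight of the next digit is at most twice the successor of the entry. *)
Lemma dec_bound idx k : k <= T -> idx < size ds -> size ds <= B -> 4 * nth 0 ds idx + 4 <= B ->
  let st := dec idx (tm_out (cs k)) in [/\ st.1.1 <= B, st.1.2 <= B & st.2 <= B].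
Proof.
move=> kT hi hs hB st.
have [o eo] := @out_prefix k (T - k) ltac:(lia).
rewrite subnKC // csO in eo.
have [h1 h2 h3] := dec_mono idx (tm_out (cs k)) o (0, 0, 1).
rewrite -eo -/(dec _ _) -/(dec _ _) (dec_encode hi) /= in h1 h2 h3.
have pw : 2 ^ up_log 2 (nth 0 ds idx).+1 <= 2 * (nth 0 ds idx).+1.
  case: (nth 0 ds idx) => [|m]; first by rewrite up_log1.
  have := up_log_gtn (isT : 1 < 2) (isT : 1 < m.+2).
  have : 0 < up_log 2 m.+2 by rewrite up_log_gt0.
  by case: (up_log _ _) => // l _; rewrite expnS /=; lia.
by rewrite /st; split; lia.
Qed.

Lemma tm_leaf_wp k (s : store F) : k <= T -> encodes (cs k) s -> iv s 24 = 1 ->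
  iv s 28 < size ds -> size ds <= B -> 4 * nth 0 ds (iv s 28) + 4 <= B ->
  let c := cs k in
  wp E W N (tm_leaf (tm_q c) (tm_inpos c == 0) (tm_inpos c == n) (tm_tape c (tm_pos c))) s
    (fun t s' => t <= 120 /\
      if tm_next n c is Some c' then
        [/\ iv s' 20 = rank (tm_q c'), iv s' 21 = tm_inpos c', iv s' 22 = tm_pos c',
            iv s' 24 = 1 & [/\ iv s' 23 = iv s 23,
            ia s' 1 = upd (ia s 1) (tm_pos c) (rank (tm_tape c' (tm_pos c)))
          & dec_regs s' = dec (iv s 28) (tm_out c')]]
      else s' = seti s 24 0).
Proof.
move=> kT [e1 e20 e21 e22 [h23 ht hb hd]] e24 hi hs hB c.
have [b1 b2 b3] := dec_bound kT hi hs hB.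
have hp := cs_pos kT; have hn : tm_inpos c <= n by apply: (run_inpos cs0 csS kT).
rewrite -hd /dec_regs /= in b1 b2 b3.
rewrite /tm_leaf /tm_next; case: tm_delta => [[[[[q a] mi] mw] o]|]; last by last_step.
have rq : rank q <= W := ltnW (leq_trans (rank_lt _) QW).
have ra : rank a <= W := ltnW (leq_trans (rank_lt _) GW).
step. step.
name_state s1; have E28 : iv s1 28 = iv s 28 by [].
apply: wp_seq; apply: wp_mono (wp_frame (@move_input_wp mi s1 _ _)) => [t2 s2 [[T2 g21] f2]||]; last 2 first.
- by rewrite /s1; simp.
- by rewrite /s1; simp; rewrite e21.
have m22 : iv s2 22 = tm_pos c by case: mi f2 g21 => f2 _; frames.
apply: wp_seq; apply: wp_mono (wp_frame (@move_work_wp mw s2 _)) => [t3 s3 [[T3 g22] f3]|]; last by rewrite m22.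
have [m23 m24 m25 m26 [m27 m28 m20 m21 mia]] : [/\ iv s3 23 = iv s 23, iv s3 24 = 1, iv s3 25 = iv s 25, iv s3 26 = iv s 26
  & [/\ iv s3 27 = iv s 27, iv s3 28 = iv s 28, iv s3 20 = rank q, iv s3 21 = iv s2 21
   & ia s3 1 = upd (ia s 1) (iv s 22) (rank a)]].
  rewrite /s1 in f2; clear s1 E28 g21 g22 m22.
  case: mi f2 => f2; case: mw f3 => f3; split; last split; by frames.
have m1 : iv s3 1 = n.
  by rewrite /s1 in f2; clear s1 E28 g21 g22 m22; case: mi f2 => f2; case: mw f3 => f3; frames.
apply: wp_mono (wp_frame (@emit_wp o s3 _ _ _ _)) => [t4 s4 [[T4 g4] f4]||||]; rewrite ?m25 ?m26 ?m27 ?m28 //; try lia.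
split; first by lia.
have [j1 j2 j3 j4 [j5 j6]] : [/\ iv s4 20 = iv s3 20, iv s4 21 = iv s3 21, iv s4 22 = iv s3 22, iv s4 24 = iv s3 24
    & [/\ iv s4 23 = iv s3 23 & ia s4 1 = ia s3 1]].
  by clear -f4; case: o f4 => [[[]|]|] f4; split; last split; frames.
split; rewrite ?j1 ?j2 ?j3 ?j4 ?m20 ?m21 ?m24 ?g21 ?g22 ?m22 //=.
- by rewrite /s1; simp; rewrite e21.
- split; first by rewrite j5.
    by rewrite j6 mia e22 /upd eqxx.
  have -> : dec_regs s4 = foldl (dec_step (iv s 28)) (dec_regs s) (seq_of_opt o).
    by rewrite g4 /dec_regs m25 m26 m27 m28.
  by rewrite hd /dec foldl_cat.
Qed.

Lemma tm_body_wp k (s : store F) : k <= T -> encodes (cs k) s -> iv s 24 = 1 ->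
  iv s 28 < size ds -> size ds <= B -> 4 * nth 0 ds (iv s 28) + 4 <= B ->
  wp E W N (tm_body M) s (fun t s' => t <= 5 * (nQ + nG) + 200 /\
      if k < T then encodes (cs k.+1) s' /\ iv s' 24 = 1
      else encodes (cs k) s' /\ iv s' 24 = 0).
Proof.
move=> kT En e24 hi hs hB; have [e1 e20 e21 e22 [h23 ht hb hd]] := En.
have hp := cs_pos kT; have hn : tm_inpos (cs k) <= n by apply: (run_inpos cs0 csS kT).
have t0 : ia s 1 (tm_pos (cs k)) = rank (tm_tape (cs k) (tm_pos (cs k))) by apply: ht.
rewrite /tm_body; step; rewrite ?e22; try lia.
apply: wp_seq.
set nx := (fun t => _).
apply: (@switch_enum _ _ (tm_q (cs k))) => //.
apply: (@switch_enum _ _ (tm_tape (cs k) (tm_pos (cs k)))) => //.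
set tt := tm_tape _ _; set sx := seti _ _ _.
have Ex : encodes (cs k) sx by [].
have H := @tm_leaf_wp k sx kT Ex e24 hi hs hB.
(* The two head tests are dispatched at run time among four leaves; whichever branch is taken is the
   leaf specified in [H]. *)
have H' (P : post F) : (forall t s', t <= 150 -> (if tm_next n (cs k) is Some c' then
        [/\ iv s' 20 = rank (tm_q c'), iv s' 21 = tm_inpos c', iv s' 22 = tm_pos c',
            iv s' 24 = 1 & [/\ iv s' 23 = iv sx 23,
            ia s' 1 = upd (ia sx 1) (tm_pos (cs k)) (rank (tm_tape c' (tm_pos (cs k))) : nat)
          & dec_regs s' = dec (iv sx 28) (tm_out c')]]
      else s' = seti sx 24 0) -> frame get_mods sx s' -> P t s') ->
  wp E W N (CaseI $21 (CaseI ($1 -$ $21) (tm_leaf (tm_q (cs k)) true true tt) (tm_leaf (tm_q (cs k)) true false tt))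
                (CaseI ($1 -$ $21) (tm_leaf (tm_q (cs k)) false true tt) (tm_leaf (tm_q (cs k)) false false tt))) sx P.
  move=> HP; have Hl := wp_frame H.
  have [x1 x21] : iv sx 1 = n /\ iv sx 21 = tm_inpos (cs k) by [].
  clearbody sx.
  have n0 : (n - tm_inpos (cs k) == 0) = (tm_inpos (cs k) == n) by lia.
  last_step; rewrite x21; move: Hl; case: eqP => _ Hl; last_step; rewrite x1 x21 n0; move: Hl;
   case: eqP => _ Hl; apply: wp_mono Hl => t s' [[h1 h2] h3]; (apply: HP; [lia| exact: h2|
     exact: tame_frame (tame_leaf _ _ _ _) h3]).
apply: H' => t s' tB Hs fr.
rewrite /nx {nx H}.
have rq : rank (tm_q (cs k)) < nQ := leq_trans (rank_lt _) QQ.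
have rt : rank tt < nG := leq_trans (rank_lt _) GG.
have [f1 f28] : iv s' 1 = n /\ iv s' 28 = iv s 28 by frames; split.
case: (ltnP k T) => [kT'|Tk]; last first.
  have Ek : k = T by lia.
  rewrite Ek csT in Hs; rewrite Hs.
  last_step; rewrite e22 (eqP (_ : tm_pos (cs k) - iv s 23 == 0)) ?subn_eq0 // eqxx.
  by apply: wp_skip; split; first lia.
rewrite csS // in Hs; case: Hs => g20 g21 g22 g24 [g23 gia gd].
have Ht p : p <> tm_pos (cs k) -> tm_tape (cs k.+1) p = tm_tape (cs k) p.
  move=> np; have := run_next csS kT'; case: tm_delta => [[[[[q a] mi] mw] o]|] // -> /=.
  by rewrite /upd; case: eqP.
have Hb p : iv s 23 < p -> tm_tape (cs k.+1) p = tm_blank M.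
  by move=> hp'; rewrite Ht ?hb //; lia.
have Hi p : p <= iv s 23 -> ia s' 1 p = rank (tm_tape (cs k.+1) p).
  by move=> hp'; rewrite gia /upd; case: eqP => [->|np] //; rewrite Ht // -ht.
(* The head moves by at most one cell, so a cell beyond the mark is the one right after it; blanking
   that single cell keeps the array faithful. *)
have Hm : tm_pos (cs k.+1) <= (tm_pos (cs k)).+1.
  have := run_next csS kT'; case: tm_delta => [[[[[q a] mi] mw] o]|] // -> /=.
  by case: mw => /=; lia.
have hp' := cs_pos kT'.
have c0 : iv sx 23 = iv s 23 by [].
have c1 : iv sx 28 = iv s 28 by [].
have rb : rank (tm_blank M) <= W := ltnW (leq_trans (rank_lt _) GW).
rewrite c0 in g23; rewrite c1 in gd; clearbody sx tt.
last_step; rewrite g22 g23 subn_eq0; case: leqP => hpm.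
  apply: wp_skip; split; first lia.
  split=> //; split=> //; rewrite g23 f28; split=> //.
step; last_step; rewrite ?g22; try lia; split; first lia.
split=> //; split=> //; split=> /=; rewrite /upd2 /upd /= ?f28 //.
- move=> p hpp; case: eqP => [->|np]; first by rewrite Hb.
  by apply: Hi; lia.
- by move=> p hpp; apply: Hb; lia.
Qed.

Lemma get_progP (s : store F) : iv s 1 = n -> iv s 28 < size ds -> size ds <= B ->
  4 * nth 0 ds (iv s 28) + 4 <= B ->
  wp E W N (get_prog M) s (fun t s' => [/\
    t <= T.+2 * (5 * (nQ + nG) + 210) + 50,
    iv s' 26 = nth 0 ds (iv s 28) & frame get_mods s s']).
Proof.
move=> e1 hi hs hB.
suff H : wp E W N (get_prog M) s (fun t s' => t <= T.+2 * (5 * (nQ + nG) + 210) + 50 /\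
    iv s' 26 = nth 0 ds (iv s 28)).
  by apply: wp_mono (wp_frame H) => t s' [[h1 h2] /(tame_frame tame_get)]; split.
have rb : rank (tm_blank M) <= W := ltnW (leq_trans (rank_lt _) GW).
have rs : rank (tm_start M) <= W := ltnW (leq_trans (rank_lt _) QW).
rewrite /get_prog; do 9! step; name_state s1.
have E0 : encodes (cs 0) s1.
  rewrite cs0; split=> //; split=> //= p; rewrite leqn0 => /eqP ->.
  by rewrite /upd2 /upd.
have e28 : iv s1 28 = iv s 28 by [].
have e24 : iv s1 24 = 1 by [].
clearbody s1.
(* There are [T.+1] rounds: [T] moves and one in which the machine is found to halt and the flag in
   register 24 is cleared. *)
apply: wp_mono (wp_while (I := fun k s' => iv s' 28 = iv s 28 /\
     if k <= T then encodes (cs k) s' /\ iv s' 24 = 1 else encodes (cs T) s' /\ iv s' 24 = 0)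
   (B := 5 * (nQ + nG) + 200) (n := T.+1) _ _ _).
- move=> t s' [h1 [h2 h3] _]; rewrite ltnn in h3; case: h3 => [[_ _ _ _ [_ _ _ hd]] _].
  split.
    move: h1; rewrite /= !mulnDr; lia.
  move: hd; rewrite h2 csO dec_encode // /dec_regs; by case.
- by [].
- move=> k s' kT [_ h]; split=> //=; case: leqP h => hk [_ ->]; lia.
move=> k s' kT [h2 h3] _; rewrite ltnS in kT; rewrite kT in h3; case: h3 => h3 h4.
apply: wp_mono (wp_frame (@tm_body_wp k s' kT h3 h4 _ _ _)); rewrite ?h2 // => t s2 [[t2 h5] f].
have tb : tame (tm_body M) by exact: tame_body.
split=> //; split; first by have := tame_frame tb f => {}f; frames.
by case: ltnP h5 => // Tk; have -> : k = T by lia.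
Qed.

End Get.

(** * The online verifier *)

Definition evaluate_cmd : cmd :=
  0 :=! FCst false;; 43 :=$ 2$[$2];; 44 :=$ #0;;
  For 13 $1 (42 :=$ $13;; chi_prog 13 1;; 0 :=! !0 +^ FInp $13 *^ !13).

(** Integer register 0 is the verdict, set to 1 at the outset and cleared by a failing check. The
    conversation goes on after a failure, so its shape does not depend on the prover. *)
Definition reject_unless (e : fexp) : cmd := CaseF e Skip (0 :=$ #0).

(** The value at 0 is the constant coefficient and the value at 1 the sum of all three; the new
    claim is computed by Horner's rule. The challenge is stored since preprocessing but sent only
    once the message has been received. *)
Definition round_prog : cmd :=
  In 11;; In 12;; In 13;;
  reject_unless (!11 +^ (!11 +^ !12 +^ !13) -^ !10);;
  17 :=! 0![$8];; 8 :=$ $8 +$ #1;; Out !17;;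
  10 :=! !11 +^ !17 *^ (!12 +^ !17 *^ !13).

(** Coefficients are consumed as they arrive and never stored. Registers 19, 16, 15 end up with the
    values at 0, at 1 and at the challenge in 17, whose current power is in 18. *)
Definition line_read_prog : cmd :=
  18 :=! FCst true;; 15 :=! FCst false;; 16 :=! FCst false;;
  For 13 ($5 +$ #1)
    (In 14;; CaseI $13 (19 :=! !14) Skip;;
     16 :=! !16 +^ !14;; 15 :=! !15 +^ !14 *^ !18;; 18 :=! !18 *^ !17).

(** The challenge on the line is loaded before its coefficients arrive, so that they can be
    evaluated on the fly, and is revealed only after all of them have been received. *)
Definition interact_layer_prog : cmd :=
  4 :=$ 2$[$3];; 5 :=$ 2$[$3 +$ #1];;
  For 13 ($4 +$ ($5 +$ $5)) round_prog;;
  In 11;; In 12;;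
  reject_unless (2![$3] *^ (!11 +^ !12) +^ 3![$3] *^ (!11 *^ !12) -^ !10);;
  17 :=! 0![$8];; 8 :=$ $8 +$ #1;;
  line_read_prog;;
  reject_unless (!19 -^ !11);;
  reject_unless (!16 -^ !12);;
  10 :=! !15;; Out !17.

Definition interact_cmd : cmd :=
  0 :=$ #1;; 8 :=$ #0;; In 10;;
  For 3 $2 interact_layer_prog;;
  reject_unless (!10 -^ !0).

Lemma all_iotaS (P : pred nat) k : all P (iota 0 k.+1) = all P (iota 0 k) && P k.
Proof.
have -> : iota 0 k.+1 = iota 0 k ++ [:: k] by rewrite -[k.+1]addn1 iotaD.
by rewrite all_cat /= andbT.
Qed.

Section Verifier.
Variables (F : fieldType) (n : nat) (C : circuit) (coins : nat -> F).
Hypothesis wfC : wf_circuit n C.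
Variables (W N : nat).
Notation S := (csize n C).
Notation L := (up_log 2 S).
Notation d := (depth C).
Notation v := (lab n C).
Hypotheses (NW : 16 * N <= W) (DN : 8 * (d * L) <= N) (SW : 20 * S <= W).

(** All that the final check of a layer needs to know about the circuit. It depends on the coins but
    not on the input or the messages, hence can be prepared in advance. *)
Definition gate_coef i mul : F :=
  ((beta n C i (point n C coins i)).@[fun j => chal n C coins i j]
   * (mle (wiring F n C i mul)).@[fun j => chal n C coins i j])%R.

(** The interface between preprocessing and the online phase: [d + 1] label lengths, at most
    [4 * (d * L)] coins, the last point and two coefficients per layer. *)
Definition ready (s : store F) :=
  [/\ iv s 1 = n, iv s 2 = d, forall i, i <= d -> ia s 2 i = v i,
      forall j, j < coin_start n C d -> fa s 0 j = coins j
    & [/\ forall j, j < v d -> fa s 1 j = point n C coins d j,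
          forall i, i < d -> fa s 2 i = gate_coef i false,
          forall i, i < d -> fa s 3 i = gate_coef i true,
          heard s = 0 & log s = [::]]].

Lemma dL_bounds : [/\ 0 < L, 0 < d, d <= d * L, L <= d * L & L < S].
Proof.
have L0 := L_gt0 wfC; have d0 : 0 < d by case: wfC.
by split=> //; [rewrite leq_pmulr|rewrite leq_pmull|exact: (L_lt wfC)].
Qed.

Lemma W16' : 16 <= W.
Proof. by move: (S_ge2 wfC) SW; clear; lia. Qed.

Lemma nvars_le i : (nvars n C i).+1 <= 4 * L.
Proof.
by have := lab_le n C i; have := lab_le n C i.+1; have := L_gt0 wfC; rewrite /nvars; clear; lia.
Qed.

Lemma coin_startS i : coin_start n C i.+1 = coin_start n C i + (nvars n C i).+1.
Proof. by rewrite /coin_start big_ord_recr. Qed.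

Lemma coin_start_le i : i <= d -> coin_start n C i <= 4 * (d * L).
Proof.
move=> id; apply: (@leq_trans (i * (4 * L))); last first.
  by rewrite mulnCA leq_mul2l leq_mul2r id orbT.
rewrite -[i in i * _]card_ord -sum_nat_const; apply: leq_sum => j _; exact: nvars_le.
Qed.

Lemma coin_start_mono i j : i <= j -> coin_start n C i <= coin_start n C j.
Proof. exact: (@sum_ord_mono (fun k => (nvars n C k).+1)). Qed.

Section Online.
Variables (x : seq F) (msgs : nat -> F).
Hypothesis xn : size x <= n.
Notation E := (Env [:: n] x coins msgs).

Lemma evaluate_cmdP (s : store F) : ready s ->
  wp E W N evaluate_cmd s (fun t s' => [/\ t <= n * (60 * v d + 120) + 20,
    fv s' 0 = ((mle (layer_fun n C x d)).@[fun j => point n C coins d j])%R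
  & frame evaluate_cmd s s']).
Proof.
move=> [e1 e2 hl hc [hz _ _ _ _]].
have [b1 b2 b3 b4 b5] := dL_bounds.
have vdL := lab_le n C d.
suff H : wp E W N evaluate_cmd s (fun t s' => t <= n * (60 * v d + 120) + 20 /\
    fv s' 0 = ((mle (layer_fun n C x d)).@[fun j => point n C coins d j])%R).
  by apply: wp_mono (wp_frame H) => t s' [[]].
have nS : n <= S by rewrite csizeE leq_addl.
rewrite /evaluate_cmd; step; step; step; name_state s1.
have c43 : iv s1 43 = v d by rewrite /s1; simp; rewrite e2 hl.
have [c1 c44 c0 cz] : [/\ iv s1 1 = n, iv s1 44 = 0, fv s1 0 = 0%R & fa s1 1 = fa s 1] by [].
clearbody s1.
apply: wp_mono (wp_for (I := fun k s' => fv s' 0 =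
    (\sum_(a < k) lval C x d a * chi (v d) a (point n C coins d))%R)
   (B := fun=> 60 * v d + 100) _ _ _) => //=.
- move=> t s'; rewrite c1 sum_nat_const card_ord => -[h1 h2 _]; split; first lia.
  rewrite h2 mle_eval /mlx; pose G a := (lval C x d a * chi (v d) a (point n C coins d))%R.
  (* The table of the input is padded with zeros up to a power of two, so the sum can stop after [n]
     terms. *)
  have nv : n <= 2 ^ v d by have := width_lab n C d; rewrite /width ltnn.
  rewrite -(big_mkord xpredT G) -[RHS](big_mkord xpredT G) [RHS](@big_cat_nat _ _ _ n) //=.
  rewrite [X in (_ + X)%R]big_nat [X in (_ + X)%R]big1 ?addr0 // => a /andP[na _].
  by rewrite /G (lval_default xn) ?mul0r // /width ltnn.
- by rewrite c0 big_ord0.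
move=> a s'; rewrite c1 => an h f.
have [g43 g44] : iv s' 43 = v d /\ iv s' 44 = 0 by frames; split.
have gz : fa s' 1 = fa s 1 by frames.
step; name_state s2.
have [k42 k43 k44 k13] : [/\ iv s2 42 = a, iv s2 43 = v d, iv s2 44 = 0 & iv s2 13 = a] by [].
have [k0 k1] : fv s2 0 = fv s' 0 /\ fa s2 1 = fa s 1 by [].
clearbody s2.
have [aW vN] : a <= W /\ 0 + v d <= N by lia.
rewrite -k44 in vN.
apply: wp_seq; apply: wp_mono (@chi_progP _ E W N NW W16' 13 1 s2 (v d) a k42 k43 aW vN) => t s3 [h1 h2 f3].
last_step; split; first lia.
have -> : fv s3 0 = fv s' 0 by frame_step.
have -> : iv s3 13 = a by frame_step.
rewrite h2 h big_ord_recr /= lval_input //; congr (_ + _ * _)%R.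
by apply: eq_chi => j jv; rewrite k44 k1 add0n hz.
Qed.

Lemma reject_unlessP e (s : store F) : fsafe E W N e s ->
  wp E W N (reject_unless e) s (fun t s' => [/\ t <= fcost e + 4,
    iv s' 0 = (if feval E e s == 0%R then iv s 0 else 0)
  & frame (reject_unless e) s s']).
Proof.
move=> sf; suff H : wp E W N (reject_unless e) s (fun t s' => t <= fcost e + 4 /\
    iv s' 0 = (if feval E e s == 0%R then iv s 0 else 0)).
  by apply: wp_mono (wp_frame H) => t s' [[]].
split=> //; case: ifP => e0; first by apply: wp_skip; rewrite e0; split=> //; lia.
by split=> //=; rewrite e0; split=> //; rewrite leq_add2l.
Qed.

Lemma horner_poly3 (g : nat -> F) (r : F) :
  (\poly_(k < 3) g k).[r]%R = (g 0 + r * (g 1 + r * g 2))%R.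
Proof. by rewrite horner_poly !big_ord_recr big_ord0 /=; ring. Qed.

Lemma round_progP (s : store F) p h (q := (\poly_(k < 3) msgs (h + k))%R) :
  iv s 8 = p -> p < N -> heard s = h ->
  wp E W N round_prog s (fun t s' => [/\ t <= 60,
    [/\ iv s' 0 = (if (q.[0] + q.[1] == fv s 10)%R then iv s 0 else 0),
        iv s' 8 = p.+1 & fv s' 10 = (q.[fa s 0 p])%R],
    heard s' = h + 3,
    log s' = log s ++ [:: (false, msgs (h + 0)); (false, msgs (h + 1));
                          (false, msgs (h + 2)); (true, fa s 0 p)]
  & frame round_prog s s']).
Proof.
move=> e8 pN eh.
suff H : wp E W N round_prog s (fun t s' => [/\ t <= 60,
    [/\ iv s' 0 = (if (q.[0] + q.[1] == fv s 10)%R then iv s 0 else 0),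
        iv s' 8 = p.+1 & fv s' 10 = (q.[fa s 0 p])%R],
    heard s' = h + 3 &
    log s' = log s ++ [:: (false, msgs (h + 0)); (false, msgs (h + 1));
                          (false, msgs (h + 2)); (true, fa s 0 p)]]).
  by apply: wp_mono (wp_frame H) => t s' [[]].
rewrite /round_prog; io_step; io_step; io_step; name_state s1.
have [k0 k8 k10 k11] : [/\ iv s1 0 = iv s 0, iv s1 8 = p, fv s1 10 = fv s 10 & fv s1 11 = msgs (h + 0)].
  by rewrite /s1; simp; rewrite -eh addn0.
have [k12 k13 kf] : [/\ fv s1 12 = msgs (h + 1), fv s1 13 = msgs (h + 2) & fa s1 0 = fa s 0].
  by rewrite /s1; simp; rewrite -eh addn1 addn2.
have kl : log s1 = log s ++ [:: (false, msgs (h + 0)); (false, msgs (h + 1)); (false, msgs (h + 2))].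
  by rewrite /s1 /= eh -!cats1 -!catA /= addn0 addn1 addn2.
have kh : heard s1 = h + 3 by rewrite /s1 /= eh addn3.
clearbody s1; apply: wp_seq; apply: wp_mono (reject_unlessP _) => // t s2 [ht h0 f2].
have [g8 gf] : iv s2 8 = p /\ fa s2 0 = fa s 0 by split; frame_step.
have [g11 [g12 g13]] : fv s2 11 = msgs (h + 0) /\ fv s2 12 = msgs (h + 1) /\ fv s2 13 = msgs (h + 2).
  by split; [|split]; frame_step.
have [gl gh] : log s2 = log s1 /\ heard s2 = heard s1 by split; frame_step.
rewrite /= in ht; rewrite /= k11 k12 k13 k10 k0 in h0.
clear k0 k8 k10 k11 k12 k13 kf f2.
have W16 := W16'.
step; step; step; last_step; rewrite g8 gf g11 g12 g13 gh gl kh kl; split=> //; first by lia.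
  split=> //; last by rewrite horner_poly3.
    rewrite h0 /q !horner_poly3 mul0r addr0 -[in RHS]subr_eq0.
    by congr (if (_ == _)%R then _ else _); ring.
  by rewrite addn1.
by rewrite -cats1 -catA.
Qed.

Lemma sum_polyE k (g : nat -> F) (r : F) :
  (\poly_(j < k) g j).[r]%R = (\sum_(j < k) g j * r ^+ j)%R.
Proof. exact: horner_poly. Qed.

Lemma line_read_progP (s : store F) u h (q := (\poly_(k < u.+1) msgs (h + k))%R) :
  iv s 5 = u -> u < W -> heard s = h ->
  wp E W N line_read_prog s (fun t s' => [/\ t <= 60 * u + 100,
    [/\ fv s' 19 = (q.[0])%R, fv s' 16 = (q.[1])%R & fv s' 15 = (q.[fv s 17])%R],
    heard s' = h + u.+1,
    log s' = log s ++ [seq (false, msgs (h + k)) | k <- iota 0 u.+1]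
  & frame line_read_prog s s']).
Proof.
move=> e5 uW eh.
suff H : wp E W N line_read_prog s (fun t s' => [/\ t <= 60 * u + 100,
    [/\ fv s' 19 = (q.[0])%R, fv s' 16 = (q.[1])%R & fv s' 15 = (q.[fv s 17])%R],
    heard s' = h + u.+1 &
    log s' = log s ++ [seq (false, msgs (h + k)) | k <- iota 0 u.+1]]).
  by apply: wp_mono (wp_frame H) => t s' [[]].
have W16 := W16'.
rewrite /line_read_prog; step; step; step; name_state s1.
have [k15 k16 k18] : [/\ fv s1 15 = 0%R, fv s1 16 = 0%R & fv s1 18 = 1%R] by [].
have [k5 k17 kh kl] : [/\ iv s1 5 = u, fv s1 17 = fv s 17, heard s1 = h & log s1 = log s] by [].
clearbody s1; pose r := fv s 17; pose c k := msgs (h + k).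
refine (wp_mono _ (wp_for (I := fun k s' =>
   [/\ fv s' 18 = r ^+ k, fv s' 16 = \sum_(j < k) c j, fv s' 15 = \sum_(j < k) c j * r ^+ j,
       heard s' = (h + k)%N & (0 < k)%N -> fv s' 19 = c 0%N]%R /\
   log s' = log s ++ [seq (false, msgs (h + k)) | k <- iota 0 k])
   (B := fun=> 50) _ _ _)).
- move=> t s' /=; rewrite k5 sum_nat_const card_ord => -[h1 [[h18 h16 h15 hh h19] hl] _].
  rewrite h16 h15 hh hl h19 //; last by rewrite addn1.
  rewrite addn1; split=> //; first lia.
  split; rewrite /q sum_polyE //.
    by rewrite big_ord_recl expr0 mulr1 big1 ?addr0 // => j _; rewrite exprS mul0r mulr0.
  by apply: eq_bigr => j _; rewrite expr1n mulr1.
- by bounds.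
- by rewrite k18 k16 k15 kh kl !big_ord0 cats0 addn0.
move=> k s'; rewrite -[ieval _ _ s1]/(iv s1 5 + 1) k5 => ku [[h18 h16 h15 hh h19] hl] f.
have h17 : fv s' 17 = r by frame_step.
io_step; name_state s2.
have [g13 g14 g17] : [/\ iv s2 13 = k, fv s2 14 = c k & fv s2 17 = r].
  by rewrite /s2; simp; rewrite hh.
have [g15 g16 g18 g19] : [/\ fv s2 15 = fv s' 15, fv s2 16 = fv s' 16, fv s2 18 = fv s' 18 & fv s2 19 = fv s' 19] by [].
have [gh gl] : heard s2 = (h + k).+1 /\ log s2 = log s ++ [seq (false, msgs (h + k)) | k <- iota 0 k.+1].
  split; first by rewrite /s2 /= hh.
  rewrite -[log s2]/(rcons (log s') (false, msgs (heard s'))) hh hl.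
  by rewrite -[in RHS](addn1 k) iotaD map_cat catA cats1.
clearbody s2; rewrite -g18 in h18; rewrite -g16 in h16; rewrite -g15 in h15; rewrite -g19 in h19.
clear g15 g16 g18 g19 hh hl f.
apply: wp_seq; split=> //; rewrite -[ieval _ _ s2]/(iv s2 13) g13.
case: eqP => k0; [last_step|apply: wp_skip]; (step; step; last_step; rewrite h18 h16 h15 ?g17 g14 gh gl;
  split; [by lia|split; [split; rewrite ?exprSr ?big_ord_recr ?addnS //|by []]]).
- by move=> _; rewrite k0.
- by move=> _; rewrite h19 // lt0n; apply/eqP.
Qed.

Notation acc := (layer_accepts n C coins msgs).
Notation conv i := (swap_view (layer_conversation n C coins msgs i)).
Notation cs := (coin_start n C).
Notation ms := (msg_start n C).
Notation m := (nvars n C).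

Lemma msg_startS i : ms i.+1 = ms i + 3 * m i + 2 + (v i.+1).+1.
Proof. by rewrite /msg_start big_ord_recr /= -!addnA. Qed.

Lemma round_acceptsS i k : all (fun j => (round_msg n C msgs i j).[0] + (round_msg n C msgs i j).[1]
    == round_claim n C coins msgs i j)%R (iota 0 k.+1)
  = all (fun j => (round_msg n C msgs i j).[0] + (round_msg n C msgs i j).[1]
    == round_claim n C coins msgs i j)%R (iota 0 k)
  && ((round_msg n C msgs i k).[0] + (round_msg n C msgs i k).[1] == round_claim n C coins msgs i k)%R.
Proof. exact: all_iotaS. Qed.

Lemma swap_cat (a b : seq (bool * F)) : swap_view (a ++ b) = swap_view a ++ swap_view b.
Proof. exact: map_cat. Qed.

Lemma swap_logs (f : nat -> seq (bool * F)) k :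
  swap_view (logs f k) = logs (fun i => swap_view (f i)) k.
Proof. by elim: k => // k IH; rewrite !logsS swap_cat IH. Qed.

Lemma interact_layer_progP (s : store F) i (b : bool) : i < d -> iv s 3 = i ->
  (forall k, k <= d -> ia s 2 k = v k) ->
  (forall j, j < cs d -> fa s 0 j = coins j) ->
  fa s 2 i = gate_coef i false -> fa s 3 i = gate_coef i true ->
  [/\ iv s 0 = b, iv s 8 = cs i, fv s 10 = claim n C coins msgs i & heard s = ms i] ->
  wp E W N interact_layer_prog s (fun t s' => [/\ t <= 600 * L,
    [/\ iv s' 0 = b && acc i, iv s' 8 = cs i.+1, fv s' 10 = claim n C coins msgs i.+1
       & heard s' = ms i.+1]
  & log s' = log s ++ conv i]).
Proof.
move=> id e3 hlab hcoin hA hB [e0 e8 e10 eh].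
have [b1 b2 b3 b4 b5] := dL_bounds; have w16 := W16'.
have [l0 l1] := (lab_le n C i, lab_le n C i.+1).
have csi : cs i + (m i).+1 <= cs d by rewrite -coin_startS; apply: coin_start_mono.
have csd := coin_start_le (leqnn d).
rewrite /interact_layer_prog; step; step; name_state s1.
have [k0 k3 k4 k5] : [/\ iv s1 0 = b, iv s1 3 = i, iv s1 4 = v i & iv s1 5 = v i.+1].
  by rewrite /s1; simp; rewrite e3 addn1 !hlab // ltnW.
have [k8 k10 kh] : [/\ iv s1 8 = cs i, fv s1 10 = claim n C coins msgs i & heard s1 = ms i] by [].
have [kf kl] : fa s1 = fa s /\ log s1 = log s by [].
clearbody s1; apply: wp_seq.
have eE : ieval E ($4 +$ ($5 +$ $5)) s1 = m i by rewrite /= k4 k5.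
pose rounds_ok j := all (fun j => (round_msg n C msgs i j).[0] + (round_msg n C msgs i j).[1]
      == round_claim n C coins msgs i j)%R (iota 0 j).
pose rlog j := swap_view ([seq (true, msgs (ms i + 3 * j + k)) | k <- iota 0 3]
  ++ [:: (false, chal n C coins i j)]).
pose I j (s' : store F) := [/\ iv s' 0 = b && rounds_ok j, iv s' 8 = cs i + j,
  fv s' 10 = round_claim n C coins msgs i j, heard s' = ms i + 3 * j
  & log s' = log s ++ logs rlog j].
have chalE j : j <= m i -> fa s 0 (cs i + j) = chal n C coins i j.
  by move=> jm; rewrite hcoin //; lia.
have mL := nvars_le i.
have Hfor : wp E W N (For 13 ($4 +$ ($5 +$ $5)) round_prog) s1
  (fun t s' => [/\ t <= 66 * m i + 20, I (m i) s' & frame (For 13 ($4 +$ ($5 +$ $5)) round_prog) s1 s']).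
  apply: wp_mono (wp_for (I := I) (B := fun=> 60) _ _ _).
  - by move=> t s'; rewrite eE sum_nat_const card_ord /= => -[h1 h2 h3]; split=> //; lia.
  - by rewrite /= k4 k5; bounds.
  - by split; rewrite /I ?k0 ?k8 ?k10 ?kh ?kl ?logs0 ?cats0 ?addn0 ?muln0 ?addn0 // andbT.
  move=> j s'; rewrite eE => jm [h0 h8 h10 hh hl] f.
  have hf : fa s' 0 = fa s 0 by rewrite -kf; frame_step.
  have jN : cs i + j < N by lia.
  apply: wp_mono (@round_progP (seti s' 13 j) (cs i + j) (ms i + 3 * j) h8 jN hh).
  rewrite /= /upd /= hf chalE ?(ltnW jm) // h0 h10 hl => t s2 [h1 [g0 g8 g10] gh gl f2]; split=> //; split.
  - rewrite g0 /rounds_ok round_acceptsS andbA -/(round_msg n C msgs i j).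
    by case: (_ == _)%R; rewrite ?andbT ?andbF.
  - by rewrite g8 addnS.
  - by rewrite g10.
  - by rewrite gh; lia.
  by rewrite gl logsS catA.
apply: wp_mono Hfor => t1 s2 [ht1 [h0 h8 h10 hh hl] f2].
have [g3 g5] : iv s2 3 = i /\ iv s2 5 = v i.+1 by split; frame_step.
have gf j : fa s2 j = fa s j by rewrite -kf; frame_step.
clear f2.
io_step; io_step; name_state s3.
have [n3 n5 n8 n0] : [/\ iv s3 3 = i, iv s3 5 = v i.+1, iv s3 8 = cs i + m i & iv s3 0 = b && rounds_ok (m i)] by [].
have n10 : fv s3 10 = round_claim n C coins msgs i (m i) by [].
have nf j : fa s3 j = fa s j by exact: gf.
have [n11 n12] : fv s3 11 = claim1 n C msgs i /\ fv s3 12 = claim2 n C msgs i.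
  by rewrite /s3; simp; rewrite hh /claim1 /claim2 addn1.
have nh : heard s3 = ms i + 3 * m i + 2 by rewrite /s3 /= hh addn2.
have nl : log s3 = log s ++ logs rlog (m i) ++ [:: (false, claim1 n C msgs i); (false, claim2 n C msgs i)].
  by rewrite /s3 /= hl hh -!cats1 -!catA /claim2 addn1.
clearbody s3; clear h0 h8 h10 hh hl g3 g5 gf s2.
apply: wp_seq; apply: wp_mono (reject_unlessP _); last by rewrite /= n3; bounds.
move=> t2 s4 [ht2 q0 f4]; rewrite /= n3 !nf hA hB n11 n12 n10 subr_eq0 eq_sym n0 in ht2 q0.
have [q5 q8] : iv s4 5 = v i.+1 /\ iv s4 8 = cs i + m i by split; frame_step.
have [q11 q12] : fv s4 11 = claim1 n C msgs i /\ fv s4 12 = claim2 n C msgs i by split; frame_step.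
have [qh ql] : heard s4 = heard s3 /\ log s4 = log s3 by split; frame_step.
have qf j : fa s4 j = fa s j by rewrite -nf; frame_step.
rewrite nh in qh; rewrite nl in ql.
clear f4 n0 n3 n5 n8 n10 nf n11 n12 nh nl s3.
step; step; rewrite ?q8; try lia; name_state s5.
have [r5 r8 r0] : [/\ iv s5 5 = v i.+1, iv s5 8 = cs i.+1 & iv s5 0 = iv s4 0].
  by rewrite /s5; simp; rewrite coin_startS addn1 addnS.
have [r11 r12 r17] : [/\ fv s5 11 = claim1 n C msgs i, fv s5 12 = claim2 n C msgs i & fv s5 17 = line_chal n C coins i].
  by rewrite /s5; simp; rewrite qf chalE.
have [rh rl] : heard s5 = heard s4 /\ log s5 = log s4 by [].
rewrite qh in rh; rewrite ql in rl; rewrite -r0 in q0.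
clearbody s5; clear r0 q5 q8 q11 q12 qf qh ql.
apply: wp_seq; have vW : v i.+1 < W by lia.
apply: wp_mono (line_read_progP r5 vW rh) => t3 s6 [ht3 [o19 o16 o15] oh ol f6].
have [o0 o8] : iv s6 0 = iv s5 0 /\ iv s6 8 = cs i.+1 by split; frame_step.
have [o11 o12 o17] : [/\ fv s6 11 = claim1 n C msgs i, fv s6 12 = claim2 n C msgs i & fv s6 17 = line_chal n C coins i].
  by split; frame_step.
rewrite rl in ol; rewrite q0 in o0; rewrite r17 in o15; clear q0 r5 r8 r11 r12 r17 rh rl f6.
apply: wp_seq; apply: wp_mono (reject_unlessP _) => // t4 s7 [ht4 p0 f7].
rewrite /= o19 o11 subr_eq0 o0 in ht4 p0.
have p8 : iv s7 8 = cs i.+1 by frame_step.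
have [p16 p15 p12 p17] : [/\ fv s7 16 = fv s6 16, fv s7 15 = fv s6 15, fv s7 12 = claim2 n C msgs i & fv s7 17 = line_chal n C coins i].
  by split; frame_step.
have [ph pl] : heard s7 = heard s6 /\ log s7 = log s6 by split; frame_step.
rewrite oh in ph; rewrite ol in pl; rewrite o16 in p16; rewrite o15 in p15.
clear f7 o0 o8 o11 o12 o17 o19 o16 o15 oh ol.
apply: wp_seq; apply: wp_mono (reject_unlessP _) => // t5 s8 [ht5 z0 f8].
rewrite /= p16 p12 subr_eq0 p0 in ht5 z0.
have z8 : iv s8 8 = cs i.+1 by frame_step.
have [z15 z17] : fv s8 15 = fv s7 15 /\ fv s8 17 = line_chal n C coins i by split; frame_step.
have [zh zl] : heard s8 = heard s7 /\ log s8 = log s7 by split; frame_step.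
rewrite ph in zh; rewrite pl in zl; rewrite p15 in z15.
clear f8 p0 p8 p16 p15 p12 p17 ph pl.
step; last_step; rewrite z0 z8 z15 z17 zh zl; split.
- rewrite /= in ht2; rewrite /= in ht4 ht5; lia.
- rewrite msg_startS; split=> //.
  rewrite /layer_accepts -/(rounds_ok _) -/(round_msg _ _ _ _ _).
  case: (b); case: (rounds_ok _) => /=; rewrite ?if_same //.
  (* The stored coefficients already contain [beta]; factoring it out recovers the check of the
     protocol. *)
  rewrite /gate_coef -!mulrA -mulrDr /line_msg.
  by do 3!case: (_ == _).
rewrite /layer_conversation -/(logs _ _) !swap_cat swap_logs -!catA -cats1 -!catA.
rewrite iotaD map_cat swap_cat -!catA /claim1 /claim2 -[in LHS](addn0 (_ + 3 * _)).
congr (_ ++ (_ ++ [:: _, _ & _ ++ _])); first by rewrite addn0.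
rewrite /swap_view (iotaDl 2 0) -!map_comp; apply: eq_map => k; by rewrite /= addn0 addnA.
Qed.

Lemma interact_cmdP (s : store F) : ready s ->
  fv s 0 = ((mle (layer_fun n C x d)).@[fun j => point n C coins d j])%R ->
  wp E W N interact_cmd s (fun t s' => [/\ t <= 700 * (d * L),
    log s' = swap_view (conversation n C coins msgs)
  & (iv s' 0 != 0) = accepts n C coins msgs x]).
Proof.
move=> [e1 e2 hlab hcoin [_ hA hB hh hl]] hV.
have [b1 b2 b3 b4 b5] := dL_bounds; have w16 := W16'.
rewrite /interact_cmd; step; step; io_step; name_state s1.
have [k0 k2 k8 k10] : [/\ iv s1 0 = 1, iv s1 2 = d, iv s1 8 = 0 & fv s1 10 = msgs 0].
  by rewrite /s1; simp; rewrite hh.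
have [k00 kh kl] : [/\ fv s1 0 = fv s 0, heard s1 = 1 & log s1 = [:: (false, msgs 0)]].
  by rewrite /s1; simp; rewrite hh hl.
have [kia kfa] : ia s1 = ia s /\ fa s1 = fa s by [].
clearbody s1; clear hh hl.
pose I i (s' : store F) := [/\ iv s' 0 = all acc (iota 0 i), iv s' 8 = cs i,
  fv s' 10 = claim n C coins msgs i, heard s' = ms i
  & log s' = (false, msgs 0) :: logs (fun i => conv i) i].
have Hfor : wp E W N (For 3 $2 interact_layer_prog) s1
  (fun t s' => [/\ t <= (600 * L + 6) * d + 20, I d s' & frame (For 3 $2 interact_layer_prog) s1 s']).
  apply: wp_mono (wp_for (I := I) (B := fun=> 600 * L) _ _ _) => //.
  - move=> t s'; rewrite [icost _]/= -[ieval _ _ _]/(iv s1 2) k2 sum_nat_const card_ord => -[h1 h2 h3].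
    by split=> //; lia.
  - split; rewrite ?k0 ?k8 ?k10 ?kh ?kl ?logs0 //; first by rewrite /coin_start big_ord0.
    by rewrite /msg_start big_ord0.
  move=> i s'; rewrite -[ieval _ _ _]/(iv s1 2) k2 => id [h0 h8 h10 hh hl] f.
  have [gia gfa] : ia s' 2 = ia s 2 /\ forall j, fa s' j = fa s j.
    by rewrite -kia -kfa; split=> [|j]; frame_step.
  apply: wp_mono (@interact_layer_progP (seti s' 3 i) i (all acc (iota 0 i)) id _ _ _ _ _ _) => //=.
  - move=> t s2; rewrite hl => -[ht [q0 q8 q10 qh] ql]; split=> //; split=> //.
      by rewrite q0 all_iotaS.
    by rewrite ql logsS.
  - by rewrite gia.
  - by rewrite gfa.
  - by rewrite gfa hA.
  by rewrite gfa hB.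
apply: wp_seq; apply: wp_mono Hfor => t s2 [ht [h0 h8 h10 hh hl] f2].
have g0 : fv s2 0 = fv s 0 by rewrite -k00; frame_step.
have gl : log s2 = swap_view (conversation n C coins msgs).
  by rewrite hl /conversation -/(logs _ _) /= swap_logs.
clear hl f2; apply: wp_mono (reject_unlessP _) => // t2 s3 [ht2 q0 f3].
rewrite /= h10 g0 hV subr_eq0 h0 in ht2 q0; split.
- by rewrite /=; lia.
- by frame_step.
by rewrite q0 /accepts andbC; case: (claim _ _ _ _ _ == _)%R; case: (all _ _).
Qed.

End Online.
End Verifier.

(** * The preprocessing phase *)

(** [frame_step] decides what a program leaves alone by computing its effects, which is impossible
    around the abstract fetching program [gp]. Replacing [gp] by [get_mods], whose effects cover
    those of [gp], makes the lists compute. *)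
Definition covers c c' :=
  [/\ {subset ivars c <= ivars c'}, {subset fvars c <= fvars c'},
      {subset iarrs c <= iarrs c'}, {subset farrs c <= farrs c'}
    & (draws c -> draws c') /\ (talks c -> talks c')].

Lemma frame_covers (F : fieldType) c c' (s s' : store F) :
  covers c c' -> frame c s s' -> frame c' s s'.
Proof. by case=> ? ? ? ? [? ?]; apply: frame_sub. Qed.

Lemma covers_refl c : covers c c.
Proof. by split. Qed.

Lemma covers_then a a' b b' : covers a a' -> covers b b' -> covers (a;; b) (a';; b').
Proof.
move=> [a1 a2 a3 a4 [a5 a6]] [b1 b2 b3 b4 [b5 b6]]; split=> [r|r|r|r|] /=; last first.
  by split=> /orP[]; [move/a5->|move/b5->|move/a6->|move/b6->]; rewrite ?orbT.
all: rewrite !mem_cat => /orP[].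
- by move/a4->.
- by move/b4->; rewrite orbT.
- by move/a3->.
- by move/b3->; rewrite orbT.
- by move/a2->.
- by move/b2->; rewrite orbT.
- by move/a1->.
- by move/b1->; rewrite orbT.
Qed.

Lemma covers_for r e a a' : covers a a' -> covers (For r e a) (For r e a').
Proof.
move=> [a1 a2 a3 a4 a5]; split=> // q; rewrite /= !inE => /orP[->//|/a1->]; exact: orbT.
Qed.

Lemma covers_tame c : tame c -> covers c get_mods.
Proof.
case=> t1 t2 t3 t4 /andP[/andP[t5 t6] _]; split=> //; rewrite ?t2 ?t4 //.
by rewrite (negbTE t5) (negbTE t6).
Qed.

Section Programs.
Variable gp : cmd.

(** Three fetches give the kind of the gate and its inputs. Its term of a wiring extension is a
    product of three Lagrange basis values and goes to register 11 for an addition, 12 for a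
    multiplication. *)
Definition gate_prog : cmd :=
  14 :=$ #2 +$ $2 +$ #3 *$ ($9 +$ $13);;
  28 :=$ $14;; gp;; 15 :=$ $26;;
  28 :=$ $14 +$ #1;; gp;; 16 :=$ $26;;
  28 :=$ $14 +$ #2;; gp;; 17 :=$ $26;;
  42 :=$ $13;; 43 :=$ $4;; 44 :=$ $8;; chi_prog 13 0;;
  42 :=$ $16;; 43 :=$ $5;; 44 :=$ $8 +$ $4;; chi_prog 14 0;;
  42 :=$ $17;; 44 :=$ $8 +$ $4 +$ $5;; chi_prog 15 0;;
  CaseI $15 (11 :=! !11 +^ !13 *^ (!14 *^ !15)) (12 :=! !12 +^ !13 *^ (!14 *^ !15)).

Definition draw_prog : cmd :=
  For 12 ($4 +$ ($5 +$ $5) +$ #1) (Rand 10;; 0:[$8 +$ $12] :=! !10).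

Definition beta_prog : cmd :=
  16 :=! FCst true;;
  For 12 $4 (16 :=! !16 *^ (1![$12] *^ 0![$8 +$ $12]
     +^ (FCst true -^ 1![$12]) *^ (FCst true -^ 0![$8 +$ $12]))).

Definition next_point_prog : cmd :=
  17 :=! 0![$8 +$ ($4 +$ ($5 +$ $5))];;
  For 12 $5 (1:[$12] :=! (FCst true -^ !17) *^ 0![$8 +$ $4 +$ $12] +^ !17 *^ 0![$8 +$ ($4 +$ $5) +$ $12]).

Definition pre_layer : cmd :=
  4 :=$ 2$[$3];; 5 :=$ 2$[$3 +$ #1];;
  draw_prog;;
  28 :=$ $3 +$ #1;; gp;; 6 :=$ $26;;
  11 :=! FCst false;; 12 :=! FCst false;;
  For 13 $6 gate_prog;;
  beta_prog;;
  2:[$3] :=! !16 *^ !11;; 3:[$3] :=! !16 *^ !12;;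
  next_point_prog;;
  8 :=$ $8 +$ ($4 +$ ($5 +$ $5)) +$ #1;; 9 :=$ $9 +$ $6.

Definition lab_loop : cmd :=
  For 3 ($2 +$ #1) (28 :=$ $3 +$ #1;; gp;; 42 :=$ $26;; lab_prog;; 2:[$3] :=$ $40).

Definition pre_cmd : cmd :=
  1 :=$ IInp #0;; 28 :=$ #0;; gp;; 2 :=$ $26;;
  lab_loop;;
  8 :=$ #0;; 9 :=$ #0;;
  For 3 $2 pre_layer.

End Programs.

Section Preprocess.
Variables (F : fieldType) (n : nat) (C : circuit) (coins : nat -> F).
Hypothesis wfC : wf_circuit n C.
Variables (W N TG : nat) (ds : seq nat) (gp : cmd).
Notation S := (csize n C).
Notation L := (up_log 2 S).
Notation d := (depth C).
Notation v := (lab n C).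
Notation cs := (coin_start n C).
Notation m := (nvars n C).
Hypotheses (NW : 16 * N <= W) (DN : 8 * (d * L) <= N) (SW : 20 * S <= W).
Hypothesis dsE : ds = description n C.
Notation E := (Env [:: n] [::] coins (fun=> 0%R)).
Hypothesis gp_tame : tame gp.
Hypothesis gpP : forall s : store F, iv s 1 = n -> iv s 28 < size ds ->
  wp E W N gp s (fun t s' => [/\ t <= TG, iv s' 26 = nth 0 ds (iv s 28) & frame get_mods s s']).

Lemma ds_bounds : [/\ d.+2 + 3 * off n C d = size ds, d < S, n <= S,
  off n C d <= S & forall k, nth 0 ds k <= S].
Proof.
split; first by rewrite dsE size_description.
- exact: depth_lt.
- by rewrite csizeE leq_addl.
- by rewrite csizeE leq_addr.
by move=> k; rewrite dsE; apply: nth_description_le.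
Qed.

Lemma fetchP (s : store F) e (Q : nat -> store F -> Prop) c : isafe E W N e s -> iv s 1 = n ->
  ieval E e s < size ds ->
  (forall t s', t <= TG -> iv s' 26 = nth 0 ds (ieval E e s) -> frame get_mods (seti s 28 (ieval E e s)) s' ->
     wp E W N c s' (fun t' => Q (icost e + 2 + (t + t')))) ->
  wp E W N (28 :=$ e;; gp;; c) s Q.
Proof.
move=> sf e1 h H; apply: wp_seq; split=> //; apply: wp_seq.
by apply: wp_mono (gpP _ _) => //= t s' [h1 h2 h3]; apply: H.
Qed.

Section Layer.
Variable i : nat.
Hypothesis id : i < d.
Notation w := (width n C i).
Let iC : i < depth C := id.
Notation y k := (chal n C coins i k).

Definition lstatic (s : store F) :=
  [/\ iv s 1 = n, iv s 2 = d, iv s 4 = v i, iv s 5 = v i.+1 & iv s 8 = cs i] /\ iv s 9 = off n C i.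

Definition lcoins (s : store F) := forall k, k < cs i.+1 -> fa s 0 k = coins k.

Lemma lstatic_frame c s s' : all (fun r => r \notin ivars c) [:: 1; 2; 4; 5; 8; 9] ->
  frame c s s' -> lstatic s -> lstatic s'.
Proof.
move=> /and5P[r1 r2 r4 r5 /and3P[r8 r9 _]] f [[h1 h2 h4 h5 h8] h9].
by split; [split|]; rewrite (frame_iv f).
Qed.

Lemma gate_progP (s : store F) a : a < w -> iv s 13 = a -> lstatic s -> lcoins s ->
  wp E W N (gate_prog gp) s (fun t s' => [/\ t <= 3 * TG + 500 * L,
    fv s' 11 = (if gmul C i a then fv s 11 else (fv s 11%N + wterm n C i a (chal n C coins i))%R) &
    fv s' 12 = (if gmul C i a then (fv s 12%N + wterm n C i a (chal n C coins i))%R else fv s 12)]).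
Proof.
move=> aw e13 [[e1 e2 e4 e5 e8] e9] hc.
have [b1 b2 b3 b4 b5] := dL_bounds wfC; have [c1 c2 c3 c4 c5] := ds_bounds.
have [l0 l1] := (lab_le n C i, lab_le n C i.+1).
have csi : cs i + (m i).+1 <= cs d by rewrite -coin_startS; apply: coin_start_mono.
have csd := coin_start_le wfC (leqnn d).
have oa : off n C i + a < off n C d by have := off_le n C id; rewrite offS; lia.
have w16 := W16' wfC SW.
have aW : a <= W by lia.
pose p := d.+2 + 3 * (off n C i + a).
have g j : j < 3 -> nth 0 ds (p + j) = nth 0 [:: nat_of_bool (gmul C i a); gfst C i a; gsnd C i a] j.
  by move=> j3; rewrite dsE nth_gate.
have pE : p + 2 < size ds by rewrite -c1 /p; lia.
have pW : p + 2 <= W by rewrite /p; lia.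
have mE : m i = v i + (v i.+1 + v i.+1) by [].
have [ga gb] : gfst C i a <= W /\ gsnd C i a <= W.
  have := g 1 isT; have := g 2 isT; move=> /= <- <-.
  by split; apply: leq_trans (c5 _) _; lia.
rewrite /gate_prog; step; rewrite ?e2 ?e9 ?e13; try lia; name_state s1.
have f1 : iv s1 14 = p by rewrite /s1; simp; rewrite /p; lia.
have h1 : lstatic s1 by [].
have k1 : [/\ iv s1 13 = a, fv s1 11 = fv s 11, fv s1 12 = fv s 12 & fa s1 0 = fa s 0] by [].
clearbody s1; clear e1 e2 e4 e5 e8 e9 e13.
have [[h11 _ _ _ _] _] := h1; have [h13 hf1 hg1 hF1] := k1; rewrite /p in pE pW.
apply: fetchP => //=; first by rewrite f1 /p; lia.
rewrite f1 -[in nth 0 ds p](addn0 p) g //= => t2 s2 ht2 q2 f2.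
have h2 : lstatic s2 by apply: lstatic_frame f2 _.
have k2 : [/\ iv s2 13 = a, fv s2 11 = fv s 11, fv s2 12 = fv s 12 & fa s2 0 = fa s 0].
  by rewrite -hf1 -hg1 -hF1; split; frame_step.
have n14 : iv s2 14 = p by frame_step.
clear f1 h1 k1 h11 h13 hf1 hg1 hF1 f2.
step; name_state s3.
have h3 : lstatic s3 by [].
have [k3 [n14' n15]] : [/\ iv s3 13 = a, fv s3 11 = fv s 11, fv s3 12 = fv s 12 & fa s3 0 = fa s 0] /\ 
  iv s3 14 = p /\ iv s3 15 = gmul C i a by [].
clearbody s3; clear h2 k2 q2 n14 s2.
have [[h11 _ _ _ _] _] := h3; have [h13 hf1 hg1 hF1] := k3.
apply: fetchP => //=; rewrite ?n14' -/p; try lia.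
rewrite g //= => t4 s4 ht4 q4 f4.
have h4 : lstatic s4 by apply: lstatic_frame f4 _.
have k4 : [/\ iv s4 13 = a, fv s4 11 = fv s 11, fv s4 12 = fv s 12 & fa s4 0 = fa s 0].
  by rewrite -hf1 -hg1 -hF1; split; frame_step.
have [o14 o15] : iv s4 14 = p /\ iv s4 15 = gmul C i a by split; frame_step.
clear h3 k3 n14' n15 h11 h13 hf1 hg1 hF1 f4.
step; name_state s5.
have h5 : lstatic s5 by [].
have [k5 [n14 n15 n16]] : [/\ iv s5 13 = a, fv s5 11 = fv s 11, fv s5 12 = fv s 12 & fa s5 0 = fa s 0] /\ 
  [/\ iv s5 14 = p, iv s5 15 = gmul C i a & iv s5 16 = gfst C i a] by [].
clearbody s5; clear h4 k4 q4 o14 o15 s4.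
have [[h11 _ _ _ _] _] := h5; have [h13 hf1 hg1 hF1] := k5.
apply: fetchP => //=; rewrite ?n14 -/p; try lia.
rewrite g //= => t6 s6 ht6 q6 f6.
have h6 : lstatic s6 by apply: lstatic_frame f6 _.
have k6 : [/\ iv s6 13 = a, fv s6 11 = fv s 11, fv s6 12 = fv s 12 & fa s6 0 = fa s 0].
  by rewrite -hf1 -hg1 -hF1; split; frame_step.
have [o15 o16] : iv s6 15 = gmul C i a /\ iv s6 16 = gfst C i a by split; frame_step.
clear h5 k5 n14 n15 n16 h11 h13 hf1 hg1 hF1 f6.
have [[r1 r2 r4 r5 r8] r9] := h6; have [r13 rf rg rF] := k6.
step; step; step; step; name_state s7.
have [h7 [t42 t43 t44]] : lstatic s7 /\ [/\ iv s7 42 = a, iv s7 43 = v i & iv s7 44 = cs i].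
  by rewrite /s7; simp; rewrite r13 r4 r8.
have [k7 [n15 n16 n17]] : [/\ iv s7 13 = a, fv s7 11 = fv s 11, fv s7 12 = fv s 12 & fa s7 0 = fa s 0] /\ 
  [/\ iv s7 15 = gmul C i a, iv s7 16 = gfst C i a & iv s7 17 = gsnd C i a] by [].
clearbody s7; clear h6 k6 o15 o16 q6 r1 r2 r4 r5 r8 r9 r13 rf rg rF s6.
have [[r1 r2 r4 r5 r8] r9] := h7; have [r13 rf rg rF] := k7.
have vN : iv s7 44 + v i <= N by lia.
apply: wp_seq; apply: wp_mono (@chi_progP _ E W N NW w16 13 0 s7 (v i) a t42 t43 aW vN) => t8 s8 [ht8 u13 f8].
rewrite t44 rF in u13.
have h8 : lstatic s8 by apply: lstatic_frame f8 _.
have k8 : [/\ fv s8 11 = fv s 11, fv s8 12 = fv s 12 & fa s8 0 = fa s 0].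
  by rewrite -rf -rg -rF; split; frame_step.
have [o15 o16 o17] : [/\ iv s8 15 = gmul C i a, iv s8 16 = gfst C i a & iv s8 17 = gsnd C i a].
  by split; frame_step.
clear vN h7 k7 f8 t42 t43 t44 n15 n16 n17 r1 r2 r4 r5 r8 r9 r13 rf rg rF s7.
have [[r1 r2 r4 r5 r8] r9] := h8; have [rf rg rF] := k8.
step; step; step; rewrite ?r8 ?r4; try lia; name_state s9.
have [h9 [t42 t43 t44]] : lstatic s9 /\ [/\ iv s9 42 = gfst C i a, iv s9 43 = v i.+1 & iv s9 44 = cs i + v i].
  by rewrite /s9; simp; rewrite o16 r5.
have [k9 n13 [n15 n17]] : [/\ [/\ fv s9 11 = fv s 11, fv s9 12 = fv s 12 & fa s9 0 = fa s 0],
  fv s9 13 = fv s8 13 & iv s9 15 = gmul C i a /\ iv s9 17 = gsnd C i a] by [].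
rewrite u13 in n13.
clearbody s9; clear h8 k8 o15 o16 o17 u13 r1 r2 r4 r5 r8 r9 rf rg rF s8.
have [[r1 r2 r4 r5 r8] r9] := h9; have [rf rg rF] := k9.
have vN : iv s9 44 + v i.+1 <= N by lia.
apply: wp_seq; apply: wp_mono (@chi_progP _ E W N NW w16 14 0 s9 (v i.+1) _ t42 t43 ga vN) => t10 s10 [ht10 u14 f10].
rewrite t44 rF in u14.
have h10 : lstatic s10 by apply: lstatic_frame f10 _.
have [k10 n43] : [/\ fv s10 11 = fv s 11, fv s10 12 = fv s 12 & fa s10 0 = fa s 0] /\ iv s10 43 = v i.+1.
  by rewrite -rf -rg -rF; split; [split|]; frame_step.
have [o15 o17 u13] : [/\ iv s10 15 = gmul C i a, iv s10 17 = gsnd C i a & fv s10 13 = fv s9 13].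
  by split; frame_step.
rewrite n13 in u13.
clear vN h9 k9 f10 t42 t43 t44 n13 n15 n17 r1 r2 r4 r5 r8 r9 rf rg rF s9.
have [[r1 r2 r4 r5 r8] r9] := h10; have [rf rg rF] := k10.
step; step; rewrite ?r8 ?r4 ?r5; try lia; name_state s11.
have [t42 t43 t44] : [/\ iv s11 42 = gsnd C i a, iv s11 43 = v i.+1 & iv s11 44 = cs i + v i + v i.+1].
  by rewrite /s11; simp; rewrite o17.
have [k11 n13 n14 n15] : [/\ [/\ fv s11 11 = fv s 11, fv s11 12 = fv s 12 & fa s11 0 = fa s 0],
  fv s11 13 = fv s10 13, fv s11 14 = fv s10 14 & iv s11 15 = gmul C i a] by [].
rewrite u13 in n13; rewrite u14 in n14.
clearbody s11; clear h10 k10 n43 o15 o17 u13 u14 r1 r2 r4 r5 r8 r9 rf rg rF s10.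
have [rf rg rF] := k11.
have vN : iv s11 44 + v i.+1 <= N by lia.
apply: wp_seq; apply: wp_mono (@chi_progP _ E W N NW w16 15 0 s11 (v i.+1) _ t42 t43 gb vN) => t12 s12 [ht12 u15 f12].
rewrite t44 rF in u15.
have z12 : [/\ fv s12 11 = fv s 11, fv s12 12 = fv s 12, fv s12 13 = fv s11 13 & fv s12 14 = fv s11 14].
  by rewrite -rf -rg; split; frame_step.
have z15 : iv s12 15 = gmul C i a by frame_step.
have [zf zg z13 z14] := z12; rewrite n13 in z13; rewrite n14 in z14.
have termE : (fv s12 13%N * (fv s12 14%N * fv s12 15%N))%R = wterm n C i a (chal n C coins i).
  rewrite wterm_split // z13 z14 u15; congr (_ * (_ * _))%R; apply: eq_chi => k kv;
    by rewrite hc ?coin_startS /chal; [congr coins; lia|lia].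
clear z12 z13 z14 u15 f12 vN k11 n13 n14 n15 t42 t43 t44.
split=> //; rewrite -[ieval _ _ _]/(iv s12 15) z15.
have tB : t2 + t4 + t6 + t8 + t10 + t12 <= 3 * TG + 60 * (3 * L) + 180 by lia.
case: (gmul C i a); last_step; (split; [lia|by rewrite ?termE ?zf ?zg..]).
Qed.

Lemma layer_bounds : [/\ m i + 1 <= 4 * L, v i <= L, v i.+1 <= L, cs i + (m i).+1 <= N & 4 * N <= W].
Proof.
have [b1 b2 b3 b4 b5] := dL_bounds wfC.
have csi : cs i + (m i).+1 <= cs d by rewrite -coin_startS; apply: coin_start_mono.
have csd := coin_start_le wfC (leqnn d).
have := nvars_le wfC i; have := lab_le n C i; have := lab_le n C i.+1.
by move=> h1 h2 h3; split; lia.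
Qed.

Lemma draw_progP (s : store F) : lstatic s -> drawn s = cs i ->
  (forall k, k < cs i -> fa s 0 k = coins k) ->
  wp E W N draw_prog s (fun t s' => [/\ t <= 100 * L, lcoins s', drawn s' = cs i.+1
    & frame draw_prog s s']).
Proof.
move=> [[e1 e2 e4 e5 e8] e9] hd hc; have [b1 b2 b3 b4 b5] := layer_bounds.
have w16 := W16' wfC SW.
have mE : m i = v i + (v i.+1 + v i.+1) by [].
have L0 := L_gt0 wfC.
have eE : ieval E ($4 +$ ($5 +$ $5) +$ #1) s = (m i).+1 by rewrite /= e4 e5 addn1.
apply: wp_mono (wp_for (I := fun j s' => drawn s' = cs i + j /\
   forall k, k < cs i + j -> fa s' 0 k = coins k) (B := fun=> 15) _ _ _).
- rewrite eE sum_nat_const card_ord => t s' [h1 [h2 h3] h4]; rewrite /lcoins coin_startS; split=> //.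
  by rewrite /= in h1; lia.
- by rewrite /= e4 e5; bounds.
- by rewrite addn0.
rewrite eE => j s' jm [h1 h2] f.
have g8 : iv s' 8 = cs i by frame_step.
io_step; last_step; rewrite g8; try lia.
split=> //; split; rewrite h1 ?addnS // => k kj; case: eqP => [->|kn] //; apply: h2; lia.
Qed.

Lemma beta_progP (s : store F) : lstatic s -> lcoins s ->
  (forall j, j < v i -> fa s 1 j = point n C coins i j) ->
  wp E W N beta_prog s (fun t s' => [/\ t <= 200 * L,
    fv s' 16 = ((beta n C i (point n C coins i)).@[fun j => chal n C coins i j])%R
    & frame beta_prog s s']).
Proof.
move=> [[e1 e2 e4 e5 e8] e9] hc hz; have [b1 b2 b3 b4 b5] := layer_bounds.
have w16 := W16' wfC SW.
have mE : m i = v i + (v i.+1 + v i.+1) by [].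
have L0 := L_gt0 wfC.
suff H : wp E W N beta_prog s (fun t s' => t <= 200 * L /\
    fv s' 16 = ((beta n C i (point n C coins i)).@[fun j => chal n C coins i j])%R).
  by apply: wp_mono (wp_frame H) => t s' [[]].
pose z := point n C coins i.
rewrite /beta_prog; step; name_state s1.
have [k4 k8 k0 k1 k16] : [/\ iv s1 4 = v i, iv s1 8 = cs i, fa s1 0 = fa s 0, fa s1 1 = fa s 1 & fv s1 16 = 1%R] by [].
clearbody s1.
apply: wp_mono (wp_for (I := fun k s' => fv s' 16 = (\prod_(j < k) (z j * y j + (1 - z j) * (1 - y j)))%R)
  (B := fun=> 80) _ _ _) => //=.
- rewrite k4 sum_nat_const card_ord => t s' [h1 h2 _]; split; first lia.
  rewrite h2 /beta rmorph_prod /=; apply: eq_bigr => j _.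
  by rewrite mevalD !mevalM !mevalC mevalXU mevalB meval1 mevalXU.
- by rewrite big_ord0 k16.
rewrite k4 => j s' jv h f.
have g8 : iv s' 8 = cs i by rewrite -k8; frame_step.
have [g0 g1] : fa s' 0 = fa s 0 /\ fa s' 1 = fa s 1 by rewrite -k0 -k1; split; frame_step.
last_step; rewrite ?g8; try lia.
split=> //; rewrite big_ord_recr /= -h g0 g1 hz // hc //.
by rewrite coin_startS; lia.
Qed.

Lemma next_point_progP (s : store F) : lstatic s -> lcoins s ->
  wp E W N next_point_prog s (fun t s' => [/\ t <= 200 * L,
    forall j, j < v i.+1 -> fa s' 1 j = point n C coins i.+1 j
    & frame next_point_prog s s']).
Proof.
move=> [[e1 e2 e4 e5 e8] e9] hc; have [b1 b2 b3 b4 b5] := layer_bounds.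
have w16 := W16' wfC SW.
have mE : m i = v i + (v i.+1 + v i.+1) by [].
have L0 := L_gt0 wfC.
suff H : wp E W N next_point_prog s (fun t s' => t <= 200 * L /\
    forall j, j < v i.+1 -> fa s' 1 j = point n C coins i.+1 j).
  by apply: wp_mono (wp_frame H) => t s' [[]].
rewrite /next_point_prog; step; rewrite ?e8 ?e4 ?e5; try lia; name_state s1.
have [k4 k5 k8 k0] : [/\ iv s1 4 = v i, iv s1 5 = v i.+1, iv s1 8 = cs i & fa s1 0 = fa s 0] by [].
have k17 : fv s1 17 = line_chal n C coins i.
  by rewrite /s1; simp; rewrite hc // coin_startS mE; lia.
clearbody s1.
apply: wp_mono (wp_for (I := fun k s' => forall j, j < k -> fa s' 1 j = point n C coins i.+1 j)
  (B := fun=> 80) _ _ _) => //=.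
- rewrite k5 sum_nat_const card_ord => t s' [h1 h2 _]; split=> //; lia.
rewrite k5 => j s' jv h f.
have [g4 g5 g8] : [/\ iv s' 4 = v i, iv s' 5 = v i.+1 & iv s' 8 = cs i].
  by rewrite -k8 -k5 -k4; split; frame_step.
have [g0 g17] : fa s' 0 = fa s 0 /\ fv s' 17 = line_chal n C coins i.
  by rewrite -k0 -k17; split; frame_step.
last_step; rewrite ?g8 ?g4 ?g5; try lia.
split=> // k kj; case: eqP => [->|kn]; last by apply: h; lia.
rewrite g0 g17 !hc ?coin_startS; try lia.
by rewrite /point horner_line /chal1 /chal2 /chal !addnA.
Qed.

(** By [mmap_wiring] both extensions are sums over gates, so one pass with two accumulators suffices
    and no part of the circuit is kept in memory. *)
Lemma gates_progP (s : store F) : iv s 6 = w -> lstatic s -> lcoins s ->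
  fv s 11 = 0%R -> fv s 12 = 0%R ->
  wp E W N (For 13 $6 (gate_prog gp)) s (fun t s' => [/\ t <= (3 * TG + 510 * L) * S + 10,
    fv s' 11 = ((mle (wiring F n C i false)).@[fun j => chal n C coins i j])%R,
    fv s' 12 = ((mle (wiring F n C i true)).@[fun j => chal n C coins i j])%R
  & frame (For 13 $6 (gate_prog get_mods)) s s']).
Proof.
move=> e6 hs hc e11 e12.
have L0 := L_gt0 wfC.
have cov : covers (For 13 $6 (gate_prog gp)) (For 13 $6 (gate_prog get_mods)).
  apply: covers_for; rewrite /gate_prog.
  by repeat (apply: covers_then); (apply: covers_tame || apply: covers_refl).
pose sum mul k := (\sum_(a < k | gmul C i a == mul) wterm n C i a (chal n C coins i))%R.
have sumS mul k : (sum mul k.+1 = if gmul C i k == mul then sum mul k + wterm n C i k (chal n C coins i)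
   else sum mul k)%R.
  by rewrite /sum big_mkcond big_ord_recr /= -big_mkcond; case: ifP => _; rewrite ?addr0.
have sumE mul : ((mle (wiring F n C i mul)).@[fun j => chal n C coins i j])%R = sum mul w.
  exact: (@mmap_wiring F n C i wfC id F idfun mul (chal n C coins i)).
apply: wp_mono (wp_for (I := fun k s' => fv s' 11 = sum false k /\ fv s' 12 = sum true k)
  (B := fun=> 3 * TG + 500 * L) _ _ _) => //.
- rewrite -[ieval _ _ _]/(iv s 6) e6 sum_nat_const card_ord [icost _]/= => t s' [h1 [h2 h3] h4].
  split; [|by rewrite sumE|by rewrite sumE|exact: frame_covers h4].
  apply: leq_trans h1 _; have wS := width_le n C i.
  have : w * (3 * TG + 500 * L + 6) <= S * (3 * TG + 510 * L) by apply: leq_mul; lia.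
  rewrite [X in _ -> _ <= X + _]mulnC; move: (w * _) (S * _) => q1 q2; lia.
- by rewrite e11 e12 /sum !big_ord0.
rewrite -[ieval _ _ _]/(iv s 6) e6 => a s' aw [h1 h2] /(frame_covers cov) f.
have hs' : lstatic (seti s' 13 a) by apply: (lstatic_frame _ f hs).
have hc' : lcoins (seti s' 13 a) by move=> k kc /=; rewrite -hc //; frame_step.
apply: wp_mono (gate_progP aw _ hs' hc') => // t s2 [ht q1 q2]; split=> //.
rewrite q1 q2 !sumS -h1 -h2.
by case: (gmul C i a).
Qed.

Lemma pre_layerP (s : store F) : iv s 3 = i -> lstatic (seti (seti s 4 (v i)) 5 (v i.+1)) ->
  drawn s = cs i -> (forall k, k < cs i -> fa s 0 k = coins k) ->
  (forall j, j < v i -> fa s 1 j = point n C coins i j) ->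
  (forall k, k <= d -> ia s 2 k = v k) ->
  wp E W N (pre_layer gp) s (fun t s' => [/\ t <= (4 * TG + 2000 * L) * S,
    [/\ iv s' 8 = cs i.+1, iv s' 9 = off n C i.+1, drawn s' = cs i.+1 & lcoins s'],
    forall j, j < v i.+1 -> fa s' 1 j = point n C coins i.+1 j,
    forall k, fa s' 2 k = if k == i then gate_coef n C coins i false else fa s 2 k
  & forall k, fa s' 3 k = if k == i then gate_coef n C coins i true else fa s 3 k]).
Proof.
move=> e3 hs hd hc hz hl; have [b1 b2 b3 b4 b5] := layer_bounds.
have w16 := W16' wfC SW; have L0 := L_gt0 wfC.
have [c1 c2 c3 c4 c5] := ds_bounds; have [d1 d2 d3 d4 d5] := dL_bounds wfC.
have [[e1 e2 _ _ e8] e9] := hs; simpl in e1, e2, e8, e9; rewrite /upd /= in e1 e2 e8 e9.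
have mE : m i = v i + (v i.+1 + v i.+1) by [].
rewrite /pre_layer; step; rewrite ?e3; try lia.
step; rewrite ?e3 ?addn1 ?hl; try lia.
name_state s1.
have h1 : lstatic s1 by rewrite /s1; split; [split|]; simp.
have [k3 kd] : iv s1 3 = i /\ drawn s1 = cs i by [].
have kf : fa s1 = fa s by [].
clearbody s1; clear hs hd e1 e2 e8 e9 e3.
rewrite -kf in hc.
apply: wp_seq; apply: wp_mono (draw_progP h1 kd hc) => t2 s2 [T2 c2' kd2 f2].
have h2 : lstatic s2 by apply: lstatic_frame f2 h1.
have g3 : iv s2 3 = i by frame_step.
have gf j : j != 0 -> fa s2 j = fa s j.
  by move=> j0; rewrite -kf; case: f2 => _ _ _ f _; apply: f; rewrite inE.
clear h1 k3 kd kf hc f2 s1.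
have [[e1 e2 e4 e5 e8] e9] := h2.
have iw : nth 0 ds i.+1 = w by rewrite dsE; apply: nth_width; lia.
apply: fetchP => //; first by rewrite /= g3; bounds.
  by rewrite /= g3; lia.
rewrite -[ieval _ _ _]/(iv s2 3 + 1) g3 addn1 iw => t3 s3 T3 q26 f3.
have h3 : lstatic s3 by apply: lstatic_frame f3 h2.
have [k3 kd] : iv s3 3 = i /\ drawn s3 = cs i.+1 by split; frame_step.
have kf j : fa s3 j = fa s2 j by case: f3 => _ _ _ f _; apply: f.
clear h2 g3 kd2 f3 e1 e2 e4 e5 e8 e9.
step; step; step; name_state s4.
have h4 : lstatic s4 by [].
have [g3 g6 gd] : [/\ iv s4 3 = i, iv s4 6 = w & drawn s4 = cs i.+1] by [].
have g11 : fv s4 11 = 0%R /\ fv s4 12 = 0%R by [].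
have gf4 j : fa s4 j = fa s2 j by exact: kf.
clearbody s4; case: g11 => g11 g12; clear h3 k3 kd kf q26 s3.
have lc4 : lcoins s4 by rewrite /lcoins gf4.
apply: wp_seq; apply: wp_mono (gates_progP g6 h4 lc4 g11 g12) => t5 s5 [T5 q11 q12 f5].
have h5 : lstatic s5 by apply: lstatic_frame f5 h4.
have [k3 k6 kd] : [/\ iv s5 3 = i, iv s5 6 = w & drawn s5 = cs i.+1] by split; frame_step.
have kf j : fa s5 j = fa s2 j by rewrite -gf4; case: f5 => _ _ _ f _; apply: f.
clear lc4 h4 g3 g6 gd g11 g12 gf4 f5 s4.
have lc5 : lcoins s5 by rewrite /lcoins kf.
have hz5 j : j < v i -> fa s5 1 j = point n C coins i j by move=> jv; rewrite kf gf // hz.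
apply: wp_seq; apply: wp_mono (beta_progP h5 lc5 hz5) => t6 s6 [T6 q16 f6].
have h6 : lstatic s6 by apply: lstatic_frame f6 h5.
have [g3 g6 gd] : [/\ iv s6 3 = i, iv s6 6 = w & drawn s6 = cs i.+1] by split; frame_step.
have [g11 g12] : fv s6 11 = fv s5 11 /\ fv s6 12 = fv s5 12 by split; frame_step.
have gf6 j : fa s6 j = fa s2 j by rewrite -kf; case: f6 => _ _ _ f _; apply: f.
rewrite q11 in g11; rewrite q12 in g12.
clear lc5 h5 hz5 k3 k6 kd q11 q12 kf f6 s5.
step; rewrite ?g3; try lia.
step; rewrite ?g3; try lia.
name_state s7.
have h7 : lstatic s7 by [].
have [k6 kd] : iv s7 6 = w /\ drawn s7 = cs i.+1 by [].
have kf0 : fa s7 0 = fa s2 0 by rewrite /s7; simp; rewrite gf6.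
have kf2 k : fa s7 2 k = if k == i then gate_coef n C coins i false else fa s 2 k.
  by rewrite /s7; simp; rewrite q16 g11 gf6 gf //.
have kf3 k : fa s7 3 k = if k == i then gate_coef n C coins i true else fa s 3 k.
  by rewrite /s7; simp; rewrite q16 g12 gf6 gf //.
clearbody s7; clear h6 g3 g6 gd g11 g12 gf6 q16 s6.
have lc7 : lcoins s7 by rewrite /lcoins kf0.
apply: wp_seq; apply: wp_mono (next_point_progP h7 lc7) => t8 s8 [T8 q8 f8].
have h8 : lstatic s8 by apply: lstatic_frame f8 h7.
have [g6 gd] : iv s8 6 = w /\ drawn s8 = cs i.+1 by split; frame_step.
have [g0 g2 g3] : [/\ fa s8 0 = fa s7 0, fa s8 2 = fa s7 2 & fa s8 3 = fa s7 3] by split; frame_step.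
clear h7 k6 kd f8.
have [[e1 e2 e4 e5 e8] e9] := h8.
have oN : off n C i + w <= S by apply: off_width; lia.
step; rewrite ?e8 ?e4 ?e5; try lia.
last_step; rewrite ?e8 ?e4 ?e5 ?e9 ?g6; try lia.
split=> //.
- have S2 := S_ge2 wfC.
  have : (TG + 600 * L) * 2 <= (TG + 600 * L) * S by rewrite leq_mul2l S2 orbT.
  rewrite -[X in X * S](addnK (3 * TG + 1400 * L)) => H; clear - T2 T3 T5 T6 T8 H L0 S2.
  have -> : (4 * TG + 2000 * L) * S = (3 * TG + 510 * L) * S + (TG + 600 * L) * S + (890 * L) * S by lia.
  have : L * 2 <= L * S by rewrite leq_mul2l S2 orbT.
  by rewrite addnK in H; lia.
- split=> //; first by rewrite coin_startS mE; lia.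
  + by rewrite offS.
  by rewrite /lcoins /= g0 kf0.
- by move=> k; rewrite g2 kf2.
by move=> k; rewrite g3 kf3.
Qed.

End Layer.
Lemma lab_loopP (s : store F) : iv s 1 = n -> iv s 2 = d ->
  wp E W N (lab_loop gp) s (fun t s' => [/\ t <= (TG + 110 * S) * S + 10,
    forall k, k <= d -> ia s' 2 k = v k & frame (lab_loop get_mods) s s']).
Proof.
move=> e1 e2; have w16 := W16' wfC SW.
have [c1 c2 c3 c4 c5] := ds_bounds; have [d1 d2 d3 d4 d5] := dL_bounds wfC.
have S2 := S_ge2 wfC.
have cov : covers (lab_loop gp) (lab_loop get_mods).
  apply: covers_for.
  by repeat (apply: covers_then); (apply: covers_tame || apply: covers_refl).
apply: wp_mono (wp_for (I := fun j s' => forall k, k < j -> ia s' 2 k = v k)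
   (B := fun=> TG + 50 * S + 50) _ _ _).
- rewrite -[ieval _ _ _]/(iv s 2 + 1) e2 sum_nat_const card_ord => t s' [h1 h2 h3].
  split; [|by move=> k kd; apply: h2; lia|exact: frame_covers h3].
  apply: leq_trans h1 _; rewrite [icost _]/=.
  have : (d + 1) * (TG + 50 * S + 50 + 6) <= S * (TG + 110 * S) by apply: leq_mul; lia.
  by move: (_ * (TG + 50 * S + 50 + 6)) => q; rewrite [S * (_ + _)]mulnC; move: (_ * S) => q'; lia.
- by rewrite /= e2; bounds.
- by [].
move=> k s'; rewrite -[ieval _ _ _]/(iv s 2 + 1) e2 => kd h /(frame_covers cov) f.
have g1 : iv s' 1 = n by frame_step.
have iw : nth 0 ds k.+1 = width n C k by rewrite dsE; apply: nth_width; lia.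
have wS := width_le n C k.
apply: fetchP => //; first by rewrite /= /upd /=; bounds.
  by rewrite /= /upd /=; lia.
rewrite -[ieval _ _ _]/(k + 1) addn1 iw => t1 s1 T1 q26 f1.
have [k1 k3] : iv s1 1 = n /\ iv s1 3 = k by split; frame_step.
have ka : ia s1 2 = ia s' 2 by frame_step.
step; name_state s2.
have [g42 g3 ga] : [/\ iv s2 42 = width n C k, iv s2 3 = k & ia s2 2 = ia s' 2] by [].
clearbody s2; clear f f1 k1 k3 ka.
have wW : 4 * width n C k <= W by lia.
apply: wp_seq; apply: wp_mono (lab_progP _ _ g42 wW w16) => t3 s3 [T3 q40 _ f3].
have [k3 ka] : iv s3 3 = k /\ ia s3 2 = ia s' 2 by split; frame_step.
last_step; rewrite ?k3; try lia.
split; first by lia.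
move=> j jk; rewrite q40; case: eqP => [->|jn] //; rewrite ka; apply: h; lia.
Qed.

(** There are fewer than [S] layers with at most [S] gates each, and a gate costs three fetches of
    time [TG] plus [O(log S)] field operations; one factor [S] for the layers and one for the gates
    is generous but polynomial. *)
Lemma pre_cmdP : wp E W N (pre_cmd gp) (store0 F) (fun t s' =>
  t <= (10 * TG + 4000 * S) * (S * S) /\ ready n C coins s').
Proof.
have w16 := W16' wfC SW.
have [c1 c2 c3 c4 c5] := ds_bounds; have [d1 d2 d3 d4 d5] := dL_bounds wfC.
have S2 := S_ge2 wfC.
rewrite /pre_cmd; step; name_state s1.
have k1 : iv s1 1 = n by [].
have [kd kh kl] : [/\ drawn s1 = 0, heard s1 = 0 & log s1 = [::]] by [].
clearbody s1.
apply: fetchP => //; first by rewrite /= -c1.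
move=> t2 s2 T2; rewrite [ieval _ _ _]/= => q26 f2.
have g1 : iv s2 1 = n by frame_step.
have [gd gh gl] : [/\ drawn s2 = 0, heard s2 = 0 & log s2 = [::]] by split; frame_step.
clear k1 kd kh kl f2; rewrite dsE nth_depth in q26.
step; name_state s3.
have [k1 k2] : iv s3 1 = n /\ iv s3 2 = d by [].
have [kd kh kl] : [/\ drawn s3 = 0, heard s3 = 0 & log s3 = [::]] by [].
clearbody s3; clear g1 gd gh gl q26 s2.
apply: wp_seq; apply: wp_mono (lab_loopP k1 k2) => t4 s4 [T4 lab4 f4].
have [g1 g2] : iv s4 1 = n /\ iv s4 2 = d by split; frame_step.
have [gd gh gl] : [/\ drawn s4 = 0, heard s4 = 0 & log s4 = [::]] by split; frame_step.
clear k1 k2 kd kh kl f4 s3.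
step; step; name_state s5.
have [k1 k2 k8 k9] : [/\ iv s5 1 = n, iv s5 2 = d, iv s5 8 = 0 & iv s5 9 = 0] by [].
have [kd kh kl] : [/\ drawn s5 = 0, heard s5 = 0 & log s5 = [::]] by [].
have lab5 k : k <= d -> ia s5 2 k = v k by exact: lab4.
clearbody s5; clear g1 g2 gd gh gl lab4 s4.
have cov : covers (For 3 $2 (pre_layer gp)) (For 3 $2 (pre_layer get_mods)).
  apply: covers_for; rewrite /pre_layer /gate_prog.
  repeat (apply: covers_then); try (apply: covers_tame; exact: gp_tame); try apply: covers_refl.
  apply: covers_for.
  by repeat (apply: covers_then); (apply: covers_tame || apply: covers_refl).
apply: wp_mono (wp_for (I := fun i s' =>
   [/\ iv s' 8 = cs i, iv s' 9 = off n C i, drawn s' = cs i & forall k, k < cs i -> fa s' 0 k = coins k] /\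
   [/\ forall j, j < v i -> fa s' 1 j = point n C coins i j,
      forall k, k < i -> fa s' 2 k = gate_coef n C coins k false
     & forall k, k < i -> fa s' 3 k = gate_coef n C coins k true])
   (B := fun=> (4 * TG + 2000 * L) * S) _ _ _) => //.
- rewrite -[ieval _ _ _]/(iv s5 2) k2 sum_nat_const card_ord => t s' [h1 [[h8 h9 hd hc] [hz hA hB]] f].
  have {}f := frame_covers cov f.
  split; last first.
    split; [by frame_step|by frame_step| |by []|split=> //].
    + by move=> k kd'; rewrite -lab5 //; frame_step.
    + by frame_step.
    by frame_step.
  rewrite /= in h1.
  clear - T2 T4 h1 c2 d1 d5 S2.
  have q1 : S <= S * S by rewrite leq_pmulr // ltnW.
  have q2 : d * ((4 * TG + 2000 * L) * S + 6) <= S * ((4 * TG + 2001 * S) * S + 6).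
    by apply: leq_mul; [lia|rewrite leq_add2r leq_mul2r; apply/orP; right; lia].
  have q3 : (TG + 110 * S) * S <= (TG + 110 * S) * (S * S) by rewrite leq_mul2l q1 orbT.
  have q4 : TG * 1 <= TG * (S * S) by rewrite leq_mul2l; apply/orP; right; lia.
  have -> : (10 * TG + 4000 * S) * (S * S) = (TG + 110 * S) * (S * S) + S * ((4 * TG + 2001 * S) * S) + (5 * TG + 1889 * S) * (S * S) by lia.
  have q5 : (5 * TG + 1889 * S) * (S * S) = 5 * (TG * (S * S)) + 1889 * (S * (S * S)) by lia.
  have q6 : S * 1 <= S * (S * S) by rewrite leq_mul2l; apply/orP; right; lia.
  rewrite [S * (_ + 6)]mulnDr in q2; rewrite q5.
  move: (TG * (S * S)) (S * (S * S)) ((TG + 110 * S) * (S * S)) (S * ((4 * TG + 2001 * S) * S)) ((TG + 110 * S) * S) q2 q3 q4 q6 h1 T4 => x1 x2 x3 x4 x5.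
  move: (d * _) => x6; lia.
- split; first by rewrite k8 k9 kd /coin_start /off !big_ord0.
  by split=> // j; rewrite (lab0 wfC).
move=> i s'; rewrite -[ieval _ _ _]/(iv s5 2) k2 => id [[h8 h9 hd hc] [hz hA hB]] /(frame_covers cov) f.
have [f1 f2] : iv s' 1 = n /\ iv s' 2 = d by split; frame_step.
have fl k : k <= d -> ia s' 2 k = v k by move=> kd'; rewrite -lab5 //; frame_step.
apply: wp_mono (@pre_layerP i id (seti s' 3 i) _ _ hd hc hz fl) => //.
  move=> t s6 [T6 [q8 q9 qd qc] qz qA qB]; split=> //; split=> //; split=> // k ki.
    by rewrite qA; case: eqP => [->|kn] //; apply: hA; lia.
  by rewrite qB; case: eqP => [->|kn] //; apply: hB; lia.
Qed.

End Preprocess.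

(** * The theorem *)

Lemma cwf_pre_cmd gp : cwf gp -> cwf (pre_cmd gp).
Proof. by move=> h; rewrite /= !h. Qed.

(** * Polynomial bounds in the circuit size *)

Section PowerBounds.
Variable S : nat.
Hypothesis S2 : 2 <= S.

Lemma pow_mono p q : p <= q -> S ^ p <= S ^ q.
Proof. by move=> pq; rewrite leq_exp2l. Qed.

(** Since [S >= 2], constants can be absorbed into the exponent, which lets one [K], chosen before
    [n], serve for the word size and for the preprocessing time. *)
Lemma pow_const c p : c <= 2 ^ p -> c <= S ^ p.
Proof.
move=> h; apply: leq_trans h _.
by case: p => // p; rewrite leq_exp2r.
Qed.

Lemma pow_any c : c <= S ^ c.
Proof. by apply/pow_const/ltnW/ltn_expl. Qed.

Lemma pow_mul a b p q : a <= S ^ p -> b <= S ^ q -> a * b <= S ^ (p + q).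
Proof. by move=> ha hb; rewrite expnD leq_mul. Qed.

Lemma pow_add a b p q : a <= S ^ p -> b <= S ^ q -> a + b <= S ^ (p + q).+1.
Proof.
move=> ha hb; rewrite expnS; apply: leq_trans (_ : 2 * S ^ (p + q) <= _); last by rewrite leq_mul2r S2 orbT.
have := pow_mono (leq_addr q p); have := pow_mono (leq_addl p q); lia.
Qed.

End PowerBounds.

Section Uniform.
Variables (M : tm) (K0 n : nat) (C : circuit) (T : nat) (cs : nat -> tm_config M).
Hypothesis wfC : wf_circuit n C.
Notation S := (csize n C).
Notation L := (up_log 2 S).
Notation nQ := #|tm_state M|.
Notation nG := #|tm_sym M|.
Hypotheses (cs0 : cs 0 = tm_init M)
  (csS : forall k, k < T -> tm_next n (cs k) = Some (cs k.+1))
  (csT : tm_next n (cs T) = None)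
  (cs_pos : forall k, k <= T -> tm_pos (cs k) < K0 * L)
  (csO : tm_out (cs T) = encode (description n C)).

Definition get_time := T.+2 * (5 * (nQ + nG) + 210) + 50.

(** An exponent depending on the machine and its space constant only, not on [n]. *)
Definition get_exp := 2 * nQ + nG + K0 + 2 * (nG * K0) + 30.

Lemma pow_L : 2 ^ L <= S ^ 2.
Proof.
have S2 := S_ge2 wfC.
have := up_log_gtn (isT : 1 < 2) S2; have := L_gt0 wfC.
case: L => // k _; rewrite expnS /= => h.
by rewrite expnS expn1; apply: leq_mul => //; apply: ltnW.
Qed.

(** The exponential factor in the number of configurations is harmless in logarithmic space:
    [nG ^ (K0 * L)] is at most [(2 ^ L) ^ (nG * K0)], and [2 ^ L <= S ^ 2]. *)
Lemma get_time_le : get_time <= S ^ get_exp.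
Proof.
have S2 := S_ge2 wfC.
have n1 : n.+1 <= S ^ 1.
  rewrite expn1 csizeE; suff : 0 < off n C (depth C) by lia.
  case: wfC => d0 w0 _ _; apply: leq_trans (off_le n C d0).
  by rewrite offS w0 leq_addl.
have sp : K0 * L <= S ^ (K0 + 1).
  by apply: pow_mul; [apply: pow_any|rewrite expn1; apply/ltnW/(L_lt wfC)].
have sy : nG ^ (K0 * L) <= S ^ (2 * (nG * K0)).
  apply: (@leq_trans ((2 ^ nG) ^ (K0 * L))).
    have [->|h] := posnP (K0 * L); first by rewrite !expn0.
    by rewrite leq_exp2r //; apply/ltnW/ltn_expl.
  rewrite -expnM mulnA mulnC expnM.
  apply: leq_trans (_ : (S ^ 2) ^ (nG * K0) <= _); last by rewrite -expnM.
  have [->|h] := posnP (nG * K0); first by rewrite !expn0.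
  by rewrite leq_exp2r // pow_L.
have h1 := pow_mul (pow_mul (pow_mul (pow_any S2 nQ) n1) sp) sy.
have h2 := run_time cs0 csS csT cs_pos.
have h3 := pow_add S2 (ltnW (leq_trans h2 h1)) (pow_const S2 (isT : 2 <= 2 ^ 1)).
have h4 := pow_add S2 (pow_mul (pow_const S2 (isT : 5 <= 2 ^ 3)) (pow_add S2 (pow_any S2 nQ) (pow_any S2 nG))) (pow_const S2 (isT : 210 <= 2 ^ 8)).
have h5 := pow_add S2 (pow_mul h3 h4) (pow_const S2 (isT : 50 <= 2 ^ 6)).
rewrite addn2 in h5; apply: leq_trans h5 _; apply: pow_mono => //.
rewrite /get_exp; move: nQ nG (nG * K0) => a b c; lia.
Qed.

End Uniform.

Lemma up_log_width n C : lab n C (depth C) = up_log 2 n.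
Proof. by rewrite /lab /width ltnn. Qed.

(** The four programs and the constant are chosen before the field and [n]. Evaluating the input is
    a separate program, to isolate the term [n log n]; its bound has [n.+1] under the logarithm
    because [up_log 2 1] is 0, while in the joint bound the term [d * up_log 2 S] absorbs that
    case. *)
Theorem theorem4 (C : nat -> circuit)
    (wfC : forall n, 0 < n -> wf_circuit n (C n))
    (uniC : logspace_uniform C) :
  exists (prover preprocess evaluate interact : prog) (K : nat),
  forall (F : finFieldType) (n : nat), 0 < n ->
  let S := csize n (C n) in
  let d := depth (C n) in
  let W := S ^ K in
  let M := K * (d * up_log 2 S) in
  (forall (x : seq F) (coins : nat -> F), size x <= n ->
     exists (t : nat) (s : state F),
       [/\ runs (Env (description n (C n)) x (fun=> 0%R) coins) W W
             prover (start F) t s,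
           t <= K * (S * up_log 2 S)
         & trace s = conversation n (C n) coins
                       (nth 0%R (honest_messages n (C n) coins x))]) /\
  (forall coins : nat -> F,
     exists (t1 : nat) (s1 : state F),
       [/\ runs (Env [:: n] [::] coins (fun=> 0%R)) W M
             preprocess (start F) t1 s1,
           t1 <= K * S ^ K,
           trace s1 = [::]
         & forall (x : seq F) (msgs : nat -> F), size x <= n ->
             exists (t2 t3 : nat) (s2 s3 : state F),
               [/\ runs (Env [:: n] x coins msgs) W M evaluate s1 t2 s2,
                   freg s2 0 = ((mle (layer_fun n (C n) x d)).@[
                                 fun j => point n (C n) coins d j])%R,
                   trace s2 = [::]
                 & t2 <= K * (n * up_log 2 n.+1)] /\
               [/\ runs (Env [:: n] x coins msgs) W M interact s2 t3 s3,
                   trace s3 = swap_view (conversation n (C n) coins msgs),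
                   (ireg s3 0 != 0) = accepts n (C n) coins msgs x,
                   t3 <= K * (d * up_log 2 S)
                 & t2 + t3 <= K * (n * up_log 2 n + d * up_log 2 S)]]).
Proof.
have [M [K0 uni]] := uniC.
pose nQ := #|tm_state M|; pose nG := #|tm_sym M|; pose e0 := get_exp M K0.
(* The requirements come from the prover's time, from the exponents of all polynomial bounds, from
   the sixteen interleaved arrays of the verifier, and from the numbers of states and symbols that
   must fit in a word. *)
have [K [KT Ke K16 Kg]] : exists K, [/\ 5 * 4000 <= K, e0 + 30 <= K, 16 * (K0 + 8) <= K & nQ + nG <= K].
  exists (5 * 4000 + (e0 + 30) + 16 * (K0 + 8) + (nQ + nG)).
  by move: (5 * 4000) => c; split; lia.
exists (compile prover_cmd 50), (compile (pre_cmd (get_prog M)) 50),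
  (compile evaluate_cmd 50), (compile interact_cmd 50), K => F n n0.
have wf := wfC n n0; set D := C n in wf *.
have {uni} [T [cs [cs0 csS csT cs_pos csO]]] := generates_run (uni n n0).
rewrite -/D in cs_pos csO *.
set S := csize n D; set d := depth D; set W := S ^ K; set L := up_log 2 S.
have S2 : 2 <= S := S_ge2 wf.
have L0 : 0 < L := L_gt0 wf; have d0 : 0 < d by case: wf.
have LS : L < S := L_lt wf; have dS : d < S := depth_lt wf.
have nS : n <= S by rewrite /S csizeE leq_addl.
have K30 : 30 <= K by apply: leq_trans Ke; rewrite leq_addl.
have pW c p : c <= S ^ p -> p <= K -> c <= W.
  by move=> h pK; apply: leq_trans h _; apply: pow_mono.
have S1 : S <= S ^ 1 by rewrite expn1.
have w16 : 16 <= W by apply: (pW _ 4); [exact: (pow_const S2 (isT : 16 <= 2 ^ 4))|lia].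
split.
- move=> x coins xn.
  (* Only time is limited for the prover; a quadratic array length leaves room for the coefficient
     table of the line. *)
  pose N := 10 * S * S.
  have NW : 16 * N <= W.
    apply: (pW _ (4 + (4 + 1 + 1))); last by lia.
    apply: pow_mul => //; first exact: (pow_const S2 (isT : 16 <= 2 ^ 4)).
    by apply: pow_mul => //; apply: pow_mul => //; exact: (pow_const S2 (isT : 10 <= 2 ^ 4)).
  have H := prover_cmdP coins wf xn (erefl (description n D)) NW (leqnn _).
  have [t [l [s [r R [ht hl] _]]]] := wp_runs NW NW w16 (leqnn 50) (isT : cwf prover_cmd) (rel_start F W) H.
  exists t, l; split=> //.
    by apply: leq_trans ht _; rewrite leq_mul2r KT orbT.
  by case: R => _ _ [_ _ ->].
move=> coins; set Mc := K * (d * L).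
(* [8 * (d * L)] cells hold the coins and the per-layer data, and the part with [K0] covers the
   simulated tape of [K0 * L] cells. *)
pose N := (K0 + 8) * (d * L).
have dL0 : 0 < d * L by rewrite muln_gt0 d0.
have NM : 16 * N <= Mc by rewrite /N /Mc mulnA leq_mul2r K16 orbT.
have NW : 16 * N <= W.
  apply: (pW _ (4 + ((K0 + 3).+1 + (1 + 1)))); last by rewrite /e0 /get_exp in Ke; lia.
  apply: pow_mul; first exact: (pow_const S2 (isT : 16 <= 2 ^ 4)).
  apply: pow_mul; first exact: (pow_add S2 (pow_any S2 K0) (pow_const S2 (isT : 8 <= 2 ^ 3))).
  by apply: pow_mul; rewrite expn1; apply: ltnW.
have DN : 8 * (d * L) <= N by rewrite /N leq_mul2r leq_addl orbT.
have SW : 20 * S <= W.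
  apply: (pW _ (5 + 1)); last by lia.
  by apply: pow_mul; [exact: (pow_const S2 (isT : 20 <= 2 ^ 5))|].
have BW : 3 * (8 * S) + 3 <= W.
  apply: (pW _ (5 + 1)); last by lia.
  apply: leq_trans (_ : 32 * S <= _); first by lia.
  by apply: pow_mul; [exact: (pow_const S2 (isT : 32 <= 2 ^ 5))|].
have [QW GW] : nQ <= W /\ nG <= W.
  by split; [apply: (pW _ nQ (pow_any S2 _))|apply: (pW _ nG (pow_any S2 _))]; lia.
have nW : n < W by lia.
have spN : K0 * L <= N by rewrite /N; apply: leq_mul; [lia|rewrite leq_pmull].
have sp0 : 0 < K0 * L by apply: leq_ltn_trans (cs_pos 0 (leq0n T)).
have GP (s : store F) : iv s 1 = n -> iv s 28 < size (description n D) ->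
  wp (Env [:: n] [::] coins (fun=> 0%R)) W N (get_prog M) s (fun t s' => [/\
    t <= get_time M T, iv s' 26 = nth 0 (description n D) (iv s 28) & frame get_mods s s']).
  move=> h1 h2; apply: (get_progP _ (leqnn _) (leqnn _) QW GW nW NW spN sp0 BW cs0 csS csT cs_pos csO h1 h2).
    have od : off n D d <= S by rewrite /S csizeE leq_addr.
    rewrite size_description -/d -/S; clear - od dS S2; lia.
  have nl := nth_description_le wf (iv s 28); rewrite -/S in nl *; move: (nth _ _ _) (S) nl S2 => a b; lia.
have H1 := pre_cmdP wf NW DN SW (erefl _) (tame_get M) GP.
have wf1 : cwf (pre_cmd (get_prog M)).
  by apply: cwf_pre_cmd; case: (tame_get M) => _ _ _ _ /andP[].
have [t1 [l1 [s1 [r1 R1 [ht1 rd1] _]]]] := wp_runs NM NW w16 (leqnn 50) wf1 (rel_start F W) H1.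
exists t1, l1; split=> //.
- apply: leq_trans (_ : W <= _); last by rewrite leq_pmull //; lia.
  apply: leq_trans ht1 _; rewrite -/S.
  have T1 := get_time_le wf cs0 csS csT cs_pos; rewrite -/e0 -/S in T1.
  apply: (pW _ ((4 + e0 + (12 + 1)).+1 + (1 + 1))); last by lia.
  apply: pow_mul; last by apply: pow_mul.
  apply: pow_add => //; apply: pow_mul => //; last exact: (pow_const S2 (isT : 4000 <= 2 ^ 12)).
  exact: (pow_const S2 (isT : 10 <= 2 ^ 4)).
- by case: R1 => _ _ [_ _ ->]; case: rd1 => _ _ _ _ [].
move=> x msgs xn.
have H2 := evaluate_cmdP wf NW DN SW msgs xn rd1.
have [t2 [l2 [s2 [r2 R2 [ht2 hv2 f2] _]]]] := wp_runs NM NW w16 (leqnn 50) (isT : cwf evaluate_cmd) R1 H2.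
(* Evaluation writes to scratch registers only, so everything prepared for the interaction survives
   it. *)
have rd2 : ready n D coins s2.
  case: rd1 => h1 h2 h3 h4 [h5 h6 h7 h8 h9].
  split; [by frame_step|by frame_step|by frame_step|by frame_step|].
  by split; frame_step.
have H3 := interact_cmdP wf NW DN SW msgs xn rd2 hv2.
have [t3 [l3 [s3 [r3 R3 [ht3 hl3 ha3] _]]]] := wp_runs NM NW w16 (leqnn 50) (isT : cwf interact_cmd) R2 H3.
exists t2, t3, l2, l3.
have nL : up_log 2 n <= up_log 2 n.+1 by apply: leq_up_log.
have nL1 : 0 < up_log 2 n.+1 by rewrite up_log_gt0.
have K1000 : 1000 <= K by move: KT; clear; lia.
rewrite up_log_width in ht2; rewrite -/d -/S -/L in ht3.
do 2!split=> //.
- by case: R2 => R _ _ _ _; case: (R 0 isT) => _ ->.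
- by case: R2 => _ _ [_ _ ->] _ _; case: rd2 => _ _ _ _ [].
- apply: leq_trans ht2 _; apply: leq_trans (_ : 1000 * (n * up_log 2 n.+1) <= _); last by rewrite leq_mul2r K1000 orbT.
  have q1 : n * up_log 2 n <= n * up_log 2 n.+1 by rewrite leq_mul2l nL orbT.
  have q2 : n <= n * up_log 2 n.+1 by rewrite leq_pmulr.
  move: (n * up_log 2 n.+1) q1 q2 => z; rewrite mulnDr mulnCA; move: (n * up_log 2 n) => y; lia.
- by case: R3 => _ _ [_ _ ->].
- by case: R3 => R _ _ _ _; case: (R 0 isT) => ->.
- by apply: leq_trans ht3 _; rewrite leq_mul2r; apply/orP; right; lia.
apply: leq_trans (_ : 1000 * (n * up_log 2 n + d * L) <= _); last by rewrite leq_mul2r K1000 orbT.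
(* For [n = 1] the logarithm vanishes; the extra 1 is paid by [d * L], which is positive. *)
have q : n <= n * up_log 2 n + 1.
  have [n1|n1] := leqP n 1; first by lia.
  have : n <= n * up_log 2 n by rewrite leq_pmulr // up_log_gt0.
  by lia.
move: ht2; rewrite mulnDr mulnCA; move: (n * up_log 2 n) (d * L) q ht3 dL0 => y z; lia.
Qed.
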